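(* Let $\{\overline H_\lambda:\lambda>0\}$ be a family of measurable subsets of $\mathbb R^d$ with $\overline H_\lambda=-\overline H_\lambda$, $0\notin\overline H_\lambda$ and $\ell(\overline H_\lambda\cap Q_1)>0$ for every $\lambda>0$. Let $\psi,\check\psi,\hat\psi$ and $F_\lambda,F_{1,\lambda},F_{2,\lambda},\widetilde F_\lambda$ be defined as in the context. Assume that $\check\psi(\lambda)\asymp\hat\psi(\lambda)$, that $\lambda\psi(\lambda)\to0$ as $\lambda\to\infty$, and that the mapping $\lambda\mapsto\lambda^2\psi(\lambda)$ does not diverge to infinity as $\lambda\to\infty$. Then there exists a sequence $\{\lambda_n\}$ such that $\lim_{n\to\infty}\lambda_n=\infty$ and the following properties hold. (i) $\lim_{n\to\infty}\mathrm{Var}(F_{\lambda_n})=\lim_{n\to\infty}\mathrm{Var}(F_{2,\lambda_n})=2c$, where $c$ is a nonnegative (finite) constant possibly depending on the sequence $\{\lambda_n\}$. (ii) If $c=0$, then $E[|\widetilde F_{\lambda_n}|]\to0$ as $n\to\infty$. (iii) If $c>0$, then $F_{2,\lambda_n}$, and therefore $F_{\lambda_n}-E[F_{\lambda_n}]$, converges in distribution as $n\to\infty$ to $X=2P(c/2)$, where $P(c/2)$ denotes a centered Poisson random variable with parameter $c/2$ (that is, a Poisson random variable of mean $c/2$ minus $c/2$). In particular, the family $\{\widetilde F_\lambda\}$ does not satisfy a CLT (i.e. does not converge in distribution to $\mathscr N(0,1)$) as $\lambda\to\infty$.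
   Context: $d\ge1$ is a fixed integer, $\ell$ is Lebesgue measure on $\mathbb R^d$, $Q_\lambda=[-\frac12\lambda^{1/d},\frac12\lambda^{1/d}]^d$, and $W=Q_1$. For $\lambda>0$, $\eta_\lambda$ is a Poisson measure on $\mathbb R^d$ with control (intensity) measure $\lambda\ell$, and $H_\lambda=\{(x,y)\in(\mathbb R^d)^2:x-y\in\overline H_\lambda\}$. $F_\lambda=\sum_{x,y\in\eta_\lambda\cap W,\,x\ne y}\mathbf 1_{x-y\in\overline H_\lambda}$ (sum over ordered pairs, so $\frac12F_\lambda$ is the number of edges of the graph with vertex set $\eta_\lambda\cap W$ in which $x,y$ are joined iff $x-y\in\overline H_\lambda$), and $\widetilde F_\lambda=(F_\lambda-E[F_\lambda])/\sqrt{\mathrm{Var}(F_\lambda)}$. Its chaotic decomposition is $F_\lambda=E[F_\lambda]+F_{1,\lambda}+F_{2,\lambda}$, $F_{i,\lambda}=I_i(f_{i,\lambda})$, where $I_i$ is the multiple Wiener–Itô integral of order $i$ with respect to $\eta_\lambda-\lambda\ell$, $f_{2,\lambda}(x,y)=\mathbf 1_{H_\lambda\cap(W\times W)}(x,y)$ and $f_{1,\lambda}(x)=2\lambda\int_{\mathbb R^d}\mathbf 1_{H_\lambda\cap(W\times W)}(x,y)\,dy$. Occupation coefficients: $\psi(\lambda)=\ell(\overline H_\lambda\cap Q_1)$, $\check\psi(\lambda)=\ell(\overline H_\lambda\cap Q_{1/2^d})$, $\hat\psi(\lambda)=\ell(\overline H_\lambda\cap Q_{2^d})$. Notation: $\gamma_\lambda\asymp\delta_\lambda$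 means that there are constants $C,C'>0$ with $C\gamma_\lambda\le\delta_\lambda\le C'\gamma_\lambda$ for $\lambda$ sufficiently large. *)

(* Defs.v *)
From HB Require Import structures.
From mathcomp Require Import all_boot all_order all_algebra.
From mathcomp Require Import all_classical all_reals all_analysis.
From mathcomp Require Import measurable_realfun.

Set Implicit Arguments.
Unset Strict Implicit.
Unset Printing Implicit Defensive.

Import Order.TTheory GRing.Theory Num.Theory.
Import numFieldNormedType.Exports.

Local Open Scope classical_set_scope.
Local Open Scope ring_scope.

(* R^d is the type of d-tuples of reals, with the product of the Borel
   sigma-algebras. *)
Notation Rd R d := (d.-tuple (measurableTypeR R)).

Section lebesgue_Rd.
Local Open Scope ereal_scope.
Context (R : realType).

Section cons_measure.
Context (n : nat) (nu : {sigma_finite_measure set (Rd R n) -> \bar R}).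

Definition tcons (p : measurableTypeR R * Rd R n) : Rd R n.+1 :=
  [tuple of p.1 :: p.2].

Lemma measurable_tcons : measurable_fun [set: measurableTypeR R * Rd R n] tcons.
Proof. exact: (measurable_cons measurable_fst measurable_snd). Qed.

Definition cons_measure : set (Rd R n.+1) -> \bar R :=
  pushforward (lebesgue_measure \x nu) tcons.

Let cons_measure0 : cons_measure set0 = 0.
Proof. by rewrite /cons_measure /pushforward preimage_set0 measure0. Qed.

Let cons_measure_ge0 A : 0 <= cons_measure A.
Proof. exact: (measure_ge0 (lebesgue_measure \x nu)). Qed.

Let cons_measure_sigma_additive : semi_sigma_additive cons_measure.
Proof.
move=> F mF tF mUF; rewrite /cons_measure /pushforward preimage_bigcup.
have mt (A : set (Rd R n.+1)) :
    measurable A -> measurable (tcons @^-1` A).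
  by move=> mA; rewrite -[X in measurable X]setTI; exact: measurable_tcons.
apply: measure_semi_sigma_additive.
- by move=> k; exact: mt.
- apply/trivIsetP => /= i j _ _ ij; rewrite -preimage_setI.
  by move/trivIsetP : tF => /(_ _ _ _ _ ij) ->//; rewrite preimage_set0.
- by rewrite -preimage_bigcup; exact: mt.
Qed.

HB.instance Definition _ := isMeasure.Build _ _ _ cons_measure
  cons_measure0 cons_measure_ge0 cons_measure_sigma_additive.

Let cons_measure_sigma_finite : sigma_finite setT cons_measure.
Proof.
have /sigma_finiteP[F [TF ndF Foo]] := sigma_finiteT (@lebesgue_measure R).
have /sigma_finiteP[G [TG ndG Goo]] := sigma_finiteT nu.
pose g (x : Rd R n.+1) : measurableTypeR R * Rd R n :=
  (tnth x ord0, [tuple of behead x]).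
have gK : cancel tcons g.
  by case=> a x; rewrite /g /tcons/=; congr pair; exact: val_inj.
have mg : measurable_fun setT g.
  apply/measurable_fun_pairP; split.
    exact: measurable_tnth.
  exact: measurable_behead.
exists (fun k => g @^-1` (F k `*` G k)).
  rewrite -preimage_bigcup -[LHS](preimage_setT g); congr (g @^-1` _).
  rewrite -setXTT TF TG predeqE => -[x y]; split.
    move=> [/= [i _ Fix] [j _ Gjy]]; exists (maxn i j) => //; split.
    - by move: x Fix; exact/subsetPset/ndF/leq_maxl.
    - by move: y Gjy; exact/subsetPset/ndG/leq_maxr.
  by move=> [i _ []/= ? ?]; split; exists i.
move=> k; have [mF Fk] := Foo k; have [mG Gk] := Goo k; split.
  by rewrite -[X in measurable X]setTI; apply: mg => //; exact: measurableX.
rewrite /cons_measure /pushforward -comp_preimage.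
rewrite (_ : g \o tcons = id); last by apply/funext => p; exact: gK.
rewrite preimage_id product_measure1E//.
by rewrite lte_mul_pinfty// ge0_fin_numE.
Qed.

HB.instance Definition _ := Measure_isSigmaFinite.Build _ _ _ cons_measure
  cons_measure_sigma_finite.

End cons_measure.

Fixpoint lebesgue_Rd (d : nat) : {sigma_finite_measure set (Rd R d) -> \bar R} :=
  match d with
  | 0 => \d_([tuple] : Rd R 0)
  | n.+1 => cons_measure (lebesgue_Rd n)
  end.


Lemma lebesgue_Rd_box (d : nat) (A : 'I_d -> set (measurableTypeR R)) :
  (forall i, measurable (A i)) ->
  lebesgue_Rd d [set x | forall i, A i (tnth x i)] =
  \prod_(i < d) lebesgue_measure (A i).
Proof.
elim: d A => [|d IHd] A mA.
  by rewrite big_ord0 /= diracE mem_set//= => -[].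
rewrite big_ord_recl -IHd//= /cons_measure /pushforward.
rewrite (_ : _ @^-1` _ =
    A ord0 `*` [set x : Rd R d | forall i, A (lift ord0 i) (tnth x i)]).
  rewrite product_measure1E//.
  rewrite (_ : [set _ | _] = \bigcap_(i in [set: 'I_d])
      ((fun x : Rd R d => tnth x i) @^-1` A (lift ord0 i))).
    apply: fin_bigcap_measurable => // i _.
    by rewrite -[X in measurable X]setTI; apply: measurable_tnth.
  by apply/seteqP; split => [x Ax i _|x Ax i]; exact: Ax.
apply/seteqP; split => [[a x] /= Ax|[a x] /= [A0 Ax] i].
  split=> [|i]; first by have := Ax ord0; rewrite tnth0.
  by have := Ax (lift ord0 i); rewrite tnthS.
by case: (unliftP ord0 i) => [j ->|->]; rewrite ?tnthS ?tnth0.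
Qed.

End lebesgue_Rd.

Section intensity.
Local Open Scope ereal_scope.
Context (R : realType) (d : nat).

(* The absolute value turns lam into a nonnegative scalar, as mscale requires;
   only positive values of lam are used. *)
Definition intensity (lam : R) : set (Rd R d) -> \bar R :=
  mscale (NngNum (normr_ge0 lam)) (lebesgue_Rd R d).

HB.instance Definition _ (lam : R) := Measure.on (intensity lam).

Let intensity_sigma_finite (lam : R) : sigma_finite setT (intensity lam).
Proof.
have [F TF Foo] := sigma_finiteT (lebesgue_Rd R d).
exists F => // k; have [mF Fk] := Foo k; split => //.
by rewrite /intensity /mscale/= lte_mul_pinfty.
Qed.

HB.instance Definition _ (lam : R) :=
  Measure_isSigmaFinite.Build _ _ _ (intensity lam)
    (@intensity_sigma_finite lam).

End intensity.
Arguments intensity {R} d lam.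

Section poisson_measure.
Local Open Scope ereal_scope.
Context (R : realType) (dO dE : measure_display) (Omega : measurableType dO)
  (E : measurableType dE) (P : probability Omega R).

(* A kernel from Omega to E is a random measure on E. [poisson_prob r _] is the
   Poisson law of parameter r (the Dirac mass at 0 if r = 0); its nat argument
   is not used. *)
Definition poisson_measure (eta : R.-ker Omega ~> E)
    (mu : {measure set E -> \bar R}) : Prop :=
  (forall A, measurable A -> mu A < +oo -> forall k : nat,
     P [set w | eta w A = k%:R%:E] = poisson_prob (fine (mu A)) 0%N [set k])
  /\
  (forall (n : nat) (A : 'I_n -> set E),
     (forall i, measurable (A i)) -> (forall i, mu (A i) < +oo) ->
     trivIset setT A ->
     forall B : 'I_n -> set (\bar R), (forall i, measurable (B i)) ->
       P (\bigcap_(i in setT) [set w | B i (eta w (A i))]) =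
       \prod_(i < n) P [set w | B i (eta w (A i))]).

Definition atoms (m : {measure set E -> \bar R}) : set E :=
  [set x | 0 < m [set x]].

End poisson_measure.

(* I_1 and I_2 are the continuous extensions to L^2(mu) and L^2(mu \x mu) of the
   maps defined on step functions by
     \1_A |-> (eta - mu) A   and   \1_(A `*` B) |-> (eta - mu) A * (eta - mu) B
   for disjoint A and B. Accordingly [wiener_itoN f X] says that (f, X) is in
   the L^2-closure of the graph of this map, i.e. that X = I_N(f) a.s. *)
Section wiener_ito.
Context (R : realType) (dO dE : measure_display) (Omega : measurableType dO)
  (E : measurableType dE) (P : probability Omega R) (eta : R.-ker Omega ~> E)
  (mu : {sigma_finite_measure set E -> \bar R}).

Definition compensated (A : set E) (w : Omega) : R :=
  fine (eta w A) - fine (mu A).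

Definition step_sets (n : nat) (A : 'I_n -> set E) : Prop :=
  [/\ forall i, measurable (A i), forall i, (mu (A i) < +oo)%E
    & trivIset setT A].

Definition step1 (n : nat) (a : 'I_n -> R) (A : 'I_n -> set E) (x : E) : R :=
  \sum_(i < n) a i * \1_(A i) x.

Definition step_integral1 (n : nat) (a : 'I_n -> R) (A : 'I_n -> set E)
    (w : Omega) : R :=
  \sum_(i < n) a i * compensated (A i) w.

Definition wiener_ito1 (f : E -> R) (X : Omega -> R) : Prop :=
  [/\ measurable_fun setT f, measurable_fun setT X
    & forall e : R, 0 < e -> exists (n : nat) (a : 'I_n -> R) (A : 'I_n -> set E),
      [/\ step_sets A,
          (\int[mu]_x ((f x - step1 a A x) ^+ 2)%R%:E < e%:E)%E
        & ('E_P[fun w => ((X w - step_integral1 a A w) ^+ 2)%R] < e%:E)%E]].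

Definition step2 (n : nat) (a : 'I_n -> 'I_n -> R) (A : 'I_n -> set E)
    (z : E * E) : R :=
  \sum_(i < n) \sum_(j < n | i != j) a i j * (\1_(A i) z.1 * \1_(A j) z.2).

Definition step_integral2 (n : nat) (a : 'I_n -> 'I_n -> R)
    (A : 'I_n -> set E) (w : Omega) : R :=
  \sum_(i < n) \sum_(j < n | i != j)
    a i j * (compensated (A i) w * compensated (A j) w).

Definition wiener_ito2 (f : E * E -> R) (X : Omega -> R) : Prop :=
  [/\ measurable_fun setT f, measurable_fun setT X
    & forall e : R, 0 < e ->
      exists (n : nat) (a : 'I_n -> 'I_n -> R) (A : 'I_n -> set E),
      [/\ step_sets A,
          (\int[mu \x mu]_z ((f z - step2 a A z) ^+ 2)%R%:E < e%:E)%E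
        & ('E_P[fun w => ((X w - step_integral2 a A w) ^+ 2)%R] < e%:E)%E]].

End wiener_ito.

Section edge_counting.
Context (R : realType) (d : nat).

Definition tzero : Rd R d := [tuple 0 : R | _ < d].

Definition topp (x : Rd R d) : Rd R d := [tuple - (tnth x i : R) | i < d].

Definition tsub (x y : Rd R d) : Rd R d :=
  [tuple (tnth x i : R) - tnth y i | i < d].

(* The closed cube centered at the origin with volume v. *)
Definition cube (v : R) : set (Rd R d) :=
  [set x | forall i, `|tnth x i : R| <= 2^-1 * v `^ (d%:R^-1)].

(* m takes nonnegative integer values on bounded sets, i.e. it is a locally
   finite sum of Dirac masses. *)
Definition locally_finite_point_measure (m : {measure set (Rd R d) -> \bar R}) :=
  forall (v : R) (A : set (Rd R d)), measurable A -> A `<=` cube v ->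
    exists k : nat, m A = k%:R%:E.

Definition occupation (Hbar : R -> set (Rd R d)) (v lam : R) : R :=
  fine (lebesgue_Rd R d (Hbar lam `&` cube v)).

Definition ordered_edges (H : set (Rd R d)) (V : set (Rd R d)) :
    set (Rd R d * Rd R d) :=
  [set p | [/\ V p.1, V p.2, p.1 <> p.2 & H (tsub p.1 p.2)]].

(* A sum over a set is 0 by convention when its support is infinite; for a
   locally finite eta the set of pairs below is always finite. *)
Definition edge_stat (dO : measure_display) (Omega : measurableType dO)
    (eta : R -> R.-ker Omega ~> Rd R d) (Hbar : R -> set (Rd R d))
    (lam : R) (w : Omega) : R :=
  \sum_(p \in ordered_edges (Hbar lam) (atoms (eta lam w) `&` cube 1)) (1 : R).

(* I_1 and I_2 of these kernels are the chaotic components of edge_stat. *)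
Definition kernel2 (Hbar : R -> set (Rd R d)) (lam : R) : Rd R d * Rd R d -> R :=
  \1_[set z | [/\ cube 1 z.1, cube 1 z.2 & Hbar lam (tsub z.1 z.2)]].

Definition kernel1 (Hbar : R -> set (Rd R d)) (lam : R) (x : Rd R d) : R :=
  2 * lam * (\int[lebesgue_Rd R d]_y kernel2 Hbar lam (x, y))%R.

End edge_counting.
Arguments tzero {R d}.
Arguments cube {R d} v.

Section convergence.
Context (R : realType).

Definition asymp (g h : R -> R) : Prop :=
  exists C C' : R, [/\ 0 < C, 0 < C' &
    \forall lam \near +oo, C * g lam <= h lam <= C' * g lam].

Definition standardize (d : measure_display) (T : measurableType d)
    (P : probability T R) (X : T -> R) (w : T) : R :=
  (X w - fine 'E_P[X]) / Num.sqrt (fine 'V_P[X]).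

(* Weak convergence of the laws of the X i along F to the law of Y, where Y is
   a random variable on a probability space of its own. *)
Definition cvg_in_law (d : measure_display) (T : measurableType d)
    (P : probability T R) (I : Type) (F : set_system I) (X : I -> T -> R)
    (d' : measure_display) (T' : measurableType d') (Q : probability T' R)
    (Y : T' -> R) : Prop :=
  forall h : R -> R, continuous h -> (exists M : R, forall x, `|h x| <= M) ->
    ('E_P[h \o X i])%E @[i --> F] --> ('E_Q[h \o Y])%E.

End convergence.

(* Main.v *)
Require Import Defs.
From HB Require Import structures.
From mathcomp Require Import all_boot all_order all_algebra.
From mathcomp Require Import all_classical all_reals all_analysis.
From mathcomp Require Import measurable_realfun.
From mathcomp Require Import ring lra zify.

(* Let G be the number of ordered edges, a = E[G], and let D be lambda times
   psi_hat, which bounds the mean degree of every point. For each fixed lambda,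
   an L^2-approximation of the kernel of F_2 by a step kernel yields, by majority
   vote on each product of two cells, a finite graph on the cells whose
   edge count G' = sum h_ij X_i X_j in the independent Poisson counts X_i is close to
   G in L^1. For G', the Mecke identity E[X_i phi(X)] = p_i E[phi(X + e_i)] gives
   E[(G' - a - F_2)^2] = O(D a) and
     |m P(G' = m) - a P(G' + 2 = m)| <= 4 D a,
   and both estimates pass to G. Hence Var(F) = 2a + O(a sqrt D), and along a
   sequence with D -> 0 and a -> c the recursion makes the law of G/2 converge to
   the Poisson law of parameter c/2. Such a sequence exists because
   a <= lambda^2 psi_hat and D <= C' lambda psi. Finally, since G >= 0, the
   standardized count is at least -a / sqrt(Var F), hence bounded below along the
   sequence, and this excludes a Gaussian limit. *)

Set Implicit Arguments.
Unset Strict Implicit.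
Unset Printing Implicit Defensive.

Import Order.TTheory GRing.Theory Num.Theory.
Import numFieldNormedType.Exports.

Local Open Scope classical_set_scope.
Local Open Scope ring_scope.

(** * Expectations of real functions *)

(** [F2] is given only as an L^2 limit of step integrals, so all computations are made on finitely
    many independent Poisson counts, with bounds that do not depend on the step kernel. Its
    coefficients are real, while the recursion needs a count: rounding them to 0 or 1 makes G' a
    natural number. Rounding by majority at most doubles the squared error, and also the degrees,
    since a chosen product of cells is filled at least by half by the edge set. The recursion shifts
    by 2 because each edge is counted in both orders: inserting the two endpoints of an edge adds 2,
    plus twice their degrees, which are rarely nonzero. Hence odd values disappear in the limit.
    Since G is close to G' only in L^1, squares pass to the limit through truncations. The sum over
    atoms that defines F is not known to be measurable. It is replaced by the mass that the product
    of the point measure with itself gives to the edge set. The two agree almost surely because all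
    atoms are simple, which follows from the mean mass of the diagonal. *)

Section expectation.
Context (R : realType) (dO : measure_display) (Omega : measurableType dO)
  (P : probability Omega R).

Implicit Types (f g : Omega -> R) (k : R).

Definition itg (f : Omega -> R) : Prop := P.-integrable setT (EFin \o f).

Definition Ex (f : Omega -> R) : R := \int[P]_w f w.

Lemma itg_meas f : itg f -> measurable_fun setT f.
Proof. by move/measurable_int/measurable_EFinP. Qed.

Lemma ExE f : itg f -> (\int[P]_w (f w)%:E = (Ex f)%:E)%E.
Proof. by move=> If; rewrite /Ex /Rintegral fineK//; exact: integrable_fin_num. Qed.

Lemma itgD f g : itg f -> itg g -> itg (fun w => f w + g w).
Proof. by move=> If Ig; exact: (integrableD measurableT If Ig). Qed.

Lemma itgB f g : itg f -> itg g -> itg (fun w => f w - g w).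
Proof. by move=> If Ig; exact: (integrableB measurableT If Ig). Qed.

Lemma itgZ k f : itg f -> itg (fun w => k * f w).
Proof. by move=> If; exact: (integrableZl measurableT k If). Qed.

Lemma itg_cst k : itg (fun=> k).
Proof. exact: finite_measure_integrable_cst. Qed.

Lemma itg_sum I (s : seq I) (Q : pred I) (f : I -> Omega -> R) :
  (forall i, Q i -> itg (f i)) -> itg (fun w => \sum_(i <- s | Q i) f i w).
Proof.
move=> If; have := @integrable_sum _ _ _ P _ measurableT _ s Q
  (fun i => EFin \o f i) If.
by apply: eq_integrable => // w _ /=; rewrite sumEFin.
Qed.

Lemma itg_le f g : measurable_fun setT f -> (forall w, `|f w| <= g w) ->
  itg g -> itg f.
Proof.
move=> mf fg Ig; apply: le_integrable Ig => //; first exact/measurable_EFinP.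
move=> w _ /=; rewrite lee_fin; apply: le_trans (fg w) _; exact: ler_norm.
Qed.

Lemma itg_abs f : itg f -> itg (fun w => `|f w|).
Proof. by move=> If; exact: integrable_norm. Qed.

Lemma ExD f g : itg f -> itg g -> Ex (fun w => f w + g w) = Ex f + Ex g.
Proof. by move=> If Ig; exact: RintegralD. Qed.

Lemma ExB f g : itg f -> itg g -> Ex (fun w => f w - g w) = Ex f - Ex g.
Proof. by move=> If Ig; exact: RintegralB. Qed.

Lemma ExZ k f : itg f -> Ex (fun w => k * f w) = k * Ex f.
Proof. by move=> If; exact: RintegralZl. Qed.

Lemma Ex_cst k : Ex (fun=> k) = k.
Proof. by rewrite /Ex Rintegral_cst//= probability_setT mulr1. Qed.

Lemma Ex_sum I (s : seq I) (Q : pred I) (f : I -> Omega -> R) :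
  (forall i, Q i -> itg (f i)) ->
  Ex (fun w => \sum_(i <- s | Q i) f i w) = \sum_(i <- s | Q i) Ex (f i).
Proof.
move=> If; elim: s => [|i s IHs].
  by under [X in Ex X]eq_fun do rewrite big_nil; rewrite Ex_cst big_nil.
rewrite big_cons -IHs; case: ifPn => Qi.
  rewrite -ExD//; last exact: itg_sum.
    by congr Ex; apply/funext => w; rewrite big_cons Qi.
  exact: If.
by congr Ex; apply/funext => w; rewrite big_cons (negbTE Qi).
Qed.

Lemma Ex_le f g : itg f -> itg g -> (forall w, f w <= g w) -> Ex f <= Ex g.
Proof. by move=> If Ig fg; apply: le_Rintegral. Qed.

Lemma Ex_ge0 f : (forall w, 0 <= f w) -> 0 <= Ex f.
Proof. by move=> f0; exact: Rintegral_ge0. Qed.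

Lemma Ex_abs f : itg f -> `|Ex f| <= Ex (fun w => `|f w|).
Proof. by move=> If; exact: le_normr_Rintegral. Qed.

Lemma itg_bnd f M : measurable_fun setT f -> (forall w, `|f w| <= M) -> itg f.
Proof. by move=> mf fM; apply: (itg_le mf fM); exact: itg_cst. Qed.

Lemma Ex_indic A : measurable A -> Ex (\1_A) = fine (P A).
Proof. by move=> mA; rewrite /Ex /Rintegral integral_indic// setIT. Qed.

Lemma itg_indic A : measurable A -> itg (\1_A).
Proof. by move=> mA; apply: integrable_indic => //; rewrite fin_num_fun_lty. Qed.

Import HBNNSimple.

(* The integral of a function that is not known to be measurable is still
   determined by its values off a null set. *)
Lemma integral_off_null (N : set Omega) (f g : Omega -> \bar R) :
  measurable N -> P N = 0%E -> measurable_fun setT g ->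
  (forall w, ~ N w -> f w = g w) -> (\int[P]_w f w = \int[P]_w g w)%E.
Proof.
move=> mN N0 mg fg.
suff pos (u v : Omega -> \bar R) : (forall w, 0 <= u w)%E ->
    (forall w, 0 <= v w)%E -> measurable_fun setT v ->
    (forall w, ~ N w -> u w = v w) -> (\int[P]_w u w = \int[P]_w v w)%E.
  rewrite integralE [RHS]integralE; congr (_ - _)%E; apply: pos => //.
  - exact: measurable_funepos.
  - by move=> w Nw; rewrite !funeposE fg.
  - exact: measurable_funeneg.
  - by move=> w Nw; rewrite !funenegE fg.
move=> u0 v0 mv uv.
pose v' w := (v w * (\1_(~` N) w)%:E)%E.
have mv' : measurable_fun setT v'.
  apply: emeasurable_funM => //; apply/measurable_EFinP.
  exact: measurable_indic (measurableC mN).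
have vv' : (\int[P]_w v w = \int[P]_w v' w)%E.
  apply: ge0_ae_eq_integral => //.
    by move=> w _; rewrite /v' mule_ge0.
  exists N; split => // w /=; apply: contra_notP => Nw _.
  by rewrite /v' indicE mem_set//= mule1.
(* [u] need not be measurable, so integrals are compared as suprema over simple functions: one below
   [v'] is below [u], because [v'] vanishes on [N]; one below [u], once cut to 0 on [N], is below
   [v] and keeps its integral. *)
apply/eqP; rewrite eq_le; apply/andP; split; last first.
  rewrite vv' ge0_integralTE; last by move=> w; rewrite /v' mule_ge0.
  rewrite [leRHS]ge0_integralTE//; apply: ub_ereal_sup => _ [h hv <-].
  apply: ereal_sup_ubound; exists h => // w.
  apply: le_trans (hv w) _; rewrite /v' indicE.
  case: (boolP (w \in ~` N)) => [|_]; last by rewrite mule0.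
  by rewrite inE => Nw; rewrite mule1 uv.
rewrite ge0_integralTE//; apply: ub_ereal_sup => _ [h hu <-].
rewrite -integralT_nnsfun.
have -> : (\int[P]_w (h w)%:E = \int[P]_w ((h w)%:E * (\1_(~` N) w)%:E))%E.
  apply: ge0_ae_eq_integral => //.
  - exact/measurable_EFinP.
  - apply: emeasurable_funM; first exact/measurable_EFinP.
    by apply/measurable_EFinP; exact: measurable_indic (measurableC mN).
  - by move=> w _; rewrite lee_fin.
  - by move=> w _; rewrite mule_ge0// lee_fin.
  exists N; split => // w /=; apply: contra_notP => Nw _.
  by rewrite indicE mem_set//= mule1.
apply: ge0_le_integral => //.
- by move=> w _; rewrite mule_ge0// lee_fin.
- apply: emeasurable_funM; first exact/measurable_EFinP.
  by apply/measurable_EFinP; exact: measurable_indic (measurableC mN).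
move=> w _; rewrite indicE; case: (boolP (w \in ~` N)) => [|_]; last by rewrite mule0.
by rewrite inE => Nw; rewrite mule1 -uv.
Qed.

End expectation.

(** * Independent Poisson counts: Mecke formula and moments *)

Section poisson_weights.
Context (R : realType).

Definition pm (r : R) (k : nat) : R := fine (poisson_prob r 0%N [set k]).

Lemma pm_pos (r : R) k : 0 < r -> pm r k = poisson_pmf r k.
Proof.
move=> r0; rewrite /pm /poisson_prob r0 esum_set1//.
by rewrite lee_fin poisson_pmf_ge0.
Qed.

Lemma pm0 k : pm 0 k = (k == 0)%N%:R.
Proof.
rewrite /pm /poisson_prob ltxx diracE; case: eqVneq => [->|k0]; first by rewrite mem_set.
by rewrite memNset//= => k0'; rewrite k0' eqxx in k0.
Qed.

Lemma pmE (r : R) k : poisson_prob r 0%N [set k] = (pm r k)%:E.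
Proof. by rewrite /pm fineK// fin_num_measure. Qed.

Lemma pm_ge0 (r : R) k : 0 <= pm r k.
Proof. exact: fine_ge0. Qed.

(** One-step recursion of the Poisson weights. It is the source of the Mecke identity below and
    identifies the limit law at the end; the Dirac convention makes it valid for [r = 0]. *)
Lemma pmS (r : R) k : 0 <= r -> k.+1%:R * pm r k.+1 = r * pm r k.
Proof.
rewrite le_eqVlt => /predU1P[<-|r0]; first by rewrite !pm0 mulr0 mul0r.
rewrite !pm_pos// /poisson_pmf r0 factS natrM invfM exprS.
by field; rewrite pnatr_eq0 -lt0n fact_gt0/= -[X in X + _]/(1%:R) -natrD pnatr_eq0.
Qed.

End poisson_weights.

(** * Integration of functions of a countable-valued variable *)

Section law_on_countable.
Context (R : realType) (dO : measure_display) (Omega : measurableType dO)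
  (P : probability Omega R) (K : countType) (X : Omega -> K).
Hypothesis mX : forall k, measurable (X @^-1` [set k]).

(** A preimage is a countable union of fibres of [X], enumerated by their codes; hence every
    function of the counts is measurable. *)
Lemma measurable_countable_val d (T : measurableType d) (u : K -> T) :
  measurable_fun setT (fun w => u (X w)).
Proof.
move=> _ B mB; rewrite setTI.
have -> : (fun w => u (X w)) @^-1` B =
    \bigcup_(m : nat) (if unpickle m is Some k then
       if k \in u @^-1` B then X @^-1` [set k] else set0 else set0).
  apply/seteqP; split => [w /= uB|w [m _]].
    by exists (pickle (X w)) => //; rewrite pickleK mem_set.
  case: (unpickle m) => [k|//]; case: ifPn => // /[!inE] kB /= Xk.
  by rewrite Xk.
apply: bigcupT_measurable => m; case: (unpickle m) => [k|]; last exact: measurable0.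
by case: ifPn => // _; exact: measurable0.
Qed.

Lemma integral_countable_val (u : K -> \bar R) : (forall k, 0 <= u k)%E ->
  (\int[P]_w u (X w) = \esum_(k in [set: K]) (u k * P (X @^-1` [set k])))%E.
Proof.
move=> u0.
(* The fibres are indexed by codes in nat, so that countable additivity applies; a number that codes
   no value has an empty fibre. *)
pose F m := [set w | pickle (X w) = m].
have Fk k : F (pickle k) = X @^-1` [set k].
  apply/seteqP; split => w /=; last by move=> <-.
  by rewrite /F/= => /(pcan_inj pickleK).
have F0 m : ~ range (@pickle K) m -> F m = set0.
  by move=> h; apply/seteqP; split => // w; rewrite /F/= => Xm; apply: h; exists (X w).
have mF m : measurable (F m).
  by have [[k _ <-]|/F0 ->] := pselect (range (@pickle K) m); rewrite ?Fk.
have -> : [set: Omega] = \bigcup_m F m.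
  by apply/seteqP; split => // w _; exists (pickle (X w)).
rewrite ge0_integral_bigcup//; last 2 first.
- exact/measurable_funTS/measurable_countable_val.
- by apply/trivIsetP => i j _ _ ij; apply/seteqP; split => // w [] /= wi wj; rewrite -wi -wj eqxx in ij.
rewrite nneseries_esumT; last by move=> m; exact: integral_ge0.
have -> : (\esum_(i in [set: nat]) \int[P]_(x in F i) u (X x) =
    \esum_(i in range (@pickle K)) \int[P]_(x in F i) u (X x))%E.
  rewrite [RHS]esum_mkcond; apply: eq_esum => m _; case: ifPn => // /negP h.
  by rewrite F0 ?integral_set0// => h'; apply: h; rewrite inE.
rewrite (@reindex_esum _ _ _ [set: K] (range (@pickle K)) pickle); last first.
  split; first by move=> k _; exists k.
    by move=> x y _ _; exact: (pcan_inj pickleK).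
  by move=> _ [k _ <-]; exists k.
apply: eq_esum => k _; rewrite Fk.
rewrite (eq_integral (cst (u k))); last by move=> w /[!inE] /= ->.
by rewrite integral_cst.
Qed.

End law_on_countable.

Section poisson_vector.
Context (R : realType) (dO : measure_display) (Omega : measurableType dO)
  (P : probability Omega R) (n : nat) (X : Omega -> {ffun 'I_n -> nat})
  (p : 'I_n -> R).
Hypothesis p0 : forall i, 0 <= p i.
Hypothesis mX : forall k, measurable (X @^-1` [set k]).
Hypothesis lawX : forall k, P (X @^-1` [set k]) = (\prod_i pm (p i) (k i))%:E.
Notation vec := {ffun 'I_n -> nat}.
Implicit Types (x : vec) (i j : 'I_n) (phi psi : vec -> R).

Definition incr i x : vec := [ffun j => x j + (j == i)]%N.

Lemma incr_weight i x :
  (incr i x i)%:R * \prod_j pm (p j) (incr i x j) = p i * \prod_j pm (p j) (x j).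
Proof.
rewrite (bigD1 i)//= [in RHS](bigD1 i)//= !ffunE eqxx addn1 !mulrA pmS//.
by congr (_ * _); apply: eq_bigr => j /negbTE ji; rewrite ffunE ji addn0.
Qed.

(** Written as a sum over states: those with [x i = 0] contribute nothing, and [incr i] is a
    bijection from all states onto the others, along which [incr_weight] exchanges the factor [x i]
    for [p i]. *)
Lemma mecke_ge0 i (f : vec -> \bar R) : (forall x, 0 <= f x)%E ->
  (\int[P]_w ((X w i)%:R%:E * f (X w)) = (p i)%:E * \int[P]_w f (incr i (X w)))%E.
Proof.
move=> f0.
rewrite (integral_countable_val P mX (u := fun x => (x i)%:R%:E * f x)%E); last first.
  by move=> x; rewrite mule_ge0// lee_fin.
rewrite -ge0_integralZl//; last 2 first.
- exact: (measurable_countable_val mX (fun x => f (incr i x))).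
- by rewrite lee_fin.
rewrite (integral_countable_val P mX (u := fun x => (p i)%:E * f (incr i x))%E); last first.
  by move=> x; rewrite mule_ge0// lee_fin.
pose Q := [set x : vec | (0 < x i)%N].
have -> : (\esum_(k in [set: vec]) ((k i)%:R%:E * f k * P (X @^-1` [set k])) =
   \esum_(k in Q) ((k i)%:R%:E * f k * P (X @^-1` [set k])))%E.
  rewrite [RHS]esum_mkcond; apply: eq_esum => x _; case: ifPn => // /negP xQ.
  have : ~ (0 < x i)%N by move=> h; apply: xQ; rewrite inE.
  by move/negP; rewrite -eqn0Ngt => /eqP ->; rewrite !mul0e.
rewrite (@reindex_esum _ _ _ [set: vec] Q (incr i)); last first.
  split => [x _|x y _ _ xy|x Qx].
  - by rewrite /Q/= ffunE eqxx addn1.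
  - apply/ffunP => j; move/ffunP : xy => /(_ j); rewrite !ffunE; exact: addIn.
  - exists [ffun j => x j - (j == i)]%N => //; apply/ffunP => j; rewrite !ffunE.
    by case: eqP => [->|_] /=; rewrite ?subn0 ?addn0// subnK.
apply: eq_esum => x _; rewrite !lawX.
rewrite muleAC -EFinM incr_weight EFinM.
by rewrite [LHS]muleAC.
Qed.

Definition wt x : nat := (\sum_i x i)%N.

(** Polynomial growth in the total count: a class stable under sums, products and [incr], and
    integrable by [moment_lty], which settles the integrability of everything computed from the
    counts. *)
Definition polyb phi : Prop :=
  exists C m, forall x, `|phi x| <= C * (1 + (wt x)%:R) ^+ m.

Lemma wt_incr i x : wt (incr i x) = (wt x).+1.
Proof.
rewrite /wt (bigD1 i)//= [in RHS](bigD1 i)//= ffunE eqxx addn1 addSn; congr _.+1.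
by congr (_ + _)%N; apply: eq_bigr => j /negbTE ji; rewrite ffunE ji addn0.
Qed.

Lemma wt1_ge1 x : 1 <= 1 + (wt x)%:R :> R.
Proof. by rewrite lerDl. Qed.

Lemma polyb_bounds phi : polyb phi ->
  exists C m, 0 <= C /\ forall x, `|phi x| <= C * (1 + (wt x)%:R) ^+ m.
Proof.
move=> [C [m Cm]]; exists C, m; split => //.
have := Cm [ffun=> 0%N]; rewrite /wt big1; last by move=> i _; rewrite ffunE.
by rewrite addr0 expr1n mulr1; exact: le_trans.
Qed.

Lemma polyb_cst k : polyb (fun=> k).
Proof. by exists `|k|, 0%N => x; rewrite expr0 mulr1. Qed.

Lemma polybM phi psi : polyb phi -> polyb psi -> polyb (fun x => phi x * psi x).
Proof.
move=> [C [m Cm]] [D [l Dl]]; exists (C * D), (m + l)%N => x.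
by rewrite normrM exprD mulrACA ler_pM.
Qed.

Lemma polybD phi psi : polyb phi -> polyb psi -> polyb (fun x => phi x + psi x).
Proof.
move=> /polyb_bounds[C [m [C0 Cm]]] /polyb_bounds[D [l [D0 Dl]]].
exists (C + D), (m + l)%N => x.
rewrite (le_trans (ler_normD _ _))// mulrDl lerD//.
  rewrite (le_trans (Cm x))// ler_wpM2l// ler_weXn2l ?wt1_ge1 ?leq_addr//.
rewrite (le_trans (Dl x))// ler_wpM2l// ler_weXn2l ?wt1_ge1 ?leq_addl//.
Qed.

Lemma polyb_le phi psi : (forall x, `|phi x| <= `|psi x|) -> polyb psi -> polyb phi.
Proof. by move=> le [C [m Cm]]; exists C, m => x; rewrite (le_trans (le x)). Qed.

Lemma polybN phi : polyb phi -> polyb (fun x => - phi x).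
Proof. by apply: polyb_le => x; rewrite normrN. Qed.

Lemma polybB phi psi : polyb phi -> polyb psi -> polyb (fun x => phi x - psi x).
Proof. by move=> a b; apply: polybD => //; exact: polybN. Qed.

Lemma polyb_sum I (s : seq I) (Q : pred I) (f : I -> vec -> R) :
  (forall t, Q t -> polyb (f t)) -> polyb (fun x => \sum_(t <- s | Q t) f t x).
Proof.
move=> fb; elim: s => [|i s IHs].
  by under eq_fun do rewrite big_nil; exact: polyb_cst.
under eq_fun do rewrite big_cons.
by case: (boolP (Q i)) => Qi //; apply: polybD => //; exact: fb.
Qed.

Lemma polyb_coord i : polyb (fun x => (x i)%:R).
Proof.
exists 1, 1%N => x; rewrite mul1r expr1 ger0_norm//.
rewrite (@le_trans _ _ (wt x)%:R)// ?lerDr// ler_nat /wt (bigD1 i)//=.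
exact: leq_addr.
Qed.

Lemma polyb_incr i phi : polyb phi -> polyb (fun x => phi (incr i x)).
Proof.
move=> /polyb_bounds[C [m [C0 Cm]]]; exists (C * 2 ^+ m), m => x.
rewrite (le_trans (Cm _))// -mulrA ler_wpM2l// -exprMn lerXn2r ?nnegrE ?mulr_ge0 ?addr_ge0//.
by rewrite wt_incr -natr1; have : 0 <= (wt x)%:R :> R by []; lra.
Qed.

Lemma measurable_val phi : measurable_fun setT (fun w => phi (X w)).
Proof. exact: measurable_countable_val. Qed.

Lemma emeasurable_val (f : vec -> \bar R) : measurable_fun setT (fun w => f (X w)).
Proof. exact: measurable_countable_val. Qed.

(** Induction on [m]: one factor [1 + wt x] is expanded into coordinates, and the Mecke identity
    trades each [x i] for [p i] and a shift, which costs at most a factor [2 ^+ m] because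
    [2 + wt x <= 2 * (1 + wt x)]. *)
Lemma moment_lty m : (\int[P]_w ((1 + (wt (X w))%:R) ^+ m)%:E < +oo)%E.
Proof.
elim: m => [|m IHm].
  under eq_integral do rewrite expr0.
  by rewrite integral_cst//= probability_setT mul1e ltry.
have E w : (((1 + (wt (X w))%:R) ^+ m.+1)%:E = ((1 + (wt (X w))%:R) ^+ m)%:E +
    \sum_(i < n) ((X w i)%:R%:E * ((1 + (wt (X w))%:R) ^+ m)%:E))%E.
  by rewrite sumEFin -EFinD exprS mulrDl mul1r -mulr_suml natr_sum.
under eq_integral do rewrite E.
have x0 w : (0 <= ((1 + (wt (X w))%:R) ^+ m)%:E :> \bar R)%E.
  by rewrite lee_fin exprn_ge0// addr_ge0.
rewrite ge0_integralD//; last 3 first.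
- exact: (emeasurable_val (fun x => ((1 + (wt x)%:R) ^+ m)%:E)).
- by move=> w _; apply: sume_ge0 => i _; rewrite mule_ge0// lee_fin.
- exact: (emeasurable_val (fun x => \sum_(i < n) ((x i)%:R%:E * ((1 + (wt x)%:R) ^+ m)%:E))%E).
rewrite ge0_integral_sum//; last first.
  by move=> i; exact: (emeasurable_val (fun x => ((x i)%:R%:E * ((1 + (wt x)%:R) ^+ m)%:E))%E).
rewrite lte_add_pinfty//; apply: lte_sum_pinfty => i _.
rewrite (mecke_ge0 i (f := fun x => ((1 + (wt x)%:R) ^+ m)%:E)); last first.
  by move=> x; rewrite lee_fin exprn_ge0// addr_ge0.
rewrite lte_mul_pinfty// ?lee_fin//.
apply: (@le_lt_trans _ _ (\int[P]_w ((2 ^+ m)%:E * ((1 + (wt (X w))%:R) ^+ m)%:E)))%E.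
  apply: ge0_le_integral => //.
  - exact: (emeasurable_val (fun x => ((1 + (wt (incr i x))%:R) ^+ m)%:E)).
  - exact: (emeasurable_val (fun x => (2 ^+ m)%:E * ((1 + (wt x)%:R) ^+ m)%:E)%E).
  move=> w _; rewrite -EFinM lee_fin -exprMn lerXn2r ?nnegrE ?mulr_ge0 ?addr_ge0//.
  by rewrite wt_incr -natr1; have : 0 <= (wt (X w))%:R :> R by []; lra.
rewrite ge0_integralZl//; last first.
  exact: (emeasurable_val (fun x => ((1 + (wt x)%:R) ^+ m)%:E)).
by rewrite lte_mul_pinfty// lee_fin exprn_ge0.
Qed.

Lemma polyb_itg phi : polyb phi -> itg P (fun w => phi (X w)).
Proof.
move=> /polyb_bounds[C [m [C0 Cm]]].
apply: (@itg_le _ _ _ _ _ (fun w => C * (1 + (wt (X w))%:R) ^+ m)) => //.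
  exact: measurable_val.
apply: itgZ; apply/integrableP; split.
  by apply/measurable_EFinP; exact: (measurable_val (fun x => (1 + (wt x)%:R) ^+ m)).
rewrite (eq_integral (fun w => ((1 + (wt (X w))%:R) ^+ m)%:E)) ?moment_lty//.
by move=> w _ /=; rewrite ger0_norm// exprn_ge0// addr_ge0.
Qed.

Definition Ev phi := Ex P (fun w => phi (X w)).

Lemma EvD phi psi : polyb phi -> polyb psi ->
  Ev (fun x => phi x + psi x) = Ev phi + Ev psi.
Proof. by move=> /polyb_itg a /polyb_itg b; exact: ExD. Qed.

Lemma EvB phi psi : polyb phi -> polyb psi ->
  Ev (fun x => phi x - psi x) = Ev phi - Ev psi.
Proof. by move=> /polyb_itg a /polyb_itg b; exact: ExB. Qed.

Lemma EvZ k phi : polyb phi -> Ev (fun x => k * phi x) = k * Ev phi.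
Proof. by move=> /polyb_itg a; exact: ExZ. Qed.

Lemma Ev_cst k : Ev (fun=> k) = k.
Proof. exact: Ex_cst. Qed.

Lemma Ev_sum I (s : seq I) (Q : pred I) (f : I -> vec -> R) :
  (forall t, Q t -> polyb (f t)) ->
  Ev (fun x => \sum_(t <- s | Q t) f t x) = \sum_(t <- s | Q t) Ev (f t).
Proof. by move=> fb; apply: Ex_sum => i Qi; apply: polyb_itg; exact: fb. Qed.

Lemma mecke i phi : polyb phi ->
  Ev (fun x => (x i)%:R * phi x) = p i * Ev (fun x => phi (incr i x)).
Proof.
(* A signed function is [|phi| - (|phi| - phi)], a difference of nonnegative functions of polynomial
   growth. *)
suff pos psi : (forall x, 0 <= psi x) -> polyb psi ->
    Ev (fun x => (x i)%:R * psi x) = p i * Ev (fun x => psi (incr i x)).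
  move=> pb.
  have pb1 : polyb (fun x => `|phi x|) by apply: polyb_le pb => x; rewrite normr_id.
  have pb2 : polyb (fun x => `|phi x| - phi x) by exact: polybB.
  have eq1 := pos _ (fun x => normr_ge0 (phi x)) pb1.
  have /(_ _ pb2) := pos (fun x => `|phi x| - phi x).
  under [X in Ev X]eq_fun do rewrite mulrBr.
  rewrite EvB; last 2 first.
  - exact: (polybM (polyb_coord i) pb1).
  - exact: (polybM (polyb_coord i) pb).
  rewrite eq1 EvB; last 2 first.
  - exact: (polyb_incr i pb1).
  - exact: (polyb_incr i pb).
  rewrite mulrBr => e.
  have /e : forall x, 0 <= `|phi x| - phi x by move=> x; rewrite subr_ge0 ler_norm.
  by move/addrI/oppr_inj.
move=> psi0 pb; apply: EFin_inj; rewrite /Ev EFinM.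
have pbs := polyb_incr i pb.
rewrite -ExE; last exact: (polyb_itg (polybM (polyb_coord i) pb)).
rewrite -ExE; last exact: (polyb_itg pbs).
by rewrite -(mecke_ge0 i (f := fun x => (psi x)%:E))// => x; rewrite lee_fin.
Qed.

Definition cent i x : R := (x i)%:R - p i.

Lemma polyb_cent i : polyb (cent i).
Proof. by apply: polybB; [exact: polyb_coord|exact: polyb_cst]. Qed.

(** Integration by parts: multiplication by a compensated count is dual to the difference operator,
    which lowers the degree of a polynomial in the counts. *)
Lemma mecke_cent i phi : polyb phi ->
  Ev (fun x => cent i x * phi x) = p i * Ev (fun x => phi (incr i x) - phi x).
Proof.
move=> pb.
have -> : (fun x => cent i x * phi x) =
    (fun x => (x i)%:R * phi x - p i * phi x).
  by apply/funext => x; rewrite -mulrBl.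
rewrite (EvB (polybM (polyb_coord i) pb) (polybM (polyb_cst (p i)) pb)).
by rewrite mecke// EvZ// (EvB (polyb_incr i pb) pb) mulrBr.
Qed.

End poisson_vector.
Arguments polyb_cst {R n} k.
Arguments polyb_coord {R n} i.

(** * Discrete chaos of independent Poisson counts *)

Section poisson_chaos.
Context (R : realType) (dO : measure_display) (Omega : measurableType dO)
  (P : probability Omega R) (n : nat) (X : Omega -> {ffun 'I_n -> nat})
  (p : 'I_n -> R).
Hypothesis p0 : forall i, 0 <= p i.
Hypothesis mX : forall k, measurable (X @^-1` [set k]).
Hypothesis lawX : forall k, P (X @^-1` [set k]) = (\prod_i pm (p i) (k i))%:E.
Notation vec := {ffun 'I_n -> nat}.
Notation Ev := (Ev P X).
Notation polyb := (@polyb R n).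
Notation y := (cent p).
Implicit Types (x : vec) (i j : 'I_n) (phi psi : vec -> R)
  (b : 'I_n -> 'I_n -> R) (g : 'I_n -> R).

(** [quad] and [lin] are the step integrals of orders 2 and 1, expressed through the cell counts.
    The coefficients [b] are not symmetrized, which is why [b i j + b j i] appears below. *)
Definition quad b x : R := \sum_(i < n) \sum_(j < n | i != j) b i j * (y i x * y j x).

Definition lin g x : R := \sum_(i < n) g i * y i x.

Lemma polyb_quad b : polyb (quad b).
Proof.
apply: polyb_sum => i _; apply: polyb_sum => j _.
apply: polybM; first exact: polyb_cst.
by apply: polybM; exact: polyb_cent.
Qed.

Lemma polyb_lin g : polyb (lin g).
Proof.
by apply: polyb_sum => i _; apply: polybM; [exact: polyb_cst|exact: polyb_cent].
Qed.

Lemma cent_incr i j x : y i (incr j x) = y i x + (i == j)%:R.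
Proof. by rewrite /cent ffunE natrD addrAC. Qed.

Lemma lin_incr g i x : lin g (incr i x) - lin g x = g i.
Proof.
rewrite /lin -sumrB (bigD1 i)//= big1 ?addr0 => [|j /negbTE ji].
  by rewrite cent_incr eqxx/=; ring.
by rewrite cent_incr ji/=; ring.
Qed.

Lemma quad_incr b i x : quad b (incr i x) - quad b x =
  \sum_(j < n | i != j) (b i j + b j i) * y j x.
Proof.
(* Since [k != l], at most one factor of [y k x * y l x] moves, so the increment is linear in the
   remaining factors. *)
transitivity (\sum_(k < n) \sum_(l < n | k != l)
    ((k == i)%:R * (b k l * y l x) + (l == i)%:R * (b k l * y k x))).
  rewrite /quad -sumrB; apply: eq_bigr => k _; rewrite -sumrB.
  apply: eq_bigr => l kl; rewrite !cent_incr.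
  case: (eqVneq k i) => [ki|_]; case: (eqVneq l i) => [li|_] /=; last 3 first.
  - by ring.
  - by ring.
  - by ring.
  by rewrite ki li eqxx in kl.
under eq_bigr do rewrite big_split/=.
rewrite big_split/=.
under [in RHS]eq_bigr do rewrite mulrDl.
rewrite big_split/=; congr (_ + _).
  rewrite (bigD1 i)//= [X in _ + X]big1 ?addr0 => [|k /negbTE ki].
    by apply: eq_bigr => j _; rewrite eqxx mul1r.
  by rewrite big1// => l _; rewrite ki mul0r.
rewrite [RHS]big_mkcond/=; apply: eq_bigr => k _.
case: ifPn => [ik|]; last rewrite negbK => /eqP <-.
  rewrite (bigD1 i)/=; last by rewrite eq_sym.
  rewrite eqxx mul1r big1 ?addr0// => l /andP[_ /negbTE ->].
  by rewrite mul0r.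
by rewrite big1// => l; rewrite eq_sym => /negbTE ->; rewrite mul0r.
Qed.

Lemma Ev_cent_lin g (c : R) i : Ev (fun x => y i x * (lin g x + c)) = p i * g i.
Proof.
have pb : polyb (fun x => lin g x + c).
  exact: (polybD (polyb_lin g) (polyb_cst c)).
rewrite (mecke_cent p0 mX lawX i pb); congr (_ * _).
rewrite -[RHS](Ev_cst P X); congr Ev; apply/funext => x.
by rewrite -(lin_incr g i x); ring.
Qed.

Lemma Ev_cent i : Ev (y i) = 0.
Proof.
have := Ev_cent_lin (fun=> 0) 1 i; rewrite mulr0 => <-.
congr Ev; apply/funext => x; rewrite /lin big1 ?add0r ?mulr1// => j _.
by rewrite mul0r.
Qed.

Let psi b g x := quad b x + lin g x.

Lemma psi_incr b g i x : psi b g (incr i x) - psi b g x =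
  lin (fun j => if i != j then b i j + b j i else 0) x + g i.
Proof.
rewrite -(lin_incr g i x) /psi opprD addrACA quad_incr; congr (_ + _).
rewrite big_mkcond; apply: eq_bigr => j _; case: ifP => //.
by rewrite mul0r.
Qed.

Let polyb_psi b g : polyb (psi b g).
Proof. exact: (polybD (polyb_quad b) (polyb_lin g)). Qed.

Lemma Ev_cent_psi b g i : Ev (fun x => y i x * psi b g x) = p i * g i.
Proof.
rewrite (mecke_cent p0 mX lawX i (polyb_psi b g)); congr (_ * _).
under [X in Ev X]eq_fun do rewrite psi_incr.
rewrite (EvD p0 mX lawX (polyb_lin _) (polyb_cst _)) Ev_cst.
rewrite [X in X + _](_ : _ = 0) ?add0r// /lin.
rewrite (Ev_sum p0 mX lawX) => [|j _]; last first.
  by apply: polybM; [exact: polyb_cst|exact: polyb_cent].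
by apply: big1 => j _; rewrite (EvZ p0 mX lawX _ (polyb_cent p j)) Ev_cent mulr0.
Qed.

(** Two integrations by parts: the first replaces [psi] by its increment, which is affine, and the
    second picks out the coefficient of [y j]. As [i != j], the factor [y j] is not affected by the
    first. *)
Lemma Ev_cent2_psi b g i j : i != j ->
  Ev (fun x => y i x * y j x * psi b g x) = p i * p j * (b i j + b j i).
Proof.
move=> ij; have pb := polybM (polyb_cent p j) (polyb_psi b g).
under [X in Ev X]eq_fun do rewrite -mulrA.
rewrite (mecke_cent p0 mX lawX i pb) -mulrA; congr (_ * _).
have := Ev_cent_lin (fun j => if i != j then b i j + b j i else 0) (g i) j.
rewrite ij => <-; congr Ev; apply/funext => x.
by rewrite cent_incr [j == i]eq_sym (negbTE ij) -psi_incr /=; ring.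
Qed.

(** Isometry and orthogonality of the first two chaoses: one factor of the square is expanded into
    monomials and each is tested against the other factor by [Ev_cent2_psi] and [Ev_cent_psi]. The
    absence of a term mixing [b] and [g] is the orthogonality. *)
Lemma Ev_chaos_sqr b g : Ev (fun x => (quad b x + lin g x) ^+ 2) =
  \sum_(i < n) \sum_(j < n | i != j) b i j * (b i j + b j i) * (p i * p j)
  + \sum_(i < n) g i ^+ 2 * p i.
Proof.
have -> : (fun x => (quad b x + lin g x) ^+ 2) = (fun x =>
   (\sum_(i < n) \sum_(j < n | i != j) b i j * (y i x * y j x * psi b g x)) +
   (\sum_(i < n) g i * (y i x * psi b g x))).
  apply/funext => x; rewrite expr2 -/(psi b g x) {1}/psi mulrDl; congr (_ + _).
    rewrite mulr_suml; apply: eq_bigr => i _; rewrite mulr_suml.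
    by apply: eq_bigr => j _; rewrite -mulrA.
  by rewrite mulr_suml; apply: eq_bigr => i _; rewrite -mulrA.
have pb2 i j : polyb (fun x => y i x * y j x * psi b g x).
  by apply: polybM => //; apply: polybM; exact: polyb_cent.
have pb1 i : polyb (fun x => y i x * psi b g x).
  by apply: polybM => //; exact: polyb_cent.
have pb2' i j : polyb (fun x => b i j * (y i x * y j x * psi b g x)).
  by apply: polybM => //; exact: polyb_cst.
have pb1' i : polyb (fun x => g i * (y i x * psi b g x)).
  by apply: polybM => //; exact: polyb_cst.
rewrite (EvD p0 mX lawX); last 2 first.
- by apply: polyb_sum => i _; apply: polyb_sum => j _.
- by apply: polyb_sum => i _.
rewrite !(Ev_sum p0 mX lawX)//; last by move=> i _; apply: polyb_sum => j _.
congr (_ + _); apply: eq_bigr => i _; last first.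
  by rewrite (EvZ p0 mX lawX _ (pb1 i)) Ev_cent_psi; ring.
rewrite (Ev_sum p0 mX lawX)//; apply: eq_bigr => j ij.
by rewrite (EvZ p0 mX lawX _ (pb2 i j)) Ev_cent2_psi//; ring.
Qed.

Lemma Ev_quad b : Ev (quad b) = 0.
Proof.
rewrite /quad (Ev_sum p0 mX lawX) => [|i _]; last first.
  apply: polyb_sum => j _; apply: polybM; first exact: polyb_cst.
  by apply: polybM; exact: polyb_cent.
apply: big1 => i _; rewrite (Ev_sum p0 mX lawX) => [|j _]; last first.
  by apply: polybM; [exact: polyb_cst|apply: polybM; exact: polyb_cent].
apply: big1 => j ij.
rewrite (EvZ p0 mX lawX _ (polybM (polyb_cent p i) (polyb_cent p j))).
rewrite (mecke_cent p0 mX lawX i (polyb_cent p j)).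
under [X in Ev X]eq_fun do rewrite cent_incr [j == i]eq_sym (negbTE ij) addr0 subrr.
by rewrite Ev_cst !mulr0.
Qed.

Lemma quadB b b' x : quad b x - quad b' x = quad (fun i j => b i j - b' i j) x.
Proof.
rewrite /quad -sumrB; apply: eq_bigr => i _; rewrite -sumrB.
by apply: eq_bigr => j _; ring.
Qed.

Lemma quad_sum_le b : \sum_(i < n) \sum_(j < n | i != j) b i j * (b i j + b j i) * (p i * p j)
  <= 2 * \sum_(i < n) \sum_(j < n | i != j) b i j ^+ 2 * (p i * p j).
Proof.
set S := (X in _ <= 2 * X).
have S' : S = \sum_(i < n) \sum_(j < n | i != j) b j i ^+ 2 * (p i * p j).
  rewrite /S (exchange_big_dep xpredT)//=; apply: eq_bigr => i _.
  by apply: eq_big => [j|j _]; [rewrite eq_sym|rewrite [p j * _]mulrC].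
(* The weights come from [b i j * b j i <= (b i j ^+ 2 + b j i ^+ 2) / 2]; by [S'] the two kinds of
   squares have the same sum, so the weights add up to 2. *)
have -> : 2 * S = \sum_(i < n) \sum_(j < n | i != j)
    (3 / 2 * b i j ^+ 2 + 1 / 2 * b j i ^+ 2) * (p i * p j).
  transitivity (3 / 2 * S + 1 / 2 * S); first by field.
  rewrite [X in _ + _ * X]S' !mulr_sumr -big_split; apply: eq_bigr => i _ /=.
  rewrite !mulr_sumr -big_split; apply: eq_bigr => j _ /=; ring.
apply: ler_sum => i _; apply: ler_sum => j _; apply: ler_wpM2r; first exact: mulr_ge0.
have := sqr_ge0 (b i j - b j i); rewrite !expr2; nra.
Qed.

Lemma Ev_quad_sqr b : Ev (fun x => quad b x ^+ 2) =
  \sum_(i < n) \sum_(j < n | i != j) b i j * (b i j + b j i) * (p i * p j).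
Proof.
have -> : (fun x => quad b x ^+ 2) = (fun x => (quad b x + lin (fun=> 0) x) ^+ 2).
  apply/funext => x; rewrite [lin _ _]big1 ?addr0// => i _.
  by rewrite mul0r.
by rewrite Ev_chaos_sqr [X in _ + X]big1 ?addr0// => i _; rewrite expr0n mul0r.
Qed.

(** * Edge count of a graph on cells with Poisson numbers of points *)

Section edges.
Variable (h : 'I_n -> 'I_n -> bool) (D : R).
Hypothesis hsym : forall i j, h i j = h j i.
Hypothesis hirr : forall i, h i i = false.
Hypothesis hdeg : forall i, \sum_(j < n) (h i j)%:R * p j <= D.

Definition edges x : nat := (\sum_(i < n) \sum_(j < n) h i j * (x i * x j))%N.
Definition deg i x : nat := (\sum_(j < n) h i j * x j)%N.
Definition mdeg i : R := \sum_(j < n) (h i j)%:R * p j.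
Definition medges : R := \sum_(i < n) \sum_(j < n) (h i j)%:R * (p i * p j).

Lemma deg_incr i j x : deg i (incr j x) = (deg i x + h i j)%N.
Proof.
rewrite /deg; under eq_bigr do rewrite ffunE mulnDr.
rewrite big_split/=; congr (_ + _)%N.
rewrite (bigD1 j)//= eqxx muln1 big1 ?addn0// => k /negbTE ->.
by rewrite muln0.
Qed.

Lemma edges_deg x : edges x = (\sum_(i < n) x i * deg i x)%N.
Proof.
rewrite /edges; apply: eq_bigr => i _; rewrite /deg big_distrr/=.
by apply: eq_bigr => j _; rewrite mulnCA.
Qed.

(** A new point in cell [i] creates [deg i x] edges, each counted in both orders; [hirr] keeps the
    points of its own cell out. *)
Lemma edges_incr i x : edges (incr i x) = (edges x + 2 * deg i x)%N.
Proof.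
rewrite !edges_deg.
under eq_bigr do rewrite deg_incr ffunE mulnDl !mulnDr.
rewrite !big_split/= -addnA; congr (_ + _)%N.
have -> : (\sum_(j < n) x j * h j i)%N = deg i x.
  by rewrite /deg; apply: eq_bigr => j _; rewrite hsym mulnC.
rewrite mul2n -addnn; congr (_ + _)%N.
rewrite -big_split/= (bigD1 i)//= eqxx !mul1n hirr addn0 big1 ?addn0// => j /negbTE ->.
by rewrite !mul0n.
Qed.

Lemma edges_incr2 i j x : h i j ->
  edges (incr i (incr j x)) = (edges x + 2 + 2 * (deg i x + deg j x))%N.
Proof. by move=> hij; rewrite !edges_incr deg_incr hij; lia. Qed.

Lemma polyb_edges : polyb (fun x => (edges x)%:R).
Proof.
rewrite /edges; under eq_fun do rewrite natr_sum.
apply: polyb_sum => i _; under eq_fun do rewrite natr_sum.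
apply: polyb_sum => j _; under eq_fun do rewrite !natrM.
apply: polybM; first exact: polyb_cst.
by apply: polybM; exact: polyb_coord.
Qed.

Lemma polyb_deg i : polyb (fun x => (deg i x)%:R).
Proof.
rewrite /deg; under eq_fun do rewrite natr_sum.
apply: polyb_sum => j _; under eq_fun do rewrite !natrM.
by apply: polybM; [exact: polyb_cst|exact: polyb_coord].
Qed.

Lemma Ev_coord i : Ev (fun x => (x i)%:R) = p i.
Proof.
have := mecke p0 mX lawX i (polyb_cst 1); rewrite Ev_cst mulr1 => <-.
by congr Ev; apply/funext => x; rewrite mulr1.
Qed.

Lemma Ev_deg i : Ev (fun x => (deg i x)%:R) = mdeg i.
Proof.
rewrite /deg; under [X in Ev X]eq_fun do rewrite natr_sum.
rewrite (Ev_sum p0 mX lawX) => [|j _]; last first.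
  under eq_fun do rewrite !natrM.
  by apply: polybM; [exact: polyb_cst|exact: polyb_coord].
apply: eq_bigr => j _; under [X in Ev X]eq_fun do rewrite !natrM.
by rewrite (EvZ p0 mX lawX _ (polyb_coord j)) Ev_coord.
Qed.

(** Obtained by substituting [x i = y i + p i]: by symmetry of [h] the two mixed terms agree, whence
    the factor 2 of the first-order kernel, as in [kernel1]. *)
Lemma edgesB x : (edges x)%:R - medges =
  quad (fun i j => (h i j)%:R) x + lin (fun i => 2 * mdeg i) x.
Proof.
have q : quad (fun i j => (h i j)%:R) x = \sum_i \sum_j (h i j)%:R * (y i x * y j x).
  apply: eq_bigr => i _; rewrite big_mkcond; apply: eq_bigr => j _.
  by case: eqVneq => [->|//]; rewrite hirr mul0r.
have l : lin mdeg x = \sum_i \sum_j (h i j)%:R * (p i * y j x).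
  rewrite exchange_big/=; apply: eq_bigr => i _; rewrite mulr_suml.
  by apply: eq_bigr => j _; rewrite hsym mulrA.
have l' : lin mdeg x = \sum_i \sum_j (h i j)%:R * (y i x * p j).
  apply: eq_bigr => i _; rewrite mulr_suml.
  by apply: eq_bigr => j _; ring.
have -> : lin (fun i => 2 * mdeg i) x = lin mdeg x + lin mdeg x.
  by rewrite -big_split; apply: eq_bigr => i _; rewrite mulr_natl mulr2n mulrDl.
rewrite {1}l l' q natr_sum -sumrB -!big_split; apply: eq_bigr => i _ /=.
rewrite natr_sum -sumrB -!big_split; apply: eq_bigr => j _ /=.
by rewrite /cent !natrM; ring.
Qed.

Lemma Ev_edges : Ev (fun x => (edges x)%:R) = medges.
Proof.
have -> : (fun x => (edges x)%:R) = (fun x =>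
    quad (fun i j => (h i j)%:R) x + (lin (fun i => 2 * mdeg i) x + medges)).
  by apply/funext => x; rewrite addrA -edgesB subrK.
have pl := polybD (polyb_lin (fun i => 2 * mdeg i)) (polyb_cst medges).
rewrite (EvD p0 mX lawX (polyb_quad _) pl) Ev_quad add0r.
rewrite (EvD p0 mX lawX (polyb_lin _) (polyb_cst _)) Ev_cst.
suff -> : Ev (lin (fun i => 2 * mdeg i)) = 0 by rewrite add0r.
rewrite /lin (Ev_sum p0 mX lawX) => [|i _]; last first.
  by apply: polybM; [exact: polyb_cst|exact: polyb_cent].
by apply: big1 => i _; rewrite (EvZ p0 mX lawX _ (polyb_cent p i)) Ev_cent mulr0.
Qed.

Lemma medgesE : medges = \sum_(i < n) p i * mdeg i.
Proof.
by apply: eq_bigr => i _; rewrite mulr_sumr; apply: eq_bigr => j _; ring.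
Qed.

Lemma mdeg_ge0 i : 0 <= mdeg i.
Proof. by apply: sumr_ge0 => j _; rewrite mulr_ge0. Qed.

(** The two orders are orthogonal. The double integral with coefficients [h - b] has second moment
    at most [2 * e]; the first-order part has the sum of the [4 * mdeg i ^+ 2 * p i], where one
    factor [mdeg i] is bounded by [D]. *)
Lemma Ev_edges_quad (b : 'I_n -> 'I_n -> R) (e : R) :
  \sum_(i < n) \sum_(j < n | i != j) ((h i j)%:R - b i j) ^+ 2 * (p i * p j) <= e ->
  Ev (fun x => ((edges x)%:R - medges - quad b x) ^+ 2) <= 2 * e + 4 * D * medges.
Proof.
move=> be.
have -> : (fun x => ((edges x)%:R - medges - quad b x) ^+ 2) = (fun x =>
    (quad (fun i j => (h i j)%:R - b i j) x + lin (fun i => 2 * mdeg i) x) ^+ 2).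
  by apply/funext => x; rewrite edgesB -quadB; congr (_ ^+ 2); ring.
rewrite Ev_chaos_sqr lerD//.
  rewrite (le_trans (quad_sum_le _))// ler_pM2l//.
rewrite medgesE mulr_sumr; apply: ler_sum => i _.
have := hdeg i; rewrite -/(mdeg i) => hD.
have := mdeg_ge0 i; have := p0 i; move=> pi0 m0.
have : 0 <= p i * mdeg i * (D - mdeg i) by rewrite !mulr_ge0// subr_ge0.
by nra.
Qed.

(** For a symmetric 0/1 kernel the summand [b i j * (b i j + b j i)] of the isometry is
    [2 * b i j]. *)
Lemma Ev_quad_edges_sqr : Ev (fun x => quad (fun i j => (h i j)%:R) x ^+ 2) = 2 * medges.
Proof.
rewrite Ev_quad_sqr mulr_sumr; apply: eq_bigr => i _; rewrite big_mkcond mulr_sumr.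
apply: eq_bigr => j _; case: eqVneq => [->|_] /=; first by rewrite hirr mul0r mulr0.
by rewrite (hsym j i); case: (h i j) => /=; ring.
Qed.

(** A size-bias argument. On the event [edges x = m] the factor [m] is the sum of the
    [h i j * x i * x j], and two Mecke steps insert a point in each of the two cells. The count then
    becomes [edges x + 2] unless an endpoint has another neighbour, which has probability at most
    [mdeg i + mdeg j], hence at most [2 * D]. *)
Lemma edges_recursion (m : nat) :
  `| m%:R * Ev (fun x => (edges x == m)%:R) - medges * Ev (fun x => (edges x + 2 == m)%N%:R) |
  <= 2 * D * medges.
Proof.
have pbb (b : vec -> bool) : polyb (fun x => (b x)%:R).
  by apply: (polyb_le (psi := fun=> 1)); [move=> x; case: (b x); rewrite ?normr0 ?normr1|exact: polyb_cst].
pose f x : R := (edges x == m)%:R.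
have pf : polyb f by exact: pbb.
have -> : m%:R * Ev f = \sum_i \sum_j (h i j)%:R * (p i * p j) * Ev (fun x => f (incr i (incr j x))).
  rewrite -(EvZ p0 mX lawX)//.
  have -> : (fun x => m%:R * f x) =
     (fun x => \sum_i \sum_j (h i j)%:R * ((x j)%:R * ((x i)%:R * f x))).
    apply/funext => x; transitivity ((edges x)%:R * f x).
      by rewrite /f; case: eqP => [->|_]; rewrite ?mulr0.
    rewrite natr_sum mulr_suml; apply: eq_bigr => i _.
    rewrite natr_sum mulr_suml; apply: eq_bigr => j _.
    by rewrite !natrM; ring.
  have pb i j : polyb (fun x => (x j)%:R * ((x i)%:R * f x)).
    exact: (polybM (polyb_coord j) (polybM (polyb_coord i) pf)).
  have pb' i j : polyb (fun x => (h i j)%:R * ((x j)%:R * ((x i)%:R * f x))).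
    by apply: polybM => //; exact: polyb_cst.
  rewrite (Ev_sum p0 mX lawX) => [|i _]; last by apply: polyb_sum => j _.
  apply: eq_bigr => i _; rewrite (Ev_sum p0 mX lawX)//; apply: eq_bigr => j _.
  rewrite (EvZ p0 mX lawX _ (pb i j)); case: (boolP (h i j)) => hij; last by rewrite !mul0r.
  rewrite !mul1r.
  (* No edge joins a cell to itself, so inserting a point in cell [j] leaves the factor [x i]
     unchanged. *)
  have ij : (i == j) = false by apply/negbTE/eqP => ij; move: hij; rewrite ij hirr.
  rewrite (mecke p0 mX lawX j (phi := fun x => (x i)%:R * f x)); last first.
    exact: (polybM (polyb_coord i) pf).
  under [X in Ev X]eq_fun do rewrite ffunE ij addn0.
  rewrite (mecke p0 mX lawX i (phi := fun x => f (incr j x))); last exact: (polyb_incr j pf).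
  rewrite mulrCA mulrA; congr (_ * Ev _); apply/funext => x; rewrite /f; congr (_ == _)%:R.
  by rewrite !edges_incr !deg_incr (hsym j i); lia.
rewrite /medges mulr_suml -sumrB (le_trans (ler_norm_sum _ _ _))// mulr_sumr ler_sum// => i _.
rewrite mulr_suml -sumrB (le_trans (ler_norm_sum _ _ _))// mulr_sumr ler_sum// => j _.
rewrite -mulrBr normrM ger0_norm ?mulr_ge0// mulrC.
case: (boolP (h i j)) => hij; last by rewrite !mul0r !mulr0.
rewrite ler_wpM2r ?mulr_ge0//.
have pbf : polyb (fun x => f (incr i (incr j x))).
  exact: (polyb_incr j (polyb_incr i pf)).
rewrite -(EvB p0 mX lawX)//.
apply: (@le_trans _ _ (Ev (fun x => (deg i x)%:R + (deg j x)%:R))); last first.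
  by rewrite (EvD p0 mX lawX (polyb_deg i) (polyb_deg j)) !Ev_deg mulr_natl mulr2n lerD// hdeg.
have pbd := polyb_itg p0 mX lawX (polybB pbf (pbb (fun x => edges x + 2 == m)%N)).
apply: le_trans (Ex_abs pbd) _; apply: Ex_le.
- exact: itg_abs.
- exact: (polyb_itg p0 mX lawX (polybD (polyb_deg i) (polyb_deg j))).
move=> w; rewrite /f edges_incr2//.
(* Degrees are natural numbers: either both vanish and the two events coincide, or their sum is at
   least 1 and dominates the difference of the indicators. *)
have [d0|d0] := posnP (deg i (X w) + deg j (X w))%N.
  by rewrite d0 muln0 addn0 subrr normr0 addr_ge0.
rewrite -natrD (@le_trans _ _ 1)//; last by rewrite -(ler_nat R) in d0.
by case: eqP => _; case: eqP => _ /=; rewrite ?subrr ?subr0 ?sub0r ?normrN ?normr0 ?normr1.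
Qed.

End edges.

End poisson_chaos.

(** * Point counts of a Poisson measure *)

Section natof.
Context (R : realType).

(* Junk value 0 off the natural numbers. *)
Definition natof (x : \bar R) : nat :=
  match pselect (exists k : nat, x = k%:R%:E) with
  | left h => projT1 (cid h)
  | right _ => 0%N
  end.

Lemma natofK (k : nat) : natof k%:R%:E = k.
Proof.
rewrite /natof; case: pselect => [h|]; last by case; exists k.
by case: cid => m /= [/eqP]; rewrite eqr_nat => /eqP.
Qed.

Lemma natofE (x : \bar R) : (exists k : nat, x = k%:R%:E) -> x = (natof x)%:R%:E.
Proof. by move=> [k ->]; rewrite natofK. Qed.

Lemma measurable_natof : measurable_fun setT natof.
Proof.
have mN : measurable (~` \bigcup_k [set k%:R%:E : \bar R]).
  by apply: measurableC; apply: bigcupT_measurable => k; exact: emeasurable_set1.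
move=> _ B _; rewrite setTI.
have -> : natof @^-1` B = (\bigcup_(k in B) [set k%:R%:E]) `|`
    (if pselect (B 0%N) then ~` \bigcup_k [set k%:R%:E : \bar R] else set0).
  apply/seteqP; split => [x /= Bx|x [[k Bk /= ->]|]].
  - have [h|h] := pselect (exists k : nat, x = k%:R%:E).
      by left; exists (natof x) => //=; exact: natofE.
    have x0 : natof x = 0%N by rewrite /natof; case: pselect.
    rewrite x0 in Bx; right; case: pselect => // _ [k _ /= xk].
    by apply: h; exists k.
  - by rewrite /= natofK.
  - case: pselect => //= B0 hx.
    rewrite /natof; case: pselect => // h; exfalso; apply: hx.
    by case: h => k ->; exists k.
apply: measurableU.
  by apply: bigcup_measurable => k _; exact: emeasurable_set1.
by case: pselect => _ /=; [exact: mN|exact: measurable0].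
Qed.

End natof.

Section null_sets.
Context (R : realType) (dO : measure_display) (Omega : measurableType dO)
  (P : probability Omega R).

Lemma measure_off_null (N A B : set Omega) : measurable N -> P N = 0%E ->
  measurable A -> measurable B -> A `&` ~` N = B `&` ~` N -> P A = P B.
Proof.
move=> mN N0 mA mB AB.
have E C : measurable C -> P C = P (C `&` ~` N).
  move=> mC; rewrite -[in LHS](setUIDK C N) measureU; last 3 first.
  - exact: measurableI.
  - exact: measurableD.
  - by rewrite setDE setIACA setICr setI0.
  by rewrite (@subset_measure0 _ _ _ P (C `&` N) N)// ?add0e ?setDE//; exact: measurableI.
by rewrite E// AB -E.
Qed.

Lemma null_bigcup (I : countType) (F : I -> set Omega) :
  (forall i, measurable (F i)) -> (forall i, P (F i) = 0%E) ->
  measurable (\bigcup_i F i) /\ P (\bigcup_i F i) = 0%E.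
Proof.
move=> mF F0.
pose F' m := if @unpickle I m is Some i then F i else set0.
have mF' m : measurable (F' m).
  by rewrite /F'; case: unpickle => // _; exact: measurable0.
have -> : \bigcup_i F i = \bigcup_m F' m.
  apply/seteqP; split => [w [i _ Fi]|w [m _]].
    by exists (pickle i) => //; rewrite /F' pickleK.
  by rewrite /F'; case: unpickle => // i Fi; exists i.
split; first exact: bigcupT_measurable.
apply: measure_negligible; first exact: bigcupT_measurable.
apply: negligible_bigcup => m; rewrite /F'; case: unpickle => [i|].
  by apply/negligibleP; [exact: mF|exact: F0].
exact: negligible_set0.
Qed.

End null_sets.

Section poisson_counts.
Context (R : realType) (dO dE : measure_display) (Omega : measurableType dO)
  (E : measurableType dE) (P : probability Omega R) (eta : R.-ker Omega ~> E)
  (mu : {measure set E -> \bar R}).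
Hypothesis eta_mu : poisson_measure P eta mu.

Lemma measurable_eta A : measurable A -> measurable_fun setT (fun w => eta w A).
Proof. exact: measurable_kernel. Qed.

Lemma measurable_eta_eq A x : measurable A -> measurable [set w | eta w A = x].
Proof.
move=> mA; rewrite -[X in measurable X]setTI.
exact: (measurable_eta mA measurableT (emeasurable_set1 x)).
Qed.

(** The Poisson weights of all natural numbers add up to 1, so the values prescribed by
    [poisson_measure] exhaust the probability. *)
Lemma eta_nat_off_null A : measurable A -> (mu A < +oo)%E ->
  let N := ~` \bigcup_(k : nat) [set w | eta w A = k%:R%:E] in
  measurable N /\ P N = 0%E.
Proof.
move=> mA Aoo.
have mU : measurable (\bigcup_(k : nat) [set w | eta w A = k%:R%:E]).
  by apply: bigcupT_measurable => k; exact: measurable_eta_eq.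
split; first exact: measurableC.
rewrite probability_setC// measure_bigcup//; last 2 first.
- by move=> k _; exact: measurable_eta_eq.
- apply/trivIsetP => i j _ _ ij; apply/seteqP; split => // w [] /= -> [/eqP].
  by rewrite eqr_nat (negbTE ij).
rewrite (@eq_eseriesr _ _ (fun k => poisson_prob (fine (mu A)) 0%N [set k])); last first.
  by move=> k _; exact: eta_mu.1.
rewrite -measure_bigcup//; last first.
  by apply/trivIsetP => i j _ _ ij; apply/seteqP; split => // w [] /= -> /eqP; rewrite (negbTE ij).
have -> : \bigcup_k [set k] = [set: nat] by apply/seteqP; split => // k _; exists k.
have e : poisson_prob (fine (mu A)) 0%N [set: nat] = 1%E by exact: probability_setT.
apply: (etrans (congr1 (fun t => 1 - t)%E e)); exact: subee.
Qed.

Section cells.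
Context (n : nat) (A : 'I_n -> set E).
Hypothesis mA : forall i, measurable (A i).
Hypothesis Aoo : forall i, (mu (A i) < +oo)%E.
Hypothesis tA : trivIset setT A.

Definition count (w : Omega) : {ffun 'I_n -> nat} := [ffun i => natof (eta w (A i))].

Lemma measurable_count k : measurable (count @^-1` [set k]).
Proof.
have -> : count @^-1` [set k] =
    \bigcap_(i in [set: 'I_n]) ((fun w => natof (eta w (A i))) @^-1` [set k i]).
  apply/seteqP; split => [w /= <- i _ /=|w /= h]; first by rewrite ffunE.
  by apply/ffunP => i; rewrite ffunE; exact: h.
apply: fin_bigcap_measurable => // i _.
rewrite -[X in measurable X]setTI; apply: measurableT_comp => //.
  exact: measurable_natof.
exact: measurable_eta.
Qed.

Lemma count_off_null : exists N, [/\ measurable N, P N = 0%E &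
  forall w, ~ N w -> forall i, eta w (A i) = (count w i)%:R%:E].
Proof.
pose F i := ~` \bigcup_(k : nat) [set w | eta w (A i) = k%:R%:E].
have [mN N0] := @null_bigcup _ _ _ P 'I_n F
  (fun i => (eta_nat_off_null (mA i) (Aoo i)).1)
  (fun i => (eta_nat_off_null (mA i) (Aoo i)).2).
exists (\bigcup_i F i); split => // w Nw i; rewrite ffunE; apply: natofE.
apply: contrapT => h; apply: Nw; exists i => // -[k _ /= wk].
by apply: h; exists k.
Qed.

Lemma law_count k :
  P (count @^-1` [set k]) = (\prod_i pm (fine (mu (A i))) (k i))%:E.
Proof.
have [N [mN N0 NE]] := count_off_null.
have := eta_mu.2 n A mA Aoo tA (fun i => [set (k i)%:R%:E]) (fun i => emeasurable_set1 _).
rewrite (eq_bigr (fun i => (pm (fine (mu (A i))) (k i))%:E)) => [|i _]; last first.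
  by rewrite -pmE; exact: eta_mu.1.
rewrite -prodEFin => <-.
apply: (measure_off_null mN N0) => //.
- exact: measurable_count.
- by apply: fin_bigcap_measurable => // i _; exact: measurable_eta_eq.
apply/seteqP; split => w [] /= h Nw; split => //.
  by move=> i _ /=; rewrite (NE _ Nw) h.
apply/ffunP => i; rewrite ffunE; have /= -> := h i I; exact: natofK.
Qed.

End cells.

(** The intersection and the two differences of [A] and [B] are disjoint, so their counts are
    independent. The extra term comes from the square of the count of the intersection, whose mean
    is [p * (p + 1)] by one Mecke step. *)
Lemma eta_mean2 A B : measurable A -> measurable B -> (mu A < +oo)%E -> (mu B < +oo)%E ->
  (\int[P]_w (eta w A * eta w B) = mu A * mu B + mu (A `&` B))%E.
Proof.
move=> mA mB Aoo Boo.
pose C (i : 'I_3) := nth set0 [:: A `&` B; A `\` B; B `\` A] i.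
have mC i : measurable (C i).
  rewrite /C; case: i => -[|[|[|//]]] ? /=.
  - exact: measurableI.
  - exact: measurableD.
  - exact: measurableD.
have Coo i : (mu (C i) < +oo)%E.
  have [CA|CB] : C i `<=` A \/ C i `<=` B.
    rewrite /C; case: i => -[|[|[|//]]] ? /=; first by left.
    + by left.
    + by right.
  - by apply: le_lt_trans Aoo; rewrite le_measure ?inE.
  - by apply: le_lt_trans Boo; rewrite le_measure ?inE.
have tC : trivIset setT C.
  apply/trivIsetP => i j _ _; rewrite /C.
  case: i => -[|[|[|//]]] ?; case: j => -[|[|[|//]]] ? //= _;
    apply/seteqP; split => // x /=; tauto.
have [N [mN N0 NE]] := count_off_null mC Coo.
pose p i := fine (mu (C i)).
have p0 i : 0 <= p i by exact: fine_ge0.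
pose o0 : 'I_3 := ord0; pose o1 : 'I_3 := inord 1; pose o2 : 'I_3 := inord 2.
have C0 : C o0 = A `&` B by [].
have C1 : C o1 = A `\` B by rewrite /C inordK.
have C2 : C o2 = B `\` A by rewrite /C inordK.
have eA (m : {measure set E -> \bar R}) : m A = (m (C o0) + m (C o1))%E.
  rewrite -measureU// ?C0 ?C1 ?setUIDK//.
  by apply/seteqP; split => // x /=; tauto.
have eB (m : {measure set E -> \bar R}) : m B = (m (C o0) + m (C o2))%E.
  rewrite -measureU// ?C0 ?C2 [A `&` B]setIC ?setUIDK//.
  by apply/seteqP; split => // x /=; tauto.
pose X := count C.
have mX := measurable_count mC; have lX := law_count mC Coo tC.
have EXX i j : (\int[P]_w ((X w i)%:R%:E * (X w j)%:R%:E) =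
    (p i * (p j + (i == j)%:R))%:E)%E.
  rewrite (mecke_ge0 p0 mX lX i (f := fun x => (x j)%:R%:E)) ?EFinM; last first.
    by move=> x; rewrite lee_fin.
  congr (_ * _)%E.
  transitivity (\int[P]_w ((X w j)%:R%:E + (i == j)%:R%:E))%E.
    by apply: eq_integral => w _; rewrite ffunE natrD EFinD eq_sym.
  have pb := polyb_coord (R := R) j.
  have Ij := polyb_itg p0 mX lX pb.
  transitivity (\int[P]_w ((X w j)%:R + (i == j)%:R)%:E)%E => //.
  rewrite ExE; last by apply: itgD => //; exact: itg_cst.
  rewrite ExD ?Ex_cst//; last exact: itg_cst.
  congr (_ + _)%:E; exact: (Ev_coord p0 mX lX j).
transitivity (\int[P]_w (((X w o0)%:R%:E * (X w o0)%:R%:E + (X w o0)%:R%:E * (X w o2)%:R%:E) +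
  ((X w o1)%:R%:E * (X w o0)%:R%:E + (X w o1)%:R%:E * (X w o2)%:R%:E)))%E.
  apply: (integral_off_null mN N0).
    apply: (measurable_countable_val mX (fun x : {ffun 'I_3 -> nat} =>
      ((x o0)%:R%:E * (x o0)%:R%:E + (x o0)%:R%:E * (x o2)%:R%:E) +
      ((x o1)%:R%:E * (x o0)%:R%:E + (x o1)%:R%:E * (x o2)%:R%:E))%E).
  move=> w Nw; rewrite eA eB !(NE _ Nw) -/X. rewrite -!EFinM; rewrite -?EFinD; apply: (congr1 EFin).
  by ring.
have mm i j : measurable_fun setT (fun w => (X w i)%:R%:E * (X w j)%:R%:E : \bar R)%E.
  exact: (measurable_countable_val mX (fun x : {ffun 'I_3 -> nat} => (x i)%:R%:E * (x j)%:R%:E)%E).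
have ge i j w : (0 <= (X w i)%:R%:E * (X w j)%:R%:E :> \bar R)%E.
  by rewrite mule_ge0// lee_fin.
have fC i : mu (C i) = (p i)%:E by rewrite fineK// ge0_fin_numE.
rewrite ge0_integralD//; last 4 first.
- by move=> w _; rewrite adde_ge0.
- exact: emeasurable_funD.
- by move=> w _; rewrite adde_ge0.
- exact: emeasurable_funD.
rewrite !ge0_integralD// !EXX eA eB -C0 !fC -?EFinM -?EFinD; apply: (congr1 EFin).
have -> : (o0 == o2) = false by rewrite -val_eqE /= inordK.
have -> : (o1 == o0) = false by rewrite -val_eqE /= inordK.
have -> : (o1 == o2) = false by rewrite -val_eqE /= !inordK.
by rewrite /=; ring.
Qed.

End poisson_counts.

(** * Ordered pairs of points, and atoms *)

Section pair_measure.
Local Open Scope ereal_scope.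
Context (R : realType) (dO dE : measure_display) (Omega : measurableType dO)
  (E : measurableType dE) (P : probability Omega R) (eta : R.-ker Omega ~> E)
  (mu : {measure set E -> \bar R}).
Hypothesis eta_mu : poisson_measure P eta mu.
Context (W : set E) (mW : measurable W) (muW : mu W < +oo)
  (etaW : forall w, eta w W < +oo).

(** Restriction to [W] makes the measures finite, as the passage to complements in the Dynkin
    argument requires. *)
Definition eta_restr (w : Omega) : {finite_measure set E -> \bar R} :=
  mfrestr mW (etaW w).

Definition mu_restr : {finite_measure set E -> \bar R} := mfrestr mW muW.

Definition eta_pairs (w : Omega) : {measure set (E * E) -> \bar R} :=
  (eta_restr w \x eta_restr w).

Let diagf (x : E) : E * E := (x, x).

Let mdiagf : measurable_fun setT diagf.
Proof. by apply/measurable_fun_pairP; split; exact: measurable_id. Qed.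

Definition mu_pairs : {measure set (E * E) -> \bar R} := (mu_restr \x mu_restr).

(** The second moment measure of a Poisson measure: the product of the intensities, plus the
    intensity carried to the diagonal, where each point is paired with itself. *)
Definition mean_pairs : {measure set (E * E) -> \bar R} :=
  measure_add mu_pairs
    (measure_function_pushforward__canonical__measure_function_Measure mu_restr mdiagf).

Lemma mean_pairsE D : mean_pairs D = mu_pairs D + mu_restr [set x | D (x, x)].
Proof. exact: measure_addE. Qed.

Lemma eta_pairs_rect w A B : measurable A -> measurable B ->
  eta_pairs w (A `*` B) = eta w (A `&` W) * eta w (B `&` W).
Proof. by move=> mA mB; exact: product_measure1E. Qed.

Lemma mu_pairs_rect A B : measurable A -> measurable B ->
  mu_pairs (A `*` B) = mu (A `&` W) * mu (B `&` W).
Proof. by move=> mA mB; exact: product_measure1E. Qed.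

Lemma eta_pairsT w : eta_pairs w setT < +oo.
Proof.
rewrite -setXTT eta_pairs_rect// !setTI lte_mul_pinfty//.
by rewrite ge0_fin_numE.
Qed.

Lemma mean_pairsT : mean_pairs setT < +oo.
Proof.
rewrite mean_pairsE lte_add_pinfty//; last exact: fin_num_fun_lty.
rewrite -setXTT mu_pairs_rect// !setTI lte_mul_pinfty//.
by rewrite ge0_fin_numE.
Qed.

Let good (D : set (E * E)) := measurable_fun setT (fun w => eta_pairs w D) /\
  \int[P]_w eta_pairs w D = mean_pairs D.

Let good_rect A B : measurable A -> measurable B -> good (A `*` B).
Proof.
move=> mA mB.
have EE w := eta_pairs_rect w mA mB.
split.
  rewrite (_ : (fun w => _) = fun w => eta w (A `&` W) * eta w (B `&` W)); last exact/funext.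
  by apply: emeasurable_funM; apply: measurable_eta; exact: measurableI.
under eq_integral do rewrite EE.
rewrite (eta_mean2 eta_mu) ?mean_pairsE//; last 4 first.
- exact: measurableI.
- exact: measurableI.
- by apply: le_lt_trans muW; rewrite le_measure ?inE//; exact: measurableI.
- by apply: le_lt_trans muW; rewrite le_measure ?inE//; exact: measurableI.
rewrite mu_pairs_rect//; congr (_ + _).
by rewrite /= /mfrestr /mrestr; congr (mu _); apply/seteqP; split => x /=; tauto.
Qed.

Let good_setC D : measurable D -> good D -> good (~` D).
Proof.
move=> mD [mfD iD].
have [mT iT] : good setT by rewrite -setXTT; exact: good_rect.
have setCE (m : {measure set (E * E) -> \bar R}) : m setT < +oo -> m (~` D) = m setT - m D.
  move=> moo; rewrite -setTD measureD ?setTI//.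
have EE w : eta_pairs w (~` D) = eta_pairs w setT - eta_pairs w D.
  by apply: setCE; exact: eta_pairsT.
split.
  rewrite (_ : (fun w => _) = fun w => eta_pairs w setT - eta_pairs w D); last exact/funext.
  exact: emeasurable_funB.
under eq_integral do rewrite EE.
have it : P.-integrable setT (fun w => eta_pairs w setT).
  apply/integrableP; split => //.
  under eq_integral do rewrite gee0_abs//.
  by rewrite iT; exact: mean_pairsT.
rewrite integralB//; last first.
  apply: le_integrable it => // w _.
  by rewrite !gee0_abs// le_measure ?inE.
by rewrite iT iD setCE//; exact: mean_pairsT.
Qed.

Let good_bigcup (F : (set (E * E))^nat) : (forall n, measurable (F n)) ->
  trivIset setT F -> (forall n, good (F n)) -> good (\bigcup_k F k).
Proof.
move=> mF tF gF.
have EE w : eta_pairs w (\bigcup_k F k) = \sum_(k <oo) eta_pairs w (F k).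
  by rewrite measure_bigcup//; apply: eq_eseriesl => i; rewrite in_setT.
split.
  rewrite (_ : (fun w => _) = fun w => \sum_(k <oo) eta_pairs w (F k)); last exact/funext.
  by apply: ge0_emeasurable_sum => // k _; exact: (gF k).1.
under eq_integral do rewrite EE.
rewrite integral_nneseries//; last by move=> k; exact: (gF k).1.
rewrite measure_bigcup//.
transitivity (\sum_(k <oo) mean_pairs (F k)).
  by apply: eq_eseriesr => k _; exact: (gF k).2.
by apply: eq_eseriesl => i; rewrite in_setT.
Qed.

(** The sets whose random mass is measurable and has the right mean form a Dynkin system; it
    contains the rectangles by [eta_mean2]. *)
Lemma pairs_mean D : measurable D -> measurable_fun setT (fun w => eta_pairs w D) /\
  \int[P]_w eta_pairs w D = mean_pairs D.
Proof.
move=> mD.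
pose G := [set A `*` B | A in (@measurable _ E) & B in (@measurable _ E)].
have GE : @measurable _ (E * E)%type = <<s G >> by rewrite measurable_prod_measurableType.
apply: (@dynkin_induction _ _ G good) => //.
- move=> _ _ [A mA [B mB <-]] [A' mA' [B' mB' <-]].
  exists (A `&` A'); first exact: measurableI.
  by exists (B `&` B'); [exact: measurableI|rewrite setXI].
- by rewrite -setXTT; exact: good_rect.
- by move=> _ [A mA [B mB <-]]; exact: good_rect.
- by rewrite -GE.
Qed.

End pair_measure.

(** * Atoms of integer-valued measures *)

Section separating_family.
Context (dE : measure_display) (E : measurableType dE) (U : nat -> set E).
Hypothesis mU : forall k, measurable (U k).
Hypothesis sepU : forall x y, (forall k, U k x <-> U k y) -> x = y.

Lemma measurable_singleton (x : E) : measurable [set x].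
Proof.
have -> : [set x] = \bigcap_k (if x \in U k then U k else ~` U k).
  apply/seteqP; split => [_ -> k _|y xy].
    by case: ifPn => [/[!inE]//|/negP xk xk']; apply: xk; rewrite inE.
  apply: sepU => k; have := xy k I; case: ifPn => [/[!inE]//|/negP xk yk].
  by split => // xk'; case: xk; rewrite inE.
apply: bigcapT_measurable => k; case: ifPn => // _; exact: measurableC.
Qed.

Lemma measurable_diagonal : measurable [set z : E * E | z.1 = z.2].
Proof.
have -> : [set z : E * E | z.1 = z.2] =
    \bigcap_k ((U k `*` U k) `|` (~` U k `*` ~` U k)).
  apply/seteqP; split => [[x y] /= -> k _|[x y] xy] /=.
    by have [h|h] := pselect (U k y); [left|right].
  by apply: sepU => k; have /= [] := xy k I; tauto.
apply: bigcapT_measurable => k.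
by apply: measurableU; apply: measurableX => //; exact: measurableC.
Qed.

Section integer_measure.
Local Open Scope ereal_scope.
Context (R : realType) (m : {finite_measure set E -> \bar R}).
Hypothesis m_nat : forall A, measurable A -> exists k : nat, m A = k%:R%:E.

Lemma integer_measure_ge1 A : measurable A -> 0 < m A -> 1 <= m A.
Proof.
move=> /m_nat[[|k] ->]; first by rewrite ltxx.
by move=> _; rewrite lee_fin ler1n.
Qed.

(* Choosing successively a side of each separating set that keeps positive
   mass, hence mass at least 1, the intersection has mass at least 1 and at
   most one point. *)
Lemma integer_measure_atom V : measurable V -> 0 < m V ->
  exists2 x, V x & 0 < m [set x].
Proof.
move=> mV V0.
pose step A k := if pselect (0 < m (A `&` U k)) then A `&` U k else A `&` ~` U k.
have stepS A k : step A k `<=` A by rewrite /step; case: pselect => _ x [].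
have mstep A k : measurable A -> measurable (step A k).
  move=> mA; rewrite /step; case: pselect => _ /=; apply: measurableI => //.
  exact: measurableC.
have step0 A k : measurable A -> 0 < m A -> 0 < m (step A k).
  move=> mA A0; rewrite /step; case: pselect => [//|/negP] /=; rewrite -leNgt => AU.
  move: A0; rewrite -[X in 0 < m X -> _](setUIDK A (U k)) measureU//; last 3 first.
  - exact: measurableI.
  - exact: measurableD.
  - by apply/seteqP; split => // x /=; tauto.
  have mAU0 : m (A `&` U k) = 0 by apply/eqP; rewrite eq_le AU measure_ge0.
  by rewrite [X in X + _]mAU0 add0e setDE.
have step_side A k x y : step A k x -> step A k y -> U k x <-> U k y.
  by rewrite /step; case: pselect => _ [] /= _ + [] /= _; tauto.
pose S := fix S k := if k is k'.+1 then step (S k') k' else V.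
have mS k : measurable (S k) by elim: k => //= k; exact: mstep.
have S0 k : 0 < m (S k) by elim: k => //= k; exact: step0.
have niS : nonincreasing_seq S.
  by apply/nonincreasing_seqP => k; apply/subsetPset; exact: stepS.
have mI : measurable (\bigcap_k S k) by exact: bigcapT_measurable.
have : m (S k) @[k --> \oo] --> m (\bigcap_k S k).
  by apply: nonincreasing_cvg_mu => //; rewrite -ge0_fin_numE// fin_num_measure.
move=> /cvg_lim cS.
have I1 : 1 <= m (\bigcap_k S k).
  rewrite -cS//; apply: lime_ge.
    apply: ereal_nonincreasing_is_cvgn => i j ij; apply: le_measure; rewrite ?inE//.
    exact/subsetPset/niS.
  by apply: nearW => k; exact: integer_measure_ge1.
have [I0|/set0P[x xS]] := eqVneq (\bigcap_k S k) set0.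
  by move: I1; rewrite I0 measure0 leNgt lte_fin ltr01.
exists x; first exact: (xS 0%N I).
apply: (lt_le_trans lte01); apply: le_trans I1 _; apply: le_measure; rewrite ?inE//.
  exact: measurable_singleton.
move=> y yS /=; apply: sepU => k.
exact: (step_side (S k) k _ _ (yS k.+1 I) (xS k.+1 I)).
Qed.

(** Induction on an integer bound of the mass of a set [V]: by [integer_measure_atom] a set of
    positive mass contains an atom, and removing it lowers the mass by at least 1. *)
Lemma integer_measure_atoms : exists T : set E, [/\ finite_set T,
  forall x, T x -> 0 < m [set x] & m (~` T) = 0].
Proof.
suff H N V : measurable V -> m V <= N%:R%:E -> exists T : set E, [/\ finite_set T,
    T `<=` V, forall x, T x -> 0 < m [set x] & m (V `\` T) = 0].
  have [N mN] := m_nat measurableT.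
  have [|T [fT _ T0 mT]] := H N setT measurableT; first by rewrite mN.
  by exists T; split => //; rewrite -setTD.
elim: N V => [|N IH] V mV VN.
  exists set0; split => //; rewrite setD0.
  by apply/eqP; rewrite eq_le measure_ge0 andbT.
have [V0|V0] := leP (m V) 0.
  exists set0; split => //; rewrite setD0.
  by apply/eqP; rewrite eq_le measure_ge0 andbT.
have [x Vx x0] := integer_measure_atom mV V0.
have mx := measurable_singleton x.
have [||T [fT TV T0 mT]] := IH (V `\ x); first exact: measurableD.
  have := integer_measure_ge1 mx x0.
  have : m V = m [set x] + m (V `\ x).
    rewrite -measureU//; last 2 first.
    - exact: measurableD.
    - by apply/seteqP; split => // y /=; tauto.
    congr (m _); apply/seteqP; split => y /=.
      by have [|] := pselect (y = x); tauto.
    by move=> [->//|[]].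
  have /m_nat[a ->] := mx.
  have /m_nat[b ->] := measurableD mV mx.
  move=> Vab; move: VN; rewrite Vab -EFinD -natrD !lee_fin !ler_nat ler1n; lia.
exists (x |` T); split.
- by rewrite finite_setU; split.
- by move=> y [->//|/TV[]].
- by move=> y [->//|/T0].
- rewrite -mT; congr (m _); apply/seteqP; split => y /=; tauto.
Qed.

Let mt (T : set E) : finite_set T -> measurable T.
Proof.
by move=> /finite_set_countable; apply: countable_measurable => x; exact: measurable_singleton.
Qed.

Section atoms_set.
Variable T : set E.
Hypotheses (fT : finite_set T) (T0 : m (~` T) = 0).

Lemma pairs_singleton x y : (m \x m) [set (x, y)] = m [set x] * m [set y].
Proof.
rewrite -product_measure1E//; try exact: measurable_singleton.
by congr ((m \x m) _); apply/seteqP; split => [_ -> //|[a b] [/= -> ->]].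
Qed.

Lemma pairs_fsum D : measurable D ->
  (m \x m) D = \sum_(p \in D `&` (T `*` T)) (m [set p.1] * m [set p.2]).
Proof.
move=> mD; have mT := mt fT.
have mTT : measurable (T `*` T) by exact: measurableX.
have z1 : (m \x m) ((~` T) `*` setT) = 0.
  by rewrite product_measure1E//; [rewrite [X in X * _]T0 mul0e|exact: measurableC].
have z2 : (m \x m) (setT `*` (~` T)) = 0.
  by rewrite product_measure1E//; [rewrite [X in _ * X]T0 mule0|exact: measurableC].
have mz1 : measurable ((~` T) `*` [set: E]) by apply: measurableX => //; exact: measurableC.
have mz2 : measurable ([set: E] `*` (~` T)) by apply: measurableX => //; exact: measurableC.
rewrite -(setUIDK D (T `*` T)) measureU; last 3 first.
- exact: measurableI.
- exact: measurableD.
- by apply/seteqP; split => // z /=; tauto.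
rewrite [X in _ + X](@subset_measure0 _ _ _ (m \x m) _ ((~` T) `*` setT `|` setT `*` (~` T))); last 4 first.
- exact: measurableD.
- exact: measurableU.
- move=> [x y] /= [_ /not_andP[]]; tauto.
- exact: (etrans (measureU0 mz1 mz2 z2) z1).
rewrite adde0 setUIDK.
have fD : finite_set (D `&` (T `*` T)).
  by apply: (@sub_finite_set _ _ (T `*` T)); [exact: subIsetr|exact: finite_setX].
transitivity ((m \x m) (\big[setU/set0]_(p \in D `&` (T `*` T)) [set p])).
  by rewrite fsbig_setU_set1.
rewrite measure_fsbig//; last 2 first.
- move=> [x y] _; rewrite (_ : [set (x, y)] = [set x] `*` [set y]).
    by apply: measurableX; exact: measurable_singleton.
  by apply/seteqP; split => [_ -> //|[a b] [/= -> ->]].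
- by apply/trivIsetP => i j _ _ ij; apply/seteqP; split => // p [] /= -> ij'; rewrite ij' eqxx in ij.
by apply: eq_fsbigr => -[x y] _; exact: pairs_singleton.
Qed.

Lemma integer_measure_fsum A : measurable A -> m A = \sum_(x \in A `&` T) m [set x].
Proof.
move=> mA; have mT := mt fT.
have fA : finite_set (A `&` T).
  by apply: (@sub_finite_set _ _ T) => //; exact: subIsetr.
rewrite -(setUIDK A T) measureU; last 3 first.
- exact: measurableI.
- exact: measurableD.
- by apply/seteqP; split => // z /=; tauto.
rewrite [X in _ + X](@subset_measure0 _ _ _ m _ (~` T)); last 4 first.
- exact: measurableD.
- exact: measurableC.
- by move=> x [].
- exact: T0.
rewrite adde0 setUIDK.
transitivity (m (\big[setU/set0]_(p \in A `&` T) [set p])).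
  by rewrite fsbig_setU_set1.
rewrite measure_fsbig//; first by move=> x _; exact: measurable_singleton.
by apply/trivIsetP => i j _ _ ij; apply/seteqP; split => // p [] /= -> ij'; rewrite ij' eqxx in ij.
Qed.

End atoms_set.

Lemma pairs_diagonal T : finite_set T -> m (~` T) = 0 ->
  (m \x m) [set z : E * E | z.1 = z.2] = \sum_(x \in T) (m [set x] * m [set x]).
Proof.
move=> fT T0; rewrite (pairs_fsum fT T0); last exact: measurable_diagonal.
apply: (@reindex_fsbig _ _ _ _ _ (fun x : E => (x, x)) T); split.
- by move=> x Tx.
- by move=> x y _ _ [].
- by move=> [x y] /= [-> [Ty _]]; exists y.
Qed.

Let atomE x : m [set x] = (fine (m [set x]))%:E.
Proof. by rewrite fineK// fin_num_measure//; exact: measurable_singleton. Qed.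

Let atom_ge1 x : 0 < m [set x] -> (1 <= fine (m [set x]))%R.
Proof.
move=> x0; have := integer_measure_ge1 (measurable_singleton x) x0.
by rewrite [X in _ <= X]atomE lee_fin.
Qed.

(** Both sides are sums over the atoms, of [k] and of [k ^+ 2] for positive integers [k]. For the
    Poisson measure, equality of the means will force equality almost surely. *)
Lemma pairs_diagonal_ge : m setT <= (m \x m) [set z : E * E | z.1 = z.2].
Proof.
have [T [fT posT T0]] := integer_measure_atoms.
rewrite (pairs_diagonal fT T0) (integer_measure_fsum fT T0)// setTI.
apply: lee_fsum => // x Tx; have := atom_ge1 (posT x Tx).
by rewrite atomE -EFinM !lee_fin; nra.
Qed.

(* A sum of the squares of positive integers equals their sum only if all of
   them are 1. *)
Lemma pairs_diagonal_simple T : finite_set T -> (forall x, T x -> 0 < m [set x]) ->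
  m (~` T) = 0 -> (m \x m) [set z : E * E | z.1 = z.2] = m setT ->
  forall x, T x -> m [set x] = 1.
Proof.
move=> fT posT T0; rewrite (pairs_diagonal fT T0) (integer_measure_fsum fT T0)// setTI.
pose k x := fine (m [set x]); pose f x := (k x * k x - k x)%R.
have -> : \sum_(x \in T) (m [set x] * m [set x]) = (\sum_(x \in T) (f x + k x))%:E.
  rewrite -fsumEFin//; apply: eq_fsbigr => x _.
  by rewrite atomE -EFinM /f subrK.
have -> : \sum_(x \in T) m [set x] = (\sum_(x \in T) k x)%:E.
  by rewrite -fsumEFin//; apply: eq_fsbigr => x _; rewrite atomE.
rewrite fsbig_split// => -[/eqP]; rewrite -subr_eq0 addrK => /eqP f0 x Tx.
have k1 y : T y -> (1 <= k y)%R by move=> Ty; exact: atom_ge1 (posT y Ty).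
have fge0 y : T y -> (0 <= f y)%R by move=> /k1; rewrite /f; nra.
have /eqP := pfsumr_eq0 fT fge0 f0 Tx.
rewrite atomE /f -{3}[k x]mulr1 -mulrBr mulf_eq0 => /orP[] /eqP fx; congr EFin.
  by have := k1 x Tx; rewrite fx; lra.
by rewrite -/(k x); lra.
Qed.

End integer_measure.

End separating_family.

(** * Cubes and translations in R^d *)

Section geometry.
Context (R : realType).

Lemma lebesgue_measure_translation (c : R) (A : set R) : measurable A ->
  lebesgue_measure ((fun x : measurableTypeR R => x - c) @^-1` A) = lebesgue_measure A.
Proof.
have mf : measurable_fun setT (fun x : measurableTypeR R => x - c : measurableTypeR R).
  by apply: measurable_funB.
move=> mA; apply/esym.
apply: (@lebesgue_measure_unique R
  (measure_function_pushforward__canonical__measure_function_Measure lebesgue_measure mf)) => //.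
move=> _ [[a b]] _ <-.
rewrite /= /pushforward.
have -> : (fun x : R => x - c) @^-1` `]a, b]%classic = `]a + c, b + c]%classic.
  by apply/seteqP; split => x /=; rewrite !in_itv/= ltrBrDr lerBlDr.
rewrite !lebesgue_measure_itv/= !lte_fin ltrD2r.
by case: ifP => // _; rewrite -!EFinB; congr EFin; ring.
Qed.

Section dim.
Variable d : nat.
Implicit Types x y : Rd R d.

Lemma tnth_tsub x y i : tnth (tsub x y) i = (tnth x i : R) - tnth y i.
Proof. by rewrite tnth_mktuple. Qed.

Lemma tsubxx x : tsub x x = tzero.
Proof. by apply: eq_from_tnth => i; rewrite !tnth_mktuple subrr. Qed.

Lemma topp_tsub x y : topp (tsub x y) = tsub y x.
Proof. by apply: eq_from_tnth => i; rewrite !tnth_mktuple opprB. Qed.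

Lemma measurable_tsub : measurable_fun setT (fun z : Rd R d * Rd R d => tsub z.1 z.2).
Proof.
apply/measurable_fun_tnthP => i.
rewrite (_ : _ \o _ = fun z : Rd R d * Rd R d => (tnth z.1 i : R) - tnth z.2 i); last first.
  by apply/funext => z /=; rewrite tnth_tsub.
apply: measurable_funB.
- by apply: (measurableT_comp (measurable_tnth i)); exact: measurable_fst.
- by apply: (measurableT_comp (measurable_tnth i)); exact: measurable_snd.
Qed.

Lemma measurable_tsubr x : measurable_fun setT (fun y : Rd R d => tsub y x).
Proof.
apply: (measurableT_comp measurable_tsub (g := fun y => (y, x))).
exact: measurable_pair2.
Qed.

(** A countable family that separates the points of R^d: a rational threshold on one coordinate.
    Codes of no pair give the empty set, which separates nothing and does no harm. *)
Definition half_space (k : nat) : set (Rd R d) :=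
  if @unpickle ('I_d * rat)%type k is Some (i, q) then [set x | (tnth x i : R) <= ratr q]
  else set0.

Lemma measurable_half_space k : measurable (half_space k).
Proof.
rewrite /half_space; case: unpickle => [[i q]|]; last exact: measurable0.
have -> : [set x : Rd R d | (tnth x i : R) <= ratr q] = (fun x : Rd R d => tnth x i) @^-1` `]-oo, (ratr q : R)]%classic.
  by apply/seteqP; split => x /=; rewrite in_itv.
rewrite -[X in measurable X]setTI; apply: measurable_tnth => //.
Qed.

Lemma half_space_separates x y : (forall k, half_space k x <-> half_space k y) -> x = y.
Proof.
move=> xy; apply: eq_from_tnth => i.
have {}xy q : (tnth x i : R) <= ratr q <-> (tnth y i : R) <= ratr q.
  by have := xy (pickle (i, q)); rewrite /half_space pickleK.
apply/eqP; rewrite -[_ == _]negbK; apply/negP.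
rewrite neq_lt => /orP[] /rat_in_itvoo[q]; rewrite in_itv/= => /andP[h1 h2].
- by have := (xy q).1 (ltW h1); rewrite leNgt h2.
- by have := (xy q).2 (ltW h1); rewrite leNgt h2.
Qed.

Lemma cube_box v : cube v = [set x : Rd R d | forall i,
  `[- (2^-1 * v `^ (d%:R^-1)), 2^-1 * v `^ (d%:R^-1)]%classic (tnth x i)].
Proof. by apply/seteqP; split => x h i; have := h i; rewrite /= in_itv/= ler_norml. Qed.

Lemma measurable_cube v : measurable (cube v : set (Rd R d)).
Proof.
rewrite cube_box (_ : [set _ | _] = \bigcap_(i in [set: 'I_d]) ((fun x : Rd R d => tnth x i) @^-1`
    `[- (2^-1 * v `^ (d%:R^-1)), 2^-1 * v `^ (d%:R^-1)]%classic)).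
  apply: fin_bigcap_measurable => // i _.
  by rewrite -[X in measurable X]setTI; apply: measurable_tnth => //; exact: measurable_itv.
by apply/seteqP; split => x h i; [move=> _; exact: h|exact: h].
Qed.

Lemma lebesgue_cube v : (lebesgue_Rd R d (cube v) = ((v `^ (d%:R^-1)) ^+ d)%:E)%E.
Proof.
rewrite cube_box (lebesgue_Rd_box (A := fun=>
  `[- (2^-1 * v `^ (d%:R^-1)), 2^-1 * v `^ (d%:R^-1)]%classic)); last first.
  by move=> i; exact: measurable_itv.
rewrite (eq_bigr (fun=> (v `^ (d%:R^-1))%:E)).
  by rewrite prodEFin prodr_const card_ord.
move=> i _; rewrite lebesgue_measure_itv/= lte_fin.
set w := v `^ _; have w0 : 0 <= w by exact: powR_ge0.
case: ifPn => h; first by rewrite -EFinB; congr EFin; lra.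
by congr EFin; move: h; rewrite -leNgt; lra.
Qed.

Lemma lebesgue_singleton x : (0 < d)%N -> (lebesgue_Rd R d [set x] = 0)%E.
Proof.
move=> d0.
have -> : [set x] = [set y : Rd R d | forall i, [set tnth x i : R] (tnth y i)].
  by apply/seteqP; split => [_ -> //|y xy]; apply: eq_from_tnth => i; exact: xy.
rewrite (lebesgue_Rd_box (A := fun i => [set tnth x i : R])); last by move=> i; exact: measurable_set1.
by rewrite (bigD1 (Ordinal d0))//= lebesgue_measure_set1 mul0e.
Qed.

Lemma subset_cube u v : 0 <= u -> u <= v -> cube u `<=` (cube v : set (Rd R d)).
Proof.
move=> u0 uv x h i; apply: le_trans (h i) _; rewrite ler_wpM2l//.
by rewrite ge0_ler_powR// nnegrE// (le_trans u0).
Qed.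

(** Differences of points of the window lie in the cube of side 2, whose volume is [2 ^+ d]; this is
    why degrees are governed by [psi_hat]. *)
Lemma tsub_cube x y : (0 < d)%N -> cube 1 x -> cube 1 y -> cube (2 ^+ d) (tsub x y).
Proof.
move=> d0 hx hy i; rewrite tnth_tsub.
have -> : (2 ^+ d : R) `^ d%:R^-1 = 2.
  rewrite -powR_mulrn// -powRrM divff ?powRr1// pnatr_eq0; lia.
have := hx i; have := hy i; rewrite powR1.
have := ler_normB (tnth x i : R) (tnth y i); lra.
Qed.

End dim.

(** As [lebesgue_Rd] is an iterated product, a translation splits into one of the first coordinate
    and one of the others; uniqueness of the product measure on rectangles closes the induction. *)
Lemma lebesgue_translation d (x : Rd R d) (A : set (Rd R d)) : measurable A ->
  lebesgue_Rd R d ((fun y : Rd R d => tsub y x) @^-1` A) = lebesgue_Rd R d A.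
Proof.
elim: d x A => [|d IH] x A mA.
  rewrite (_ : _ @^-1` _ = A)//; apply/seteqP.
  by split => y /=; rewrite (tuple0 (tsub y x)) (tuple0 y).
pose x' := [tuple of behead x] : Rd R d.
pose g (z : measurableTypeR R * Rd R d) : measurableTypeR R * Rd R d :=
  (z.1 - thead x, tsub z.2 x').
have mg : measurable_fun setT g.
  apply/measurable_fun_pairP; split.
    by apply: measurable_funB => //; exact: measurable_fst.
  exact: (measurableT_comp (measurable_tsubr x') measurable_snd).
have E z : tsub (tcons z) x = tcons (g z).
  apply: eq_from_tnth => i; rewrite tnth_tsub.
  case: (unliftP ord0 i) => [j ->|->]; last by rewrite !tnth0.
  rewrite !tnthS tnth_tsub; congr (_ - _); rewrite tnth_behead; congr tnth.
  by apply: val_inj; rewrite [RHS]inordK ?ltnS.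
rewrite /= /cons_measure /pushforward.
have -> : @tcons R d @^-1` ((fun y : Rd R d.+1 => tsub y x) @^-1` A) = g @^-1` (@tcons R d @^-1` A).
  by apply/seteqP; split => z; rewrite /= E.
apply/esym.
apply: (@product_measure_unique _ _ _ _ _ _ _
  (measure_function_pushforward__canonical__measure_function_Measure
     (lebesgue_measure \x lebesgue_Rd R d)%E mg)); last first.
  by rewrite -[X in measurable X]setTI; exact: measurable_tcons.
move=> B C mB mC.
transitivity ((lebesgue_measure \x lebesgue_Rd R d)%E (g @^-1` (B `*` C))) => //.
have -> : g @^-1` (B `*` C) = ((fun a : measurableTypeR R => a - thead x) @^-1` B) `*`
    ((fun y : Rd R d => tsub y x') @^-1` C) by [].
rewrite product_measure1E.
- by congr (_ * _)%E; [exact: lebesgue_measure_translation|exact: IH].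
- by rewrite -[X in measurable X]setTI; apply: (measurable_funB (f := id) (g := cst (thead x))).
- by rewrite -[X in measurable X]setTI; exact: measurable_tsubr.
Qed.

End geometry.

(** * The edge count of the graph *)

Section edge_process.
Local Open Scope ereal_scope.
Context (R : realType) (d : nat) (d_gt0 : (0 < d)%N)
  (dO : measure_display) (Omega : measurableType dO) (P : probability Omega R)
  (eta : R.-ker Omega ~> Rd R d) (lam : R) (lam_gt0 : (0 < lam)%R)
  (eta_points : forall w, locally_finite_point_measure (eta w))
  (eta_poisson : poisson_measure P eta (intensity d lam))
  (H : set (Rd R d)) (mH : measurable H) (Hsym : H = @topp R d @` H)
  (H0 : ~ H tzero).
Notation E := (Rd R d).
Notation mu := (intensity d lam : {sigma_finite_measure set E -> \bar R}).
Notation mu2 := (mu \x mu).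
Notation W := (cube 1 : set E).

Lemma intensityE (A : set E) : mu A = lam%:E * lebesgue_Rd R d A.
Proof. by transitivity (`|lam|%:E * lebesgue_Rd R d A) => //; rewrite gtr0_norm. Qed.

Let mW : measurable W := @measurable_cube R d 1%R.

Lemma intensity_cube v : mu (cube v) < +oo.
Proof. by rewrite intensityE lebesgue_cube -EFinM ltry. Qed.

Let muW : mu W < +oo := intensity_cube 1.

Lemma eta_nat w A : measurable A -> A `<=` W -> exists k : nat, eta w A = k%:R%:E.
Proof. by move=> mA AW; exact: eta_points AW. Qed.

Lemma eta_cube_lty w : eta w W < +oo.
Proof. by have [k ->] := eta_nat w mW (@subset_refl _ _); exact: ltry. Qed.

Let etaW := eta_cube_lty.

Definition edge_set : set (E * E) :=
  [set z | [/\ cube 1 z.1, cube 1 z.2 & H (tsub z.1 z.2)]].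

Lemma measurable_edge_set : measurable edge_set.
Proof.
have -> : edge_set = (fst @^-1` W) `&` (snd @^-1` W) `&`
    ((fun z : E * E => tsub z.1 z.2) @^-1` H).
  by apply/seteqP; split => [z [] //|z [[]] //].
apply: measurableI; first apply: measurableI.
- by rewrite -[X in measurable X]setTI; exact: measurable_fst.
- by rewrite -[X in measurable X]setTI; exact: measurable_snd.
- by rewrite -[X in measurable X]setTI; exact: measurable_tsub.
Qed.

Lemma H_tsubC x y : H (tsub x y) -> H (tsub y x).
Proof. by move=> Hxy; rewrite Hsym; exists (tsub x y) => //; exact: topp_tsub. Qed.

Lemma edge_set_irr x : ~ edge_set (x, x).
Proof. by case => _ _ /=; rewrite tsubxx. Qed.

Lemma edge_set_sym x y : edge_set (x, y) -> edge_set (y, x).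
Proof. by case => /= ? ? /H_tsubC ?; split. Qed.

Definition pairs w := eta_pairs mW etaW w.

(** A natural-valued version of [edge_stat], measurable because it only depends on the mass of one
    measurable set of pairs. *)
Definition edge_num w : nat := natof (pairs w edge_set).

Let restr_nat w A : measurable A -> exists k : nat, eta_restr mW etaW w A = k%:R%:E.
Proof. by move=> mA; apply: (@eta_nat w (A `&` W)); [exact: measurableI|exact: subIsetr]. Qed.

Let mhs := @measurable_half_space R d.
Let seph := @half_space_separates R d.
Let diag := [set z : E * E | z.1 = z.2].
Let mdiag : measurable diag := measurable_diagonal mhs seph.

Lemma mu_singleton x : mu [set x] = 0.
Proof. by rewrite intensityE lebesgue_singleton// mule0. Qed.

Lemma mu_pairs_diag : mu_pairs mW muW diag = 0.
Proof.
rewrite /mu_pairs/= /product_measure1; apply: integral0_eq => x _ /=.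
rewrite /mfrestr /mrestr (_ : xsection diag x = [set x]); last first.
  by apply/seteqP; split => y; rewrite /xsection/= inE.
apply: (@subset_measure0 _ _ _ mu _ [set x]); last exact: mu_singleton.
- by apply: measurableI => //; exact: measurable_singleton mhs seph x.
- exact: measurable_singleton mhs seph x.
- by move=> y [].
Qed.

Lemma eta_mean1 A : measurable A -> mu A < +oo -> \int[P]_w eta w A = mu A.
Proof.
move=> mA Aoo.
have m1 : forall i : 'I_1, measurable ((fun=> A) i) by [].
have oo1 : forall i : 'I_1, mu ((fun=> A) i) < +oo by [].
have t1 : trivIset [set: 'I_1] (fun=> A).
  by apply/trivIsetP => i j _ _; rewrite !ord1 eqxx.
have [N [mN N0 NE]] := count_off_null eta_poisson m1 oo1.
have mX := measurable_count eta m1; have lX := law_count eta_poisson m1 oo1 t1.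
transitivity (\int[P]_w ((count eta (fun _ : 'I_1 => A) w ord0)%:R%:E)).
  apply: (integral_off_null mN N0); last by move=> w /NE/(_ ord0).
  by apply/measurable_EFinP; exact: (measurable_val mX (fun x => (x ord0)%:R)).
have p0 : forall i : 'I_1, (0 <= fine (mu ((fun=> A) i)))%R by move=> _; exact: fine_ge0.
rewrite ExE; last exact: (polyb_itg p0 mX lX (polyb_coord ord0)).
rewrite [X in X%:E](Ev_coord p0 mX lX ord0).
by rewrite fineK// ge0_fin_numE.
Qed.

(** The diagonal mass is the sum of the squared multiplicities, hence at least [eta w W]. Both have
    mean [mu W], because the product of the intensities does not charge the diagonal, and a
    nonnegative variable of mean 0 vanishes almost surely. *)
Lemma simple_off_null : exists N, [/\ measurable N, P N = 0 &
  forall w, ~ N w -> pairs w diag = eta w W].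
Proof.
have [mq iq] := pairs_mean eta_poisson mW muW etaW mdiag.
have iW := eta_mean1 mW muW.
have meW := measurable_eta eta mW.
have fW w : eta w W \is a fin_num by rewrite ge0_fin_numE.
have fq w : pairs w diag \is a fin_num.
  rewrite ge0_fin_numE//; apply: le_lt_trans (eta_pairsT mW etaW w).
  by apply: le_measure; rewrite ?inE.
have iq' : \int[P]_w pairs w diag = mu W.
  rewrite iq mean_pairsE mu_pairs_diag add0e /= /mfrestr /mrestr.
  by congr (mu _); apply/seteqP; split => x //= [].
have le w : eta w W <= pairs w diag.
  have := pairs_diagonal_ge mhs seph (restr_nat w).
  by rewrite /= /mfrestr /mrestr setTI.
have iW' : P.-integrable setT (fun w => eta w W).
  apply/integrableP; split => //.
  by under eq_integral do rewrite gee0_abs//; rewrite iW.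
have iq'' : P.-integrable setT (fun w => pairs w diag).
  apply/integrableP; split => //.
  by under eq_integral do rewrite gee0_abs//; rewrite iq'.
have : \int[P]_w (pairs w diag - eta w W) = 0.
  rewrite integralB// iq' iW subee//.
  by rewrite ge0_fin_numE.
have mB : measurable_fun setT (fun w => pairs w diag - eta w W) by exact: emeasurable_funB.
move=> h.
have : \int[P]_w `|pairs w diag - eta w W| = 0.
  rewrite -[RHS]h; apply: eq_integral => w _; rewrite gee0_abs// sube_ge0//.
  by rewrite fW.
move/(ae_eq_integral_abs P measurableT mB) => [N [mN N0 NE]].
exists N; split => // w Nw; apply: contrapT => ne; apply: Nw; apply: NE => /= /(_ I).
by move/eqP; rewrite sube_eq ?fq ?fin_num_adde_defl// add0e => /eqP.
Qed.

(** Almost surely all atoms in the window have mass 1, so each ordered pair of atoms has mass 1 and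
    the mass of the edge set is a number of pairs. These are pairs of distinct points since [H]
    avoids the origin. *)
Lemma edge_num_off_null : exists N, [/\ measurable N, P N = 0 &
  forall w, ~ N w -> pairs w edge_set = (edge_num w)%:R%:E /\
   (\sum_(p \in ordered_edges H (atoms (eta w) `&` cube 1)) (1 : R) = (edge_num w)%:R)%R].
Proof.
have [N [mN N0 NE]] := simple_off_null; exists N; split => // w /NE simp.
have [T [fT posT T0]] := integer_measure_atoms mhs seph (restr_nat w).
have T1 := pairs_diagonal_simple mhs seph (restr_nat w) fT posT T0.
have {}T1 x : T x -> eta_restr mW etaW w [set x] = 1.
  by apply: T1; rewrite [LHS]simp /= /mfrestr /mrestr setTI.
have mx x : measurable [set x : E] := measurable_singleton mhs seph x.
have restr1 x : W x -> eta_restr mW etaW w [set x] = eta w [set x].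
  move=> Wx; rewrite /= /mfrestr /mrestr; congr (eta w _).
  by apply/seteqP; split => [y []//|y /= ->].
have TW x : T x -> W x.
  move=> Tx; apply: contrapT => Wx; have := T1 x Tx.
  rewrite /= /mfrestr /mrestr (_ : _ `&` _ = set0) ?measure0.
    by move=> [] /eqP; rewrite eq_sym oner_eq0.
  by apply/seteqP; split => // y [/= ->].
have TE : atoms (eta w) `&` cube 1 = T.
  apply/seteqP; split => x.
    move=> [ax Wx]; apply: contrapT => Tx; move: ax; rewrite /atoms/= -restr1//.
    rewrite (@subset_measure0 _ _ _ (eta_restr mW etaW w) [set x] (~` T)) ?ltxx//.
    - by apply: measurableC; apply: countable_measurable => //; exact: finite_set_countable.
    - by move=> y /= ->.
  by move=> Tx; split; [rewrite /atoms/= -restr1 ?T1//|]; exact: TW.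
have DE : edge_set `&` (T `*` T) = ordered_edges H T.
  apply/seteqP; split => [[x y] /= [[/= Wx Wy Hxy] [/= Tx Ty]]|[x y] [/= Tx Ty xy Hxy]].
    split => //= xy; apply: H0; rewrite -(tsubxx y); by move: Hxy; rewrite xy.
  by split => //; split => //=; exact: TW.
have fD : finite_set (ordered_edges H T).
  by rewrite -DE; apply: (@sub_finite_set _ _ (T `*` T)); [exact: subIsetr|exact: finite_setX].
have pE : pairs w edge_set = (\sum_(p \in ordered_edges H T) (1 : R))%R%:E.
  rewrite [LHS](pairs_fsum mhs seph fT T0 measurable_edge_set) DE -fsumEFin//.
  apply: eq_fsbigr => p; rewrite inE => -[Tx Ty _ _].
  by rewrite [X in X * _](T1 _ Tx) [X in _ * X](T1 _ Ty) mule1.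
have [k kE] : exists k : nat, (\sum_(p \in ordered_edges H T) (1 : R) = k%:R)%R.
  eexists.
  by rewrite fsbig_finite//= big_const_seq count_predT iter_addr_0.
by rewrite TE pE /edge_num pE kE natofK.
Qed.

End edge_process.

Section product_square.
Local Open Scope ereal_scope.
Context (R : realType) (dE : measure_display) (E : measurableType dE)
  (m : {sigma_finite_measure set E -> \bar R}).

Lemma mu_pairsE (W : set E) (mW : measurable W) (moo : m W < +oo) D :
  measurable D -> mu_pairs mW moo D = (m \x m) (D `&` (W `*` W)).
Proof.
move=> mD.
have mWW : measurable (W `*` W) by exact: measurableX.
apply: (@product_measure_unique _ _ _ _ _ (mu_restr mW moo) (mu_restr mW moo)
  (mrestr (m \x m) mWW)) => // A B mA mB.
transitivity ((m \x m) ((A `*` B) `&` (W `*` W))) => //.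
by rewrite -setXI product_measure1E//; exact: measurableI.
Qed.

Lemma product_swap D : measurable D ->
  (m \x m) ((fun z : E * E => (z.2, z.1)) @^-1` D) = (m \x m) D.
Proof.
move=> mD; apply/esym.
have ms : measurable_fun setT (fun z : E * E => (z.2, z.1)).
  by apply/measurable_fun_pairP; split; [exact: measurable_snd|exact: measurable_fst].
apply: (@product_measure_unique _ _ _ _ _ _ _
  (measure_function_pushforward__canonical__measure_function_Measure (m \x m) ms)) => //.
move=> A B mA mB; rewrite muleC -product_measure1E//.
by rewrite /= /pushforward; congr product_measure1; apply/seteqP; split => -[x y] [].
Qed.

Lemma product_row_le C (K : R) A : measurable C -> (0 <= K)%R ->
  (forall x, m (xsection C x) <= K%:E) -> measurable A ->
  (m \x m) (C `&` (A `*` setT)) <= K%:E * m A.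
Proof.
move=> mC K0 CK mA.
have -> : m A = \int[m]_x (\1_A x)%:E by rewrite integral_indic// setIT.
rewrite -ge0_integralZl//; last first.
  by apply/measurable_EFinP; exact: measurable_indic.
apply: ge0_le_integral => //.
- apply: measurable_fun_xsection; apply: measurableI => //.
  exact: measurableX.
- by apply: emeasurable_funM => //; apply/measurable_EFinP; exact: measurable_indic.
move=> x _ /=; rewrite indicE; case: (boolP (x \in A)) => xA /=.
  rewrite mule1 (le_trans _ (CK x))// le_measure ?inE//; do ?exact: measurable_xsection.
    by apply: measurable_xsection; apply: measurableI => //; exact: measurableX.
  by move=> y; rewrite /xsection/= !inE => -[].
rewrite mule0 (_ : xsection _ _ = set0) ?measure0//.
apply/seteqP; split => // y; rewrite /xsection/= !inE => -[_ [/= Ax _]].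
by rewrite mem_set in xA.
Qed.

End product_square.

Section degree_bound.
Local Open Scope ereal_scope.
Context (R : realType) (d : nat) (d_gt0 : (0 < d)%N) (lam : R) (lam_gt0 : (0 < lam)%R)
  (H : set (Rd R d)) (mH : measurable H) (Hsym : H = @topp R d @` H).

Definition hat_deg : R := (lam * fine (lebesgue_Rd R d (H `&` cube (2 ^+ d))))%R.

(** The neighbours of [x], translated by [- x], lie in [H] and in the cube of side 2, wherever [x]
    lies in the window; translation invariance does the rest. *)
Lemma xsection_edge_set_le x : intensity d lam (xsection (edge_set H) x) <= hat_deg%:E.
Proof.
rewrite (intensityE lam_gt0) /hat_deg EFinM lee_wpmul2l ?lee_fin ?(ltW lam_gt0)//.
have mHc : measurable (H `&` cube (2 ^+ d)) by apply: measurableI => //; exact: measurable_cube.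
rewrite fineK; last first.
  rewrite ge0_fin_numE//; apply: (@le_lt_trans _ _ (lebesgue_Rd R d (cube (2 ^+ d)))).
    by apply: le_measure; rewrite ?inE//; exact: measurable_cube.
  by rewrite lebesgue_cube ltry.
rewrite -(lebesgue_translation x mHc); apply: le_measure; rewrite ?inE.
- exact: measurable_xsection (measurable_edge_set mH).
- by rewrite -[X in measurable X]setTI; exact: measurable_tsubr.
- move=> y; rewrite /xsection /= inE => -[/= Wx Wy Hxy]; split.
    exact: H_tsubC.
  exact: tsub_cube.
Qed.

Lemma hat_deg_ge0 : (0 <= hat_deg)%R.
Proof. by rewrite mulr_ge0 ?(ltW lam_gt0)//; exact: fine_ge0. Qed.

End degree_bound.

(** * Majority vote on the cells of a step kernel *)

Section step_cells.
Context (R : realType) (dE : measure_display) (E : measurableType dE)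
  (m : {sigma_finite_measure set E -> \bar R}) (n : nat) (A : 'I_n -> set E).
Hypothesis stepA : step_sets m A.
Notation m2 := (m \x m)%E.
Implicit Types (b : 'I_n -> 'I_n -> R) (C : set (E * E)).

Let mA i : measurable (A i). Proof. by case: stepA. Qed.
Let Aoo i : (m (A i) < +oo)%E. Proof. by case: stepA. Qed.
Let tA : trivIset setT A. Proof. by case: stepA. Qed.

Definition cell i j := A i `*` A j.

Definition cells : set (E * E) := [set z | exists i j, [/\ i != j, A i z.1 & A j z.2]].

Let mcell i j : measurable (cell i j). Proof. exact: measurableX. Qed.

Let A_inj i j x : A i x -> A j x -> i = j.
Proof. by move=> Ai Aj; apply: tA => //; exists x. Qed.

Lemma step2_in b i j z : i != j -> A i z.1 -> A j z.2 -> step2 b A z = b i j.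
Proof.
move=> ij Ai Aj; rewrite /step2 (bigD1 i)//= (bigD1 j)//= !indicE !mem_set// mulr1 mulr1.
rewrite big1 ?addr0 => [|k /andP[_ kj]]; last first.
  rewrite !indicE (memNset (A := A k)) ?mulr0// => Ak; move: kj.
  by rewrite (A_inj Ak Aj) eqxx.
rewrite big1 ?addr0// => k ki; apply: big1 => l _; rewrite !indicE (memNset (A := A k)) ?mul0r ?mulr0// => Ak.
by move: ki; rewrite (A_inj Ak Ai) eqxx.
Qed.

Lemma step2_out b z : ~ cells z -> step2 b A z = 0.
Proof.
move=> nz; apply: big1 => i _; apply: big1 => j ij; rewrite !indicE.
have [Ai|Ai] := pselect (A i z.1); last by rewrite memNset// mul0r mulr0.
have [Aj|Aj] := pselect (A j z.2); last by rewrite [z.2 \in _]memNset// !mulr0.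
by case: nz; exists i, j.
Qed.

Let p i := fine (m (A i)).
Let c C i j := fine (m2 (C `&` cell i j)).

(** The integral over the cell of the squared difference between the indicator of [C] and the
    constant [b i j]. *)
Definition cell_err C b i j : R :=
  c C i j * (1 - b i j) ^+ 2 + (p i * p j - c C i j) * b i j ^+ 2.

Let m2cell i j : m2 (cell i j) = (p i * p j)%:E.
Proof.
rewrite product_measure1E// EFinM /p !fineK// ge0_fin_numE//; exact: Aoo.
Qed.

Let m2C C i j : measurable C -> m2 (C `&` cell i j) = (c C i j)%:E.
Proof.
move=> mC; rewrite /c fineK// ge0_fin_numE//.
apply: (@le_lt_trans _ _ (m2 (cell i j))); last by rewrite m2cell ltry.
by apply: le_measure; rewrite ?inE//; exact: measurableI.
Qed.

Let m2D C i j : measurable C -> m2 (cell i j `\` C) = (p i * p j - c C i j)%:E.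
Proof.
move=> mC; rewrite [LHS]measureD//; last by rewrite [X in (X < _)%E]m2cell ltry.
rewrite [X in (X - _)%E]m2cell EFinB; congr (_ - _)%E.
by rewrite setIC; exact: m2C.
Qed.

Lemma measurable_cells : measurable cells.
Proof.
have -> : cells = \bigcup_(q in [set q : 'I_n * 'I_n | q.1 != q.2]) cell q.1 q.2.
  apply/seteqP; split => [z [i [j [ij Ai Aj]]]|z [[i j] /= ij [/= Ai Aj]]].
    by exists (i, j).
  by exists i, j.
apply: fin_bigcup_measurable => // q _; exact: mcell.
Qed.

(** A step kernel vanishes off [cells], where all of [C] is error, and is constant on each product
    of two distinct cells. *)
Lemma step_err_integral C b : measurable C ->
  (\int[m2]_z ((\1_C z - step2 b A z) ^+ 2)%:E =
   m2 (C `\` cells) + (\sum_(i < n) \sum_(j < n | i != j) cell_err C b i j)%:E)%E.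
Proof.
move=> mC; have mG := measurable_cells.
pose t i j (z : E * E) : R := (i != j)%:R *
  ((1 - b i j) ^+ 2 * \1_(C `&` cell i j) z + b i j ^+ 2 * \1_(cell i j `\` C) z).
have t0 i j z : 0 <= t i j z.
  by rewrite mulr_ge0// addr_ge0// mulr_ge0// sqr_ge0.
have mt i j : measurable_fun setT (t i j).
  apply: measurable_funM => //; apply: measurable_funD; apply: measurable_funM => //.
    by apply: measurable_indic; exact: measurableI.
  by apply: measurable_indic; exact: measurableD.
(* For fixed [z] the double sum is itself a step kernel, whose coefficients depend on whether [z] is
   in [C]; [step2_in] and [step2_out] therefore evaluate it. *)
have tE z (s : R) : (z \in C)%:R = s ->
   (\sum_(i < n) \sum_(j < n) t i j z) =
   step2 (fun i j => s * (1 - b i j) ^+ 2 + (1 - s) * b i j ^+ 2) A z.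
  move=> <-; apply: eq_bigr => i _; rewrite [RHS]big_mkcond; apply: eq_bigr => j _.
  rewrite /t; case: ifPn => _; last by rewrite mul0r.
  rewrite mul1r !indicE in_setI in_setD /cell in_setX/=.
  by case: (z \in C); case: (z.1 \in A i); case: (z.2 \in A j) => /=; ring.
have E1 z : (\1_C z - step2 b A z) ^+ 2 = \1_(C `\` cells) z + \sum_(i < n) \sum_(j < n) t i j z.
  rewrite (tE z _ erefl) !indicE in_setD.
  have [[i [j [ij Ai Aj]]]|nz] := pselect (cells z).
    rewrite !(step2_in _ ij Ai Aj) [z \in cells]mem_set; last by exists i, j.
    by case: (z \in C) => /=; ring.
  by rewrite !step2_out// [z \in cells]memNset// andbT; case: (z \in C) => /=; ring.
have mCG : measurable (C `\` cells) by exact: measurableD.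
transitivity (\int[m2]_z ((\1_(C `\` cells) z)%:E + \sum_(i < n) \sum_(j < n) (t i j z)%:E))%E.
  apply: eq_integral => z _; rewrite E1 EFinD -sumEFin; congr (_ + _)%E.
  by apply: eq_bigr => i _; rewrite sumEFin.
rewrite ge0_integralD//; last 3 first.
- by apply/measurable_EFinP; exact: measurable_indic.
- by move=> z _; apply: sume_ge0 => i _; apply: sume_ge0 => j _; rewrite lee_fin.
- by apply: emeasurable_sum => i; apply: emeasurable_sum => j; exact/measurable_EFinP.
rewrite integral_indic// setIT; congr (_ + _)%E.
rewrite ge0_integral_sum//; last 2 first.
- by move=> i; apply: emeasurable_sum => j; exact/measurable_EFinP.
- by move=> i z _; apply: sume_ge0 => j _; rewrite lee_fin.
rewrite -sumEFin; apply: eq_bigr => i _.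
rewrite ge0_integral_sum//; last 2 first.
- by move=> j; exact/measurable_EFinP.
- by move=> j z _; rewrite lee_fin.
rewrite -sumEFin [RHS]big_mkcond; apply: eq_bigr => j _.
rewrite /t; case: ifPn => ij; last by under eq_integral do rewrite mul0r; rewrite integral0.
under eq_integral do rewrite mul1r EFinD !EFinM.
have mI1 : measurable (C `&` cell i j) by exact: measurableI.
have mI2 : measurable (cell i j `\` C) by exact: measurableD.
rewrite ge0_integralD//; last 4 first.
- by move=> z _; rewrite mule_ge0// lee_fin sqr_ge0.
- by apply: emeasurable_funM => //; apply/measurable_EFinP; exact: measurable_indic.
- by move=> z _; rewrite mule_ge0// lee_fin sqr_ge0.
- by apply: emeasurable_funM => //; apply/measurable_EFinP; exact: measurable_indic.
rewrite !ge0_integralZl_EFin ?sqr_ge0//; last 2 first.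
- by apply/measurable_EFinP; exact: measurable_indic.
- by apply/measurable_EFinP; exact: measurable_indic.
rewrite !integral_indic// !setIT [X in (_ * X + _)%E]m2C// [X in (_ + _ * X)%E]m2D//.
rewrite -!EFinM -EFinD /cell_err; congr EFin.
by ring.
Qed.

Section majority.
Context (C : set (E * E)) (D : R) (a : 'I_n -> 'I_n -> R) (e : R).
Hypothesis mC : measurable C.
Hypothesis Csym : forall x y, C (x, y) -> C (y, x).
Hypothesis D0 : 0 <= D.
Hypothesis CD : forall x, (m (xsection C x) <= D%:E)%E.
Hypothesis aE : (\int[m2]_z ((\1_C z - step2 a A z) ^+ 2)%:E < e%:E)%E.

(** The rule depends on the cells and on [C] only, not on the coefficients [a]. Products of a cell
    with itself are excluded, as in a step kernel. *)
Definition majority i j : bool := (i != j) && (p i * p j < 2 * c C i j).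

Let h i j : R := (majority i j)%:R.

Let c_ge0 i j : 0 <= c C i j. Proof. exact: fine_ge0. Qed.

Let c_le i j : c C i j <= p i * p j.
Proof.
rewrite -lee_fin -m2C// -m2cell; apply: le_measure; rewrite ?inE//.
exact: measurableI.
Qed.

Let p_ge0 i : 0 <= p i. Proof. exact: fine_ge0. Qed.

Lemma majority_sym i j : majority i j = majority j i.
Proof.
suff cs : c C i j = c C j i by rewrite /majority cs eq_sym [p i * _]mulrC.
rewrite /c -product_swap; last exact: measurableI.
congr (fine (m2 _)); apply/seteqP; split => -[x y] [/= /Csym Cxy [/= ? ?]];
  by split => //; split.
Qed.

Lemma majority_irr i : majority i i = false.
Proof. by rewrite /majority eqxx. Qed.

(** On a chosen product [p i * p j < 2 * c C i j], so [p i] times the degree is at most twice the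
    mass of [C] in the row of [A i], which is at most [D * p i]. *)
Lemma majority_deg i : \sum_(j < n) (majority i j)%:R * p j <= 2 * D.
Proof.
(* The strict inequality in [majority] matters here: a row with [p i = 0] contains no chosen
   product. *)
rewrite -/(p _); have [pi0|pi0] := eqVneq (p i) 0.
  rewrite big1 ?mulr_ge0// => j _; rewrite /majority -/(p _) -/(p _) -/(c C i j).
  have : c C i j <= 0 by have := c_le i j; rewrite pi0 mul0r.
  by rewrite pi0 mul0r ltNge => /(fun h => mulr_ge0_le0 (ler0n R 2) h) ->; rewrite andbF mul0r.
have {}pi0 : 0 < p i by rewrite lt_neqAle eq_sym pi0 p_ge0.
have row : \sum_(j < n) c C i j <= D * p i.
  rewrite -lee_fin EFinM [X in (_ <= _ * X)%E]fineK ?ge0_fin_numE//.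
  apply: le_trans (product_row_le mC D0 CD (mA i)).
  rewrite -sumEFin (eq_bigr (fun j => m2 (C `&` cell i j))); last by move=> j _; rewrite m2C.
  have tK : trivIset setT (fun j => C `&` cell i j).
    apply/trivIsetP => j k _ _ jk; apply/seteqP; split => // z [[_ [_ Aj]] [_ [_ Ak]]].
    by move: jk; rewrite (A_inj Aj Ak) eqxx.
  have mK j : measurable (C `&` cell i j) by exact: measurableI.
  rewrite -(measure_bigsetU_ord m2 predT mK tK); apply: le_measure; rewrite ?inE.
  - exact: bigsetU_measurable.
  - by apply: measurableI => //; exact: measurableX.
  - apply: (big_ind (fun X => X `<=` C `&` (A i `*` setT))) => //.
      by move=> X Y XB YB z [/XB|/YB].
    by move=> j _ z [Cz [Ai _]].
rewrite -(ler_pM2l pi0) mulr_sumr (@le_trans _ _ (\sum_(j < n) 2 * c C i j))//; last first.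
  by rewrite -mulr_sumr; nra.
apply: ler_sum => j _; rewrite /majority -/(p _) -/(p _) -/(c C i j).
case: ltP => h3; first by case: (i != j) => /=; have := c_ge0 i j; nra.
by rewrite andbF mul0r mulr0 mulr_ge0.
Qed.

Lemma cell_err_ge0 b i j : 0 <= cell_err C b i j.
Proof.
by rewrite addr_ge0// mulr_ge0// ?sqr_ge0// subr_ge0 c_le.
Qed.

(** With [P = p i * p j] and [c] the mass of [C] in the cell, the best real constant has error
    [c * (P - c) / P], at least half of the smaller of [c] and [P - c], which is the error of the
    majority value. *)
Lemma majority_err i j : i != j -> cell_err C h i j <= 2 * cell_err C a i j.
Proof.
move=> ij; rewrite /cell_err /h /majority ij /=.
have := c_ge0 i j; have := c_le i j; move: (c C i j) (p i * p j) (a i j) => cc pp x h1 h2.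
have q1 := sqr_ge0 (2 * x - 1); case: ltP => h3 /=.
  have : 0 <= (2 * cc - pp) * (1 - x) ^+ 2 by rewrite mulr_ge0 ?sqr_ge0//; lra.
  have : 0 <= (pp - cc) * (2 * x - 1) ^+ 2 by rewrite mulr_ge0//; lra.
  by rewrite !expr2; lra.
have : 0 <= (pp - 2 * cc) * x ^+ 2 by rewrite mulr_ge0 ?sqr_ge0//; lra.
have : 0 <= cc * (2 * x - 1) ^+ 2 by rewrite mulr_ge0.
by rewrite !expr2; lra.
Qed.

(** Through the indicator of [C]: the squared distance of two constants is at most twice the sum of
    their errors, and [2 * (2 + 1) = 6] by [majority_err]. *)
Lemma majority_dist i j : i != j ->
  (h i j - a i j) ^+ 2 * (p i * p j) <= 6 * cell_err C a i j.
Proof.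
move=> ij; rewrite /cell_err /h /majority ij /=.
have := c_ge0 i j; have := c_le i j; move: (c C i j) (p i * p j) (a i j) => cc pp x h1 h2.
have q1 := sqr_ge0 (2 * x - 1); case: ltP => h3 /=.
  have : 0 <= (2 * cc - pp) * (1 - x) ^+ 2 by rewrite mulr_ge0 ?sqr_ge0//; lra.
  have : 0 <= (pp - cc) * (2 * x - 1) ^+ 2 by rewrite mulr_ge0//; lra.
  have : 0 <= (pp - cc) * x ^+ 2 by rewrite mulr_ge0 ?sqr_ge0//; lra.
  have : 0 <= cc * (1 - x) ^+ 2 by rewrite mulr_ge0 ?sqr_ge0.
  by rewrite !expr2; lra.
have : 0 <= (pp - 2 * cc) * x ^+ 2 by rewrite mulr_ge0 ?sqr_ge0//; lra.
have : 0 <= cc * (2 * x - 1) ^+ 2 by rewrite mulr_ge0.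
have : 0 <= (pp - cc) * x ^+ 2 by rewrite mulr_ge0 ?sqr_ge0//; lra.
have : 0 <= cc * (1 - x) ^+ 2 by rewrite mulr_ge0 ?sqr_ge0.
by rewrite !expr2; lra.
Qed.

Definition majority_set : set (E * E) :=
  [set z | exists i j, [/\ majority i j, A i z.1 & A j z.2]].

Let majority_neq i j : majority i j -> i != j. Proof. by case/andP. Qed.

Lemma indic_majority_set z :
  \1_majority_set z = \sum_(i < n) \sum_(j < n) h i j * \1_(cell i j) z :> R.
Proof.
transitivity (step2 h A z); last first.
  apply: eq_bigr => i _; rewrite big_mkcond; apply: eq_bigr => j _.
  rewrite !indicE in_setX; case: ifPn => [_|]; first by rewrite -natrM mulnb.
  by rewrite negbK => /eqP ->; rewrite /h majority_irr mul0r.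
rewrite indicE; have [[i [j [ij Ai Aj]]]|nz] := pselect (cells z).
  rewrite (step2_in _ ij Ai Aj) /h; congr (nat_of_bool _)%:R; apply/idP/idP.
    rewrite inE => -[k [l [kl Ak Al]]].
    by rewrite (A_inj Ai Ak) (A_inj Aj Al).
  by move=> mij; rewrite inE; exists i, j.
rewrite step2_out// memNset// => -[i [j [/majority_neq ij Ai Aj]]].
by apply: nz; exists i, j.
Qed.

Lemma measurable_majority_set : measurable majority_set.
Proof.
have -> : majority_set = \bigcup_(q in [set q : 'I_n * 'I_n | majority q.1 q.2]) cell q.1 q.2.
  apply/seteqP; split => [z [i [j [ij Ai Aj]]]|z [[i j] /= ij [/= Ai Aj]]].
    by exists (i, j).
  by exists i, j.
apply: fin_bigcup_measurable => // q _; exact: mcell.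
Qed.

(** Stated for any measure on pairs, because it serves both the product of the intensities and the
    random measure of pairs of points. *)
Lemma measure_majority_set (mu2 : {measure set (E * E) -> \bar R}) :
  (mu2 majority_set = \sum_(i < n) \sum_(j < n) (h i j)%:E * mu2 (cell i j))%E.
Proof.
rewrite -[in LHS](setIT majority_set) -integral_indic//; last exact: measurable_majority_set.
transitivity (\int[mu2]_z (\sum_(i < n) \sum_(j < n) ((h i j)%:E * (\1_(cell i j) z)%:E)))%E.
  apply: eq_integral => z _; rewrite indic_majority_set -sumEFin; apply: eq_bigr => i _.
  by rewrite -sumEFin.
have mI i j : measurable_fun setT (fun z => (h i j)%:E * (\1_(cell i j) z)%:E : \bar R)%E.
  by apply: emeasurable_funM => //; apply/measurable_EFinP; exact: measurable_indic.
rewrite ge0_integral_sum//; last 2 first.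
- by move=> i; apply: emeasurable_sum => j.
- by move=> i z _; apply: sume_ge0 => j _; rewrite mule_ge0// lee_fin.
apply: eq_bigr => i _; rewrite ge0_integral_sum//; last first.
  by move=> j z _; rewrite mule_ge0// lee_fin.
apply: eq_bigr => j _; rewrite ge0_integralZl_EFin//; last first.
  by apply/measurable_EFinP; exact: measurable_indic.
by rewrite integral_indic// setIT.
Qed.

Definition majority_diff : set (E * E) := (C `\` majority_set) `|` (majority_set `\` C).

Let sum_err : \sum_(i < n) \sum_(j < n | i != j) cell_err C a i j <= e.
Proof.
rewrite -lee_fin; apply: le_trans (ltW aE); rewrite step_err_integral//.
by rewrite leeDr.
Qed.

(** The squared difference of two indicators is the indicator of the symmetric difference, so this
    is the error formula for the rounded coefficients, combined with [majority_err]. *)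
Lemma measure_majority_diff : (m2 majority_diff <= (2 * e)%:E)%E.
Proof.
have mM := measurable_majority_set.
have -> : (m2 majority_diff = \int[m2]_z ((\1_C z - step2 h A z) ^+ 2)%:E)%E.
  rewrite -[in LHS](setIT majority_diff) -integral_indic//; last first.
    by apply: measurableU; exact: measurableD.
  apply: eq_integral => z _; congr EFin.
  have -> : step2 h A z = \1_majority_set z.
    rewrite indic_majority_set.
    apply: eq_bigr => i _; rewrite big_mkcond; apply: eq_bigr => j _.
    rewrite !indicE in_setX; case: ifPn => [_|]; first by rewrite -natrM mulnb.
    by rewrite negbK => /eqP ->; rewrite /h majority_irr mul0r.
  rewrite !indicE in_setU !in_setD.
  by case: (z \in C); case: (z \in majority_set) => /=; ring.
rewrite step_err_integral//.
apply: (@le_trans _ _ (2%:E * (\int[m2]_z ((\1_C z - step2 a A z) ^+ 2)%:E)))%E; last first.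
  by rewrite EFinM lee_wpmul2l ?lee_fin// ltW.
rewrite step_err_integral// muleDr//; last by rewrite ge0_adde_def ?inE// lee_fin sumr_ge0// => i _; rewrite sumr_ge0// => j _; exact: cell_err_ge0.
apply: leeD.
  by rewrite -[X in (X <= _)%E]mul1e lee_wpmul2r// lee_fin ler1n.
rewrite -EFinM lee_fin mulr_sumr; apply: ler_sum => i _.
by rewrite mulr_sumr; apply: ler_sum => j ij; exact: majority_err.
Qed.

Lemma majority_dist_sum :
  \sum_(i < n) \sum_(j < n | i != j) (h i j - a i j) ^+ 2 * (p i * p j) <= 6 * e.
Proof.
apply: (@le_trans _ _ (6 * \sum_(i < n) \sum_(j < n | i != j) cell_err C a i j)).
  rewrite mulr_sumr; apply: ler_sum => i _.
  by rewrite mulr_sumr; apply: ler_sum => j ij; exact: majority_dist.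
by rewrite ler_pM2l.
Qed.

End majority.

End step_cells.

Section off_null.
Context (R : realType) (dO : measure_display) (Omega : measurableType dO)
  (P : probability Omega R).
Implicit Types f g : Omega -> R.

Lemma Ex_off_null (N : set Omega) f g : measurable N -> P N = 0%E ->
  measurable_fun setT g -> (forall w, ~ N w -> f w = g w) -> Ex P f = Ex P g.
Proof.
move=> mN N0 mg fg; congr fine; apply: (integral_off_null mN N0).
  exact/measurable_EFinP.
by move=> w Nw; rewrite fg.
Qed.

Lemma Ex_le_off_null (N : set Omega) f g : measurable N -> P N = 0%E ->
  itg P f -> itg P g -> (forall w, ~ N w -> f w <= g w) -> Ex P f <= Ex P g.
Proof.
move=> mN N0 If Ig fg.
have mf := itg_meas If; have mg := itg_meas Ig.
have mmin : measurable_fun setT (fun w => Num.min (f w) (g w)) by exact: measurable_minr.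
have e w : ~ N w -> f w = Num.min (f w) (g w) by move=> /fg h; rewrite min_l.
rewrite (Ex_off_null mN N0 mmin e); apply: Ex_le => //; last first.
  by move=> w; rewrite ge_min lexx orbT.
apply: (itg_le mmin (g := fun w => `|f w| + `|g w|)).
  move=> w; rewrite /Num.min; case: ifP => _; [rewrite lerDl//|rewrite lerDr//].
by apply: itgD; exact: itg_abs.
Qed.

End off_null.

Lemma itg_off_null (R : realType) (dO : measure_display) (Omega : measurableType dO)
    (P : probability Omega R) (N : set Omega) (f g : Omega -> R) :
  measurable N -> P N = 0%E -> measurable_fun setT f -> itg P g ->
  (forall w, ~ N w -> f w = g w) -> itg P f.
Proof.
move=> mN N0 mf Ig fg; apply/integrableP; split; first exact/measurable_EFinP.
have mg := itg_meas Ig.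
rewrite (integral_off_null mN N0 (g := fun w => `|(g w)%:E|%E)).
- by case/integrableP: Ig.
- by apply: measurableT_comp => //; exact/measurable_EFinP.
- by move=> w Nw; rewrite /= fg.
Qed.

(** * Approximation of the edge count by finite graphs *)

Section chaos_approximation.
Context (R : realType) (d : nat) (d_gt0 : (0 < d)%N)
  (dO : measure_display) (Omega : measurableType dO) (P : probability Omega R)
  (eta : R.-ker Omega ~> Rd R d) (lam : R) (lam_gt0 : (0 < lam)%R)
  (eta_points : forall w, locally_finite_point_measure (eta w))
  (eta_poisson : poisson_measure P eta (intensity d lam))
  (H : set (Rd R d)) (mH : measurable H) (Hsym : H = @topp R d @` H)
  (H0 : ~ H tzero).
Notation E := (Rd R d).
Notation mu := (intensity d lam : {sigma_finite_measure set E -> \bar R}).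
Notation mu2 := (mu \x mu)%E.
Notation W := (cube 1 : set E).
Notation C := (edge_set H).
Notation Gn := (edge_num eta_points H).
Notation prs := (pairs eta_points).
Notation D := (hat_deg lam H).

Let mC : measurable C := measurable_edge_set mH.
Let mW : measurable W := @measurable_cube R d 1%R.
Let mWW : measurable (W `*` W) := measurableX mW mW.

Definition mean_edges : R := fine (mu2 C).

Let WWoo : (mu2 (W `*` W) < +oo)%E.
Proof.
have h : (mu W < +oo)%E := intensity_cube d lam_gt0 1.
by rewrite product_measure1E// lte_mul_pinfty// ge0_fin_numE.
Qed.

Let mu2CE : mu2 C = mean_edges%:E.
Proof.
rewrite /mean_edges fineK// ge0_fin_numE//; apply: le_lt_trans WWoo.
by apply: le_measure; rewrite ?inE// => z [].
Qed.

Lemma mean_edges_ge0 : 0 <= mean_edges. Proof. exact: fine_ge0. Qed.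

Let prsoo w B : measurable B -> (prs w B < +oo)%E.
Proof.
move=> mB; apply: (@le_lt_trans _ _ (prs w setT)); last exact: eta_pairsT.
by apply: le_measure; rewrite ?inE.
Qed.

Let q w B := fine (prs w B).

Let qE w B : measurable B -> prs w B = (q w B)%:E.
Proof. by move=> mB; rewrite /q fineK// ge0_fin_numE//; exact: prsoo. Qed.

Let mean_prs B : measurable B -> (forall x, ~ B (x, x)) ->
  measurable_fun setT (fun w => prs w B) /\
  (\int[P]_w prs w B = mu2 (B `&` (W `*` W)))%E.
Proof.
move=> mB Birr.
have [mq iq] := pairs_mean eta_poisson (@measurable_cube R d 1%R) (intensity_cube d lam_gt0 1)
  (eta_cube_lty eta_points) mB.
split => //; rewrite iq mean_pairsE mu_pairsE//.
rewrite (_ : [set x | _] = set0) ?measure0 ?adde0//.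
by apply/seteqP; split => // x /Birr.
Qed.

Let itg_q B : measurable B -> (forall x, ~ B (x, x)) ->
  itg P (q^~ B) /\ (Ex P (q^~ B))%:E = mu2 (B `&` (W `*` W)).
Proof.
move=> mB Birr; have [mp ip] := mean_prs mB Birr.
have I : itg P (q^~ B).
  apply/integrableP; split; first by apply/measurable_EFinP; apply: measurableT_comp.
  rewrite (eq_integral (fun w => prs w B)); last first.
    by move=> w _ /=; rewrite ger0_norm -?qE//; exact: fine_ge0.
  rewrite ip; apply: le_lt_trans WWoo; apply: le_measure; rewrite ?inE//.
  exact: measurableI.
split => //; rewrite -ExE// -ip; apply: eq_integral => w _.
by rewrite -qE.
Qed.

Lemma measurable_edge_num : measurable_fun setT Gn.
Proof.
apply: measurableT_comp; first exact: measurable_natof.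
exact: (mean_prs mC (fun x => edge_set_irr H0 (x:=x))).1.
Qed.

Let itg_qC := itg_q mC (fun x => edge_set_irr H0 (x:=x)).

Lemma itg_edge_num : itg P (fun w => (Gn w)%:R).
Proof.
have [N [mN N0 NE]] := edge_num_off_null d_gt0 lam_gt0 eta_points eta_poisson mH H0.
apply: (itg_off_null mN N0 _ itg_qC.1).
  by apply: measurableT_comp => //; exact: measurable_edge_num.
by move=> w /NE[qw _]; rewrite /q qw.
Qed.

Lemma Ex_edge_num : Ex P (fun w => (Gn w)%:R) = mean_edges.
Proof.
have [N [mN N0 NE]] := edge_num_off_null d_gt0 lam_gt0 eta_points eta_poisson mH H0.
rewrite (Ex_off_null mN N0 (g := q^~ C)).
- apply: EFin_inj; rewrite itg_qC.2 -mu2CE; congr (mu2 _).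
  by apply/seteqP; split => [z []//|z Cz]; split => //; case: Cz.
- exact: itg_meas itg_qC.1.
- by move=> w /NE[qw _]; rewrite /q qw.
Qed.

(* What a step kernel close to the indicator of the edge set provides: G' is the
   edge count of a graph on finitely many cells, S and T are double integrals. *)
Definition chaos_approx (F2 : Omega -> R) (e a' : R) (G' : Omega -> nat)
    (S T : Omega -> R) : Prop :=
  [/\ [/\ 0 <= a', measurable_fun setT G', itg P (fun w => (G' w)%:R) &
         Ex P (fun w => (G' w)%:R) = a'],
      Ex P (fun w => `|(Gn w)%:R - (G' w)%:R|) <= 4 * e,
      [/\ measurable_fun setT S, ('E_P[fun w => ((F2 w - S w) ^+ 2)%R] < e%:E)%E,
          itg P (fun w => ((G' w)%:R - a' - S w) ^+ 2) &
          Ex P (fun w => ((G' w)%:R - a' - S w) ^+ 2) <= 12 * e + 8 * D * a'],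
      [/\ itg P T, itg P (fun w => T w ^+ 2), Ex P T = 0 & Ex P (fun w => T w ^+ 2) = 2 * a'] /\
      (itg P (fun w => (S w - T w) ^+ 2) /\
       Ex P (fun w => (S w - T w) ^+ 2) <= 12 * e) &
      forall m : nat,
        `|m%:R * Ex P (fun w => (G' w == m)%:R) - a' * Ex P (fun w => (G' w + 2 == m)%N%:R)|
        <= 4 * D * a'].

Variable F2 : Omega -> R.
Section approximation.
Variables (e : R) (n : nat) (a : 'I_n -> 'I_n -> R) (A : 'I_n -> set E).
Hypothesis stepA : step_sets mu A.
Hypothesis aE : (\int[mu2]_z ((\1_C z - step2 a A z) ^+ 2)%:E < e%:E)%E.

Let mA i : measurable (A i). Proof. by case: stepA. Qed.
Let Aoo i : (mu (A i) < +oo)%E. Proof. by case: stepA. Qed.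
Let tA : trivIset setT A. Proof. by case: stepA. Qed.
Let X := count eta A.
Let p i := fine (mu (A i)).
Let p0 i : 0 <= p i. Proof. exact: fine_ge0. Qed.
Let mX := measurable_count eta mA.
Let lX := law_count eta_poisson mA Aoo tA.
Let h := majority mu A C.
Let Csym x y : C (x, y) -> C (y, x) := @edge_set_sym _ _ _ Hsym x y.
Let CD := xsection_edge_set_le d_gt0 lam_gt0 mH Hsym.
Let D_ge0 := hat_deg_ge0 lam_gt0 H.
Let hsym := majority_sym stepA mC Csym.
Let hirr := majority_irr mu A C.
Let hdeg := majority_deg stepA mC D_ge0 CD.
Let dist := majority_dist_sum stepA mC aE.
Let M := majority_set mu A C.
Let mM : measurable M := measurable_majority_set stepA C.
Let B := majority_diff mu A C.
Let mB : measurable B.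
Proof. by apply: measurableU; exact: measurableD. Qed.

Let a' := medges p h.
Let G' w := edges h (X w).

Let mu2M : mu2 M = a'%:E.
Proof.
rewrite (measure_majority_set stepA) /a' /medges -sumEFin; apply: eq_bigr => i _.
rewrite -sumEFin; apply: eq_bigr => j _.
rewrite [X in (_ * X)%E]product_measure1E// EFinM; congr (_ * _)%E.
by rewrite EFinM /p !fineK// ge0_fin_numE.
Qed.

Let Mirr x : ~ M (x, x).
Proof.
move=> [i [j [/andP[ij _] /= Ai Aj]]]; move: ij.
by rewrite (tA I I (ex_intro _ x (conj Ai Aj))) eqxx.
Qed.

Let Birr x : ~ B (x, x).
Proof. by move=> [[/(edge_set_irr H0)]|[/Mirr]]. Qed.

Let itg_G' : itg P (fun w => (G' w)%:R).
Proof. exact: (polyb_itg p0 mX lX (polyb_edges R h)). Qed.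

Let Ex_G' : Ex P (fun w => (G' w)%:R) = a'.
Proof.
exact: (Ev_edges p0 mX lX hsym hirr).
Qed.

(** The cells may stick out of the window, so [G'] can exceed the mass of [M] in the window. Inside,
    the discrepancy is at most the mass of [B], of mean at most [2 * e]. The excess has as mean the
    part of [M] outside the window, which is disjoint from the edge set, hence in [B], and costs
    another [2 * e]. *)
Lemma Ex_edges_dist : Ex P (fun w => `|(Gn w)%:R - (G' w)%:R|) <= 4 * e.
Proof.
have [N1 [mN1 N10 NE1]] := edge_num_off_null d_gt0 lam_gt0 eta_points eta_poisson mH H0.
have [N2 [mN2 N20 NE2]] := count_off_null eta_poisson mA Aoo.
have mN : measurable (N1 `|` N2) by exact: measurableU.
have N0 : P (N1 `|` N2) = 0%E by exact: (etrans (measureU0 mN1 mN2 N20) N10).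
have [IB EB] := itg_q mB Birr; have [IM EM] := itg_q mM Mirr.
have le w : ~ (N1 `|` N2) w ->
    `|(Gn w)%:R - (G' w)%:R| <= q w B + ((G' w)%:R - q w M).
  move=> /not_orP[/NE1[qC _] /NE2 XA].
  have GqC : q w C = (Gn w)%:R by rewrite /q qC.
  have qMG : q w M <= (G' w)%:R.
    rewrite -lee_fin -qE// (measure_majority_set stepA).
    rewrite /G' /edges natr_sum -sumEFin; apply: lee_sum => i _.
    rewrite natr_sum -sumEFin; apply: lee_sum => j _.
    rewrite natrM EFinM lee_wpmul2l ?lee_fin//.
    rewrite [X in (X <= _)%E](eta_pairs_rect _ _ w (mA i) (mA j)) natrM EFinM -!XA.
    by apply: lee_pmul => //; apply: le_measure; rewrite ?inE//; exact: measurableI.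
  have qle U V : measurable U -> measurable V -> q w U <= q w V + q w (U `\` V).
    move=> mU mV; rewrite -lee_fin EFinD -!qE//; last exact: measurableD.
    have mUV := measurableD mU mV.
    apply: (@le_trans _ _ (prs w (V `|` (U `\` V)))); last exact: measureU2.
    apply: le_measure; rewrite ?inE//.
      by apply: measurableU => //; exact: measurableD.
    by move=> z Uz; have [|] := pselect (V z); [left|right].
  have qmono U V : measurable U -> measurable V -> U `<=` V -> q w U <= q w V.
    by move=> mU mV UV; rewrite -lee_fin -!qE//; apply: le_measure; rewrite ?inE.
  have h1 := qle C M mC mM; have h2 := qle M C mM mC.
  have h3 : q w (C `\` M) <= q w B by apply: qmono; [exact: measurableD| |left].
  have h4 : q w (M `\` C) <= q w B by apply: qmono; [exact: measurableD| |right].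
  rewrite -GqC ler_norml; apply/andP; split; lra.
have IGM : itg P (fun w => (G' w)%:R - q w M) by exact: itgB.
have Idiff : itg P (fun w => `|(Gn w)%:R - (G' w)%:R|).
  by apply: itg_abs; apply: itgB => //; exact: itg_edge_num.
apply: le_trans (Ex_le_off_null mN N0 Idiff (itgD IB IGM) le) _.
rewrite ExD// ExB// Ex_G' -lee_fin EFinD EFinB EB EM -mu2M.
have B2e := measure_majority_diff stepA mC aE.
have mI U : measurable U -> measurable (U `&` (W `*` W)) by move=> mU; exact: measurableI.
have t1 : (mu2 (B `&` (W `*` W)) <= (2 * e)%:E)%E.
  by apply: le_trans B2e; apply: le_measure; rewrite ?inE//; exact: mI.
have t2 : (mu2 M - mu2 (M `&` (W `*` W)) <= (2 * e)%:E)%E.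
  rewrite -(measureD mM mWW); last by rewrite [X in (X < _)%E]mu2M ltry.
  apply: le_trans B2e; apply: le_measure; rewrite ?inE//; first exact: measurableD.
  by move=> z [Mz WWz]; right; split => // -[W1 W2 _]; apply: WWz.
apply: le_trans (leeD t1 t2) _.
by rewrite -EFinD lee_fin; lra.
Qed.

Lemma Ex_step_integral2 : measurable_fun setT F2 ->
  ('E_P[fun w => ((F2 w - quad p a (X w)) ^+ 2)%R] =
   'E_P[fun w => ((F2 w - step_integral2 eta mu a A w) ^+ 2)%R])%E.
Proof.
move=> mF2; have [N [mN N0 NE]] := count_off_null eta_poisson mA Aoo.
apply/esym; rewrite unlock; apply: (integral_off_null mN N0).
  apply/measurable_EFinP; apply: measurable_funX; apply: measurable_funB => //.
  exact: (measurable_val mX).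
move=> w Nw; congr (((_ - _) ^+ 2)%:E).
apply: eq_bigr => i _; apply: eq_bigr => j _.
by rewrite /compensated !(NE _ Nw).
Qed.

(** The step integral with coefficients [a] is close to [F2]; the one with rounded coefficients has
    second moment exactly [2 * a']. In the constants, [12 * e] is twice the kernel distance [6 * e]
    of [majority_dist_sum], and [D] enters as [2 * D] through [majority_deg]. *)
Lemma approximation_spec : measurable_fun setT F2 ->
  ('E_P[fun w => ((F2 w - step_integral2 eta mu a A w) ^+ 2)%R] < e%:E)%E ->
  chaos_approx F2 e a' G' (fun w => quad p a (X w)) (fun w => quad p (fun i j => (h i j)%:R) (X w)).
Proof.
move=> mF2 F2e.
have pS := polyb_quad p a; have pT := polyb_quad p (fun i j => (h i j)%:R).
have pE := polyb_edges R h.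
have sqr (phi : {ffun 'I_n -> nat} -> R) : polyb phi -> polyb (fun x => phi x ^+ 2).
  by move=> pf; under eq_fun do rewrite expr2; exact: polybM.
have pGS : polyb (fun x => (edges h x)%:R - a' - quad p a x).
  by apply: polybB => //; apply: polybB => //; exact: polyb_cst.
split.
- split => //.
  + by apply: sumr_ge0 => i _; apply: sumr_ge0 => j _; rewrite mulr_ge0// mulr_ge0.
  + exact: (measurable_countable_val mX (edges h)).
- exact: Ex_edges_dist.
- split; [exact: (measurable_val mX)|by rewrite Ex_step_integral2| |].
  + exact: (polyb_itg p0 mX lX (sqr _ pGS)).
  + apply: le_trans (Ev_edges_quad p0 mX lX hsym hirr hdeg dist) _.
    by rewrite -/a'; lra.
- have pTS : polyb (fun x => quad p a x - quad p (fun i j => (h i j)%:R) x) by exact: polybB.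
  split; [split|split].
  + exact: (polyb_itg p0 mX lX pT).
  + exact: (polyb_itg p0 mX lX (sqr _ pT)).
  + exact: (Ev_quad p0 mX lX).
  + exact: (Ev_quad_edges_sqr p0 mX lX hsym hirr).
  + exact: (polyb_itg p0 mX lX (sqr _ pTS)).
  + have -> : (fun w => (quad p a (X w) - quad p (fun i j => (h i j)%:R) (X w)) ^+ 2) =
      (fun w => quad p (fun i j => (h i j)%:R - a i j) (X w) ^+ 2).
      by apply/funext => w; rewrite -quadB -sqrrN opprB.
    apply: le_trans (_ : _ <= 2 * (6 * e)) _; last by lra.
    rewrite [leLHS](Ev_quad_sqr p0 mX lX).
    apply: le_trans (quad_sum_le p0 _) _.
    by rewrite ler_pM2l.
- move=> m; apply: le_trans (edges_recursion p0 mX lX hsym hirr hdeg m) _.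
  by rewrite -/a'; lra.
Qed.

End approximation.

Lemma chaos_approx_exists : wiener_ito2 P eta mu (\1_C) F2 ->
  forall e, 0 < e -> exists a' G' S T, chaos_approx F2 e a' G' S T.
Proof.
move=> [_ mF2 F2_int] e e0; have [n [a [A [stepA aE F2e]]]] := F2_int e e0.
do 4 eexists; exact: (approximation_spec stepA aE mF2 F2e).
Qed.

End chaos_approximation.

(** * Passage to the limit in L^2 *)

Section square_integrable.
Context (R : realType) (dO : measure_display) (Omega : measurableType dO)
  (P : probability Omega R).
Implicit Types f g : Omega -> R.

Definition l2 f : Prop := measurable_fun setT f /\ itg P (fun w => f w ^+ 2).

Definition l2norm f : R := Num.sqrt (Ex P (fun w => f w ^+ 2)).

Lemma l2norm_ge0 f : 0 <= l2norm f. Proof. exact: sqrtr_ge0. Qed.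

Lemma l2norm_sqr f : l2norm f ^+ 2 = Ex P (fun w => f w ^+ 2).
Proof. by rewrite sqr_sqrtr// Ex_ge0// => w; exact: sqr_ge0. Qed.

Lemma l2_mul f g : l2 f -> l2 g -> itg P (fun w => f w * g w).
Proof.
move=> [mf If] [mg Ig]; apply: (itg_le _ _ (itgD If Ig)).
  exact: measurable_funM.
move=> w; rewrite normrM -(real_normK (num_real (f w))) -(real_normK (num_real (g w))).
by have := sqr_ge0 (`|f w| - `|g w|); have := normr_ge0 (f w);
  have := normr_ge0 (g w); rewrite !expr2; nra.
Qed.

Lemma l2Z (k : R) f : l2 f -> l2 (fun w => k * f w).
Proof.
move=> [mf If]; split; first exact: measurable_funM.
by under eq_fun do rewrite exprMn; exact: itgZ.
Qed.

Lemma l2D f g : l2 f -> l2 g -> l2 (fun w => f w + g w).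
Proof.
move=> lf lg; split; first by apply: measurable_funD; [case: lf|case: lg].
under eq_fun do rewrite sqrrD -mulr_natr.
apply: itgD; last by case: lg.
apply: itgD; first by case: lf.
under eq_fun do rewrite mulrC.
by apply: itgZ; exact: l2_mul.
Qed.

Lemma l2B f g : l2 f -> l2 g -> l2 (fun w => f w - g w).
Proof.
move=> lf lg; have := l2D lf (l2Z (-1) lg).
by under [in X in X -> _]eq_fun do rewrite mulN1r.
Qed.

Lemma l2_cst (k : R) : l2 (fun=> k).
Proof. by split => //; exact: itg_cst. Qed.

Lemma l2_itg f : l2 f -> itg P f.
Proof.
move=> lf; have := l2_mul lf (l2_cst 1).
by under [in X in X -> _]eq_fun do rewrite mulr1.
Qed.

Lemma cauchy_schwarz_Ex f g : l2 f -> l2 g ->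
  `|Ex P (fun w => f w * g w)| <= l2norm f * l2norm g.
Proof.
move=> lf lg; have Ifg := l2_mul lf lg.
have key (t : R) : 0 <= l2norm f ^+ 2 + 2 * t * Ex P (fun w => f w * g w) + t ^+ 2 * l2norm g ^+ 2.
  have -> : l2norm f ^+ 2 + 2 * t * Ex P (fun w => f w * g w) + t ^+ 2 * l2norm g ^+ 2 =
      Ex P (fun w => (f w + t * g w) ^+ 2).
    rewrite !l2norm_sqr -(ExZ (2 * t) Ifg) -(ExZ (t ^+ 2) lg.2).
    rewrite -ExD; [|exact: lf.2|exact: itgZ].
    rewrite -ExD; [|by apply: itgD; [exact: lf.2|exact: itgZ]|exact: itgZ lg.2].
    by congr Ex; apply/funext => w; ring.
  by apply: Ex_ge0 => w; exact: sqr_ge0.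
move: key; have := l2norm_ge0 f; have := l2norm_ge0 g.
move: (l2norm f) (l2norm g) (Ex P _) => u v x v0 u0 key.
have {v0} [v0|v0] : v = 0 \/ 0 < v by move: v0; rewrite le_eqVlt => /predU1P[<-|]; [left|right].
  rewrite v0 mulr0 normr_le0; apply/negPn/negP => x0.
  (* As [v = 0], the quadratic in [t] is affine; at this point it equals -1. *)
  have := key (- (u ^+ 2 + 1) / (2 * x)); rewrite v0 expr0n mulr0 addr0.
  have -> : 2 * (- (u ^+ 2 + 1) / (2 * x)) * x = - (u ^+ 2 + 1) by field.
  lra.
(* For [v > 0] the quadratic is evaluated at its minimum. *)
have := key (- x / v ^+ 2).
have -> : u ^+ 2 + 2 * (- x / v ^+ 2) * x + (- x / v ^+ 2) ^+ 2 * v ^+ 2 =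
   u ^+ 2 - x ^+ 2 / v ^+ 2 by field; exact: lt0r_neq0.
rewrite subr_ge0 ler_pdivrMr ?exprn_gt0// -exprMn => h.
rewrite -(@ler_pXn2r _ 2)// ?nnegrE ?mulr_ge0// ?(ltW v0)//.
by rewrite real_normK// num_real.
Qed.

Lemma l2norm_triangle f g : l2 f -> l2 g ->
  l2norm f <= l2norm g + l2norm (fun w => f w - g w).
Proof.
move=> lf lg; have lfg := l2B lf lg.
rewrite -(@ler_pXn2r _ 2)// ?nnegrE ?addr_ge0 ?l2norm_ge0//.
rewrite sqrrD !l2norm_sqr.
have -> : (fun w => f w ^+ 2) = (fun w => g w ^+ 2 + 2 * (g w * (f w - g w)) + (f w - g w) ^+ 2).
  by apply/funext => w; ring.
have I1 := l2_mul lg lfg; have I2 := itgZ 2 I1.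
rewrite (ExD (itgD lg.2 I2) lfg.2) (ExD lg.2 I2) (ExZ 2 I1).
rewrite lerD2r lerD2l -[leRHS]mulr_natl ler_pM2l//.
exact: le_trans (ler_norm _) (cauchy_schwarz_Ex lg lfg).
Qed.

Lemma l2normN f : l2norm (fun w => - f w) = l2norm f.
Proof. by rewrite /l2norm; congr (Num.sqrt (Ex P _)); apply/funext => w; rewrite sqrrN. Qed.

Lemma l2norm_dist f g : l2 f -> l2 g ->
  `|l2norm f - l2norm g| <= l2norm (fun w => f w - g w).
Proof.
move=> lf lg; have := l2norm_triangle lf lg; have := l2norm_triangle lg lf.
have -> : l2norm (fun w => g w - f w) = l2norm (fun w => f w - g w).
  by rewrite -l2normN; congr l2norm; apply/funext => w; rewrite opprB.
by rewrite ler_norml; lra.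
Qed.

Lemma l2norm_le f (e : R) : 0 <= e -> Ex P (fun w => f w ^+ 2) <= e ^+ 2 -> l2norm f <= e.
Proof. by move=> e0 h; rewrite -(@ler_pXn2r _ 2)// ?nnegrE ?l2norm_ge0// l2norm_sqr. Qed.

Lemma Ex_abs_l2norm f : l2 f -> Ex P (fun w => `|f w|) <= l2norm f.
Proof.
move=> lf; have laf : l2 (fun w => `|f w|).
  split; first by apply: measurableT_comp => //; case: lf.
  by under eq_fun do rewrite real_normK ?num_real//; case: lf.
have := cauchy_schwarz_Ex laf (l2_cst 1).
have -> : l2norm (fun=> 1) = 1.
  by rewrite /l2norm Ex_cst expr1n sqrtr1.
have -> : l2norm (fun w => `|f w|) = l2norm f.
  by congr (Num.sqrt (Ex P _)); apply/funext => w; rewrite real_normK// num_real.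
rewrite mulr1; under [X in `|Ex P X|]eq_fun do rewrite mulr1.
by apply: le_trans; exact: ler_norm.
Qed.

Lemma expectation_lt_l2 f (e : R) : measurable_fun setT f ->
  ('E_P[fun w => (f w ^+ 2)%R] < e%:E)%E -> l2 f /\ Ex P (fun w => f w ^+ 2) < e.
Proof.
move=> mf; rewrite unlock => fe.
have If : itg P (fun w => f w ^+ 2).
  apply/integrableP; split; first by apply/measurable_EFinP; exact: measurable_funX.
  apply: le_lt_trans (ltry e); apply: le_trans (ltW fe).
  by apply: ge0_le_integral => //; do ?[by apply/measurable_EFinP; exact: measurable_funX|
     by apply: measurableT_comp => //; apply/measurable_EFinP; exact: measurable_funX|
     by move=> w _ /=; rewrite ger0_norm// sqr_ge0| by move=> w _; rewrite lee_fin sqr_ge0].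
by split => //; rewrite -lte_fin -ExE.
Qed.

(** Truncation makes squares stable under L^1 perturbations; since the bound is uniform in the level
    [k], monotone convergence removes it. *)
Lemma l2_of_truncation f (b : R) : measurable_fun setT f ->
  (forall k : nat, Ex P (fun w => Num.min `|f w| k%:R ^+ 2) <= b) ->
  l2 f /\ Ex P (fun w => f w ^+ 2) <= b.
Proof.
move=> mf fb.
pose t (k : nat) w : R := Num.min `|f w| k%:R ^+ 2.
have mt k : measurable_fun setT (t k).
  by apply: measurable_funX; apply: measurable_minr => //; exact: measurableT_comp.
have t0 k w : 0 <= t k w by exact: sqr_ge0.
have min0 k w : 0 <= Num.min `|f w| k%:R :> R by rewrite le_min normr_ge0 ler0n.
have It k : itg P (t k).
  apply: (@itg_bnd _ _ _ P (t k) (k%:R ^+ 2) (mt k)) => w.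
  rewrite ger0_norm// lerXn2r ?nnegrE//.
  by rewrite ge_min lexx orbT.
have nd w : {homo (fun k => (t k w)%:E) : x y / (x <= y)%N >-> (x <= y)%E}.
  move=> j k jk; rewrite lee_fin lerXn2r ?nnegrE// le_min !ge_min lexx /=.
  by rewrite ler_nat jk orbT.
have lt w : limn (fun k => (t k w)%:E) = (f w ^+ 2)%:E.
  apply/cvg_lim => //; apply: cvg_near_cst.
  exists (Num.trunc `|f w|).+1 => // k /= tk; rewrite /t min_l ?real_normK ?num_real//.
  apply: ltW; apply: lt_le_trans (truncnS_gt _) _.
  by rewrite ler_nat.
have : (\int[P]_w (f w ^+ 2)%:E <= b%:E)%E.
  under eq_integral do rewrite -lt.
  rewrite monotone_convergence//; last 2 first.
  - by move=> k; exact/measurable_EFinP.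
  - by move=> k w _; rewrite lee_fin.
  apply: lime_le.
    apply: ereal_nondecreasing_is_cvgn => j k jk; apply: ge0_le_integral => //.
    - by move=> w _; rewrite lee_fin.
    - exact/measurable_EFinP.
    - exact/measurable_EFinP.
    - by move=> w _; exact: nd.
  by apply: nearW => k; rewrite ExE// lee_fin; exact: fb.
move=> fle.
have If : itg P (fun w => f w ^+ 2).
  apply/integrableP; split; first by apply/measurable_EFinP; exact: measurable_funX.
  apply: le_lt_trans (ltry b); apply: le_trans fle.
  rewrite le_eqVlt; apply/orP; left; apply/eqP; apply: eq_integral => w _ /=.
  by rewrite ger0_norm// sqr_ge0.
by split => //; rewrite -lee_fin -ExE.
Qed.

End square_integrable.

(** The approximation errors below are of the form [K * s]; the restriction [s <= 1] allows [s ^+ 2]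
    to be absorbed in [s]. *)
Lemma le_add_small (R : realFieldType) (x y K : R) :
  (forall s, 0 < s -> s <= 1 -> x <= y + K * s) -> x <= y.
Proof.
move=> h; rewrite leNgt; apply/negP => yx.
pose s := Num.min 1 ((x - y) / (2 * (`|K| + 1))).
have K0 := normr_ge0 K.
have s0 : 0 < s by rewrite lt_min ltr01 divr_gt0//; lra.
have := h s s0; rewrite ge_min lexx => /(_ isT) xs.
have : K * s <= (`|K| + 1) * s by rewrite ler_wpM2r ?(ltW s0)// (le_trans (ler_norm K))// lerDl.
have : (`|K| + 1) * s <= (x - y) / 2.
  apply: le_trans (_ : (`|K| + 1) * ((x - y) / (2 * (`|K| + 1))) <= _).
    by rewrite ler_wpM2l ?addr_ge0// ge_min lexx orbT.
  by rewrite le_eqVlt; apply/orP; left; apply/eqP; field; apply/eqP; lra.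
lra.
Qed.

Section chaos_limit.
Context (R : realType) (d : nat) (d_gt0 : (0 < d)%N)
  (dO : measure_display) (Omega : measurableType dO) (P : probability Omega R)
  (eta : R.-ker Omega ~> Rd R d) (lam : R) (lam_gt0 : (0 < lam)%R)
  (eta_points : forall w, locally_finite_point_measure (eta w))
  (eta_poisson : poisson_measure P eta (intensity d lam))
  (H : set (Rd R d)) (mH : measurable H) (Hsym : H = @topp R d @` H)
  (H0 : ~ H tzero) (F2 : Omega -> R).
Notation mu := (intensity d lam : {sigma_finite_measure set (Rd R d) -> \bar R}).
Hypothesis F2_int : wiener_ito2 P eta mu (\1_(edge_set H)) F2.
Notation Gn := (edge_num eta_points H).
Notation D := (hat_deg lam H).
Notation a := (mean_edges lam H).

Let mF2 : measurable_fun setT F2. Proof. by case: F2_int. Qed.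
Let mGn : measurable_fun setT Gn := measurable_edge_num lam_gt0 eta_points eta_poisson mH H0.
Let IGn := itg_edge_num d_gt0 lam_gt0 eta_points eta_poisson mH H0.
Let EGn := Ex_edge_num d_gt0 lam_gt0 eta_points eta_poisson mH H0.
Let D0 : 0 <= D := hat_deg_ge0 lam_gt0 H.
Let a0 : 0 <= a := mean_edges_ge0 lam H.

(** The accuracy is [s ^+ 2] so that errors in L^2 norm are linear in [s]. *)
Let approx (s : R) : 0 < s -> exists a' G' S T,
  chaos_approx P lam eta_points H F2 (s ^+ 2) a' G' S T.
Proof.
move=> s0; apply: (chaos_approx_exists d_gt0 lam_gt0 eta_points eta_poisson mH Hsym H0 F2_int).
exact: exprn_gt0.
Qed.

Let dist_mean (s a' : R) G' S T : chaos_approx P lam eta_points H F2 (s ^+ 2) a' G' S T ->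
  `|a - a'| <= 4 * s ^+ 2.
Proof.
move=> [[_ _ IG' EG'] GG' _ _ _]; rewrite -EGn -EG' -ExB//.
by apply: le_trans GG'; apply: Ex_abs; exact: itgB.
Qed.

Let l2_approx (s a' : R) G' S T : 0 < s -> chaos_approx P lam eta_points H F2 (s ^+ 2) a' G' S T ->
  [/\ l2 P F2, l2 P T & l2norm P (fun w => F2 w - T w) <= 5 * s].
Proof.
move=> s0 [_ _ [mS FS _ _] [[IT IT2 _ _] [IST EST]] _].
have mT := itg_meas IT.
have [lFS FSs] := expectation_lt_l2 (measurable_funB mF2 mS) FS.
have lT : l2 P T by [].
have lST : l2 P (fun w => S w - T w) by split => //; exact: measurable_funB.
have lFT : l2 P (fun w => F2 w - T w).
  have := l2D lFS lST; congr l2; apply/funext => w /=; ring.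
split => //.
  have := l2D lFT lT; congr l2; apply/funext => w /=; ring.
apply: le_trans (l2norm_triangle lFT lST) _.
(* The second moment [12 * s ^+ 2] is rounded up to a perfect square; with the error [s] between
   [F2] and [S] the total is [5 * s]. *)
have h1 : l2norm P (fun w => S w - T w) <= 4 * s.
  apply: l2norm_le; first by rewrite mulr_ge0// ltW.
  by apply: le_trans EST _; rewrite exprMn; have := sqr_ge0 s; lra.
have h2 : l2norm P (fun w => F2 w - T w - (S w - T w)) <= s.
  apply: l2norm_le; first exact: ltW.
  apply/ltW; apply: le_lt_trans FSs; rewrite le_eqVlt; apply/orP; left; apply/eqP.
  by congr Ex; apply/funext => w /=; ring.
lra.
Qed.

Lemma l2_F2 : l2 P F2.
Proof.
have [a' [G' [S [T h]]]] := approx ltr01.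
by have [] := l2_approx ltr01 h.
Qed.

Lemma Ex_F2 : Ex P F2 = 0.
Proof.
apply/eqP; rewrite -normr_le0; apply: (@le_add_small _ _ _ 5) => s s0 _; rewrite add0r.
have [a' [G' [S [T h]]]] := approx s0.
have [lF lT FT] := l2_approx s0 h.
have [_ _ _ [[IT _ ET _] _] _] := h.
have -> : Ex P F2 = Ex P (fun w => F2 w - T w).
  by rewrite ExB ?ET ?subr0//; exact: l2_itg.
apply: le_trans FT; apply: le_trans (Ex_abs_l2norm (l2B lF lT)).
by apply: Ex_abs; apply: itgB => //; exact: l2_itg.
Qed.

Lemma Ex_F2_sqr : Ex P (fun w => F2 w ^+ 2) = 2 * a.
Proof.
rewrite -l2norm_sqr -[RHS]sqr_sqrtr ?mulr_ge0//; congr (_ ^+ 2).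
(* The constant 8 is 5, the distance from [F2] to [T], plus 3: two square roots differ by at most
   the square root of [2 * |a - a'|], itself at most that of [8 * s ^+ 2]. *)
apply/eqP; rewrite -subr_eq0 -normr_le0; apply: (@le_add_small _ _ _ 8) => s s0 _; rewrite add0r.
have [a' [G' [S [T h]]]] := approx s0.
have [lF lT FT] := l2_approx s0 h.
have aa' := dist_mean h.
have [[a'0 _ _ _] _ _ [[IT _ _ ET2] _] _] := h.
have h1 := le_trans (l2norm_dist lF lT) FT.
have h2 : l2norm P T = Num.sqrt (2 * a') by rewrite /l2norm ET2.
have h3 : `|Num.sqrt (2 * a) - Num.sqrt (2 * a')| <= 3 * s.
  have u0 := sqrtr_ge0 (2 * a); have v0 := sqrtr_ge0 (2 * a').
  have u2 : Num.sqrt (2 * a) ^+ 2 = 2 * a by rewrite sqr_sqrtr// mulr_ge0.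
  have v2 : Num.sqrt (2 * a') ^+ 2 = 2 * a' by rewrite sqr_sqrtr// mulr_ge0.
  move: aa' u2 v2; rewrite !ler_norml => /andP[]; move: u0 v0.
  move: (Num.sqrt _) (Num.sqrt _) => u v u0 v0; rewrite !expr2 => ? ? ? ?.
  by apply/andP; split; nra.
move: h1 h3; rewrite h2 !ler_norml => /andP[? ?] /andP[? ?]; apply/andP; split; lra.
Qed.

Let Z w := (Gn w)%:R - a - F2 w.

(** Squares are controlled for [G'], while [Gn] is close to [G'] only in L^1. Let [t] be [|Z|]
    truncated at [k] and [x] the absolute remainder of [G'], so that [t <= x + r]. If [t > x], then
    [t - x <= r] and [t + x <= 2 * k], so in all cases [t ^+ 2 <= x ^+ 2 + 2 * k * r]. The error is
    thus linear in [r], with [k] fixed while [s] tends to 0. *)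
Lemma edge_chaos_rest : l2 P Z /\ Ex P (fun w => Z w ^+ 2) <= 8 * D * a.
Proof.
have mGr : measurable_fun setT (fun w => (Gn w)%:R : R) := itg_meas IGn.
have mZ : measurable_fun setT Z.
  by apply: measurable_funB => //; apply: measurable_funB.
apply: l2_of_truncation => // k.
(* 12 is the error of the approximation, 32 is 8 times the 4 from [dist_mean], and [9 * s] bounds
   the mean of [r], with shares 4, 4 and 1. *)
apply: (@le_add_small _ _ _ (12 + 32 * D + 2 * k%:R * 9)) => s s0 s1.
have [a' [G' [S [T h]]]] := approx s0.
have aa' := dist_mean h.
have [[a'0 mG' IG' EG'] GG' [mS FS IZ' EZ'] _ _] := h.
have [lFS FSs] := expectation_lt_l2 (measurable_funB mF2 mS) FS.
have FS1 : Ex P (fun w => `|F2 w - S w|) <= s.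
  apply: le_trans (Ex_abs_l2norm lFS) _; apply: l2norm_le; exact: ltW.
pose r w := `|(Gn w)%:R - (G' w)%:R| + `|a - a'| + `|F2 w - S w|.
have IGG' : itg P (fun w => `|(Gn w)%:R - (G' w)%:R|).
  by apply: itg_abs; exact: itgB.
have IFS : itg P (fun w => `|F2 w - S w|) by apply: itg_abs; exact: l2_itg.
have Ir1 : itg P (fun w => `|(Gn w)%:R - (G' w)%:R| + `|a - a'|).
  by apply: itgD => //; exact: itg_cst.
have Ir : itg P r by exact: itgD.
have Er : Ex P r <= 9 * s.
  rewrite (ExD Ir1 IFS) (ExD IGG' (itg_cst _ _)) Ex_cst.
  have : s ^+ 2 <= s by rewrite expr2 ler_piMl// ltW.
  by lra.
have min0 w : 0 <= Num.min `|Z w| k%:R by rewrite le_min normr_ge0 ler0n.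
have mt : measurable_fun setT (fun w => Num.min `|Z w| k%:R ^+ 2).
  by apply: measurable_funX; apply: measurable_minr => //; exact: measurableT_comp.
have It : itg P (fun w => Num.min `|Z w| k%:R ^+ 2).
  apply: (@itg_bnd _ _ _ P _ (k%:R ^+ 2) mt) => w.
  by rewrite ger0_norm ?sqr_ge0// lerXn2r ?nnegrE// ge_min lexx orbT.
have Ikr := itgZ (2 * k%:R) Ir.
apply: (@le_trans _ _ (Ex P (fun w => ((G' w)%:R - a' - S w) ^+ 2 + 2 * k%:R * r w))).
  apply: Ex_le => //; first exact: itgD.
  move=> w; set z' := (G' w)%:R - a' - S w.
  have zz' : `|Z w| <= `|z'| + r w.
    have -> : Z w = z' + (((Gn w)%:R - (G' w)%:R) - (a - a') - (F2 w - S w)).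
      by rewrite /Z /z'; ring.
    apply: le_trans (ler_normD _ _) _; rewrite lerD2l.
    apply: le_trans (ler_normB _ _) _; rewrite lerD2r.
    exact: ler_normB.
  have t1 : Num.min `|Z w| k%:R <= `|Z w| by rewrite ge_min lexx.
  have t2 : Num.min `|Z w| k%:R <= k%:R :> R by rewrite ge_min lexx orbT.
  have r0 : 0 <= r w by rewrite !addr_ge0.
  rewrite -(real_normK (num_real z')).
  have := min0 w; have := normr_ge0 z'; move: t1 t2 zz' r0.
  set t := Order.min _ _; set z := `|Z w|; set x := `|z'|; set rr := r w.
  move=> t1 t2 zz' r0 x0 t0.
  have [tx|xt] := leP t x.
    have : 0 <= k%:R * rr by rewrite mulr_ge0.
    by rewrite !expr2; nra.
  have : 0 <= (rr - (t - x)) * k%:R by rewrite mulr_ge0//; lra.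
  have : 0 <= (t - x) * (k%:R - t) by rewrite mulr_ge0//; lra.
  have : 0 <= (t - x) * (k%:R - x) by rewrite mulr_ge0//; lra.
  by rewrite !expr2; lra.
rewrite (ExD IZ' Ikr) (ExZ _ Ir).
have h1 : 2 * k%:R * Ex P r <= 2 * k%:R * (9 * s) by rewrite ler_wpM2l// mulr_ge0.
have h2 : a' <= a + 4 * s ^+ 2 by move: aa'; rewrite ler_norml => /andP[? ?]; lra.
have h3 : D * a' <= D * (a + 4 * s ^+ 2) by rewrite ler_wpM2l.
have h4 : s ^+ 2 <= s by rewrite expr2 ler_piMl// ltW.
have h5 : D * s ^+ 2 <= D * s by rewrite ler_wpM2l.
have e1 : 8 * D * a' <= 8 * D * a + 32 * (D * s).
  by move: h3; rewrite mulrDr => h3; lra.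
have -> : 8 * D * a + (12 + 32 * D + 2 * k%:R * 9) * s =
    (12 * s + (8 * D * a + 32 * (D * s))) + 2 * k%:R * (9 * s) by ring.
apply: lerD => //; apply: le_trans EZ' _; lra.
Qed.

Lemma edge_num_recursion (m : nat) :
  `|m%:R * Ex P (fun w => (Gn w == m)%:R) - a * Ex P (fun w => (Gn w + 2 == m)%N%:R)|
  <= 4 * D * a.
Proof.
apply: (@le_add_small _ _ _ (16 * D + m%:R * 4 + 4 + a * 4)) => s s0 s1.
have [a' [G' [S [T h]]]] := approx s0.
have aa' := dist_mean h.
have [[a'0 mG' IG' EG'] GG' _ _ rec] := h.
have I01 (K : Omega -> nat) (j : nat -> nat) : measurable_fun setT K ->
    itg P (fun w => (j (K w) == m)%:R).
  move=> mK; apply: (@itg_bnd _ _ _ P _ 1).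
    by apply: (@measurableT_comp _ _ _ _ _ _ (fun x : nat => (j x == m)%:R : R)).
  by move=> w; case: (_ == _); rewrite ?normr0 ?normr1.
have IGG' : itg P (fun w => `|(Gn w)%:R - (G' w)%:R|).
  by apply: itg_abs; exact: itgB.
(* Distinct natural numbers are at distance at least 1, so a difference of indicators is dominated
   by [|Gn - G'|], and L^1 closeness suffices. *)
have cmp (j : nat -> nat) : injective j ->
    `|Ex P (fun w => (j (Gn w) == m)%:R) - Ex P (fun w => (j (G' w) == m)%:R)| <= 4 * s ^+ 2.
  move=> inj_j; rewrite -ExB; [|exact: (I01 _ j)|exact: (I01 _ j)].
  apply: le_trans GG'; apply: le_trans (Ex_abs (itgB (I01 _ j mGn) (I01 _ j mG'))) _.
  apply: Ex_le => //; first by apply: itg_abs; apply: itgB; exact: I01.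
  move=> w; have [->|ne] := eqVneq (Gn w) (G' w); first by rewrite !subrr normr0.
  apply: (@le_trans _ _ 1).
    by case: (_ == _); case: (_ == _); rewrite ?subrr ?subr0 ?sub0r ?normrN ?normr0 ?normr1.
  have [lt|lt] : (Gn w < G' w)%N \/ (G' w < Gn w)%N by lia.
    by rewrite distrC ger0_norm -?natrB ?(ltnW lt)// ler1n subn_gt0.
  by rewrite ger0_norm -?natrB ?(ltnW lt)// ler1n subn_gt0.
have c1 := cmp id (@inj_id _); have c2 := cmp (fun x => x + 2)%N (@addIn 2).
have := rec m.
have x01 : 0 <= Ex P (fun w => (G' w + 2 == m)%N%:R) <= 1.
  rewrite Ex_ge0// -[leRHS](Ex_cst P); apply: Ex_le; [exact: (I01 _ (addn^~ 2))|exact: itg_cst|].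
  by move=> w; case: (_ == _).
move: c1 c2 x01; rewrite /=.
set x := Ex P (fun w => (Gn w == m)%:R); set x' := Ex P (fun w => (G' w == m)%:R).
set z := Ex P (fun w => (Gn w + 2 == m)%N%:R); set z' := Ex P (fun w => (G' w + 2 == m)%N%:R).
move=> c1 c2 /andP[z'0 z'1] {}rec.
have s2 : s ^+ 2 <= s by rewrite expr2 ler_piMl// ltW.
have h2 : a' <= a + 4 * s ^+ 2 by move: aa'; rewrite ler_norml => /andP[? ?]; lra.
have h3 : D * a' <= D * (a + 4 * s) by rewrite ler_wpM2l//; lra.
have e1 : `|m%:R * x - m%:R * x'| <= m%:R * 4 * s.
  rewrite -mulrBr normrM ger0_norm// -mulrA ler_wpM2l//; lra.
have e2 : `|a' * z' - a * z| <= 4 * s + a * 4 * s.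
  have -> : a' * z' - a * z = (a' - a) * z' - a * (z - z') by ring.
  apply: le_trans (ler_normB _ _) _; apply: lerD.
    rewrite normrM (@ger0_norm _ z')// distrC.
    apply: le_trans (_ : `|a - a'| * z' <= `|a - a'|) _; last lra.
    by rewrite ler_piMr.
  by rewrite normrM (ger0_norm a0) -mulrA ler_wpM2l//; lra.
have -> : m%:R * x - a * z = (m%:R * x - m%:R * x') + (m%:R * x' - a' * z') + (a' * z' - a * z) by ring.
apply: le_trans (ler_normD _ _) _.
have h4 := ler_normD (m%:R * x - m%:R * x') (m%:R * x' - a' * z').
move: h3; rewrite mulrDr => h3; lra.
Qed.

End chaos_limit.

(** * The Poisson limit *)

Section real_sequences.
Context (R : realType).
Implicit Types f g : nat -> R.

Lemma cvg0_le f g : (forall n, `|f n| <= g n) -> g n @[n --> \oo] --> 0 ->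
  f n @[n --> \oo] --> 0.
Proof.
move=> fg g0; apply/cvgrPdist_le => eps e0.
move/cvgrPdist_le : g0 => /(_ eps e0); apply: filterS => n.
rewrite !sub0r !normrN => h; apply: le_trans (fg n) _; exact: le_trans (ler_norm _) h.
Qed.

Lemma eq_cvgn f g (l : R) : f =1 g -> f n @[n --> \oo] --> l -> g n @[n --> \oo] --> l.
Proof. by move=> /funext ->. Qed.

Lemma cvgn_sum (I : Type) (s : seq I) (f : I -> nat -> R) (l : I -> R) :
  (forall i, f i n @[n --> \oo] --> l i) ->
  \sum_(i <- s) f i n @[n --> \oo] --> \sum_(i <- s) l i.
Proof.
move=> fl; elim: s => [|i s IH].
  rewrite big_nil; under eq_fun do rewrite big_nil; exact: cvg_cst.
rewrite big_cons; under eq_fun do rewrite big_cons.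
exact: cvgD.
Qed.

Lemma cvgn_zero_mul f g (l : R) : f n @[n --> \oo] --> l -> g n @[n --> \oo] --> 0 ->
  f n * g n @[n --> \oo] --> 0.
Proof. by move=> fl g0; rewrite -(mulr0 l); exact: cvgM. Qed.

Lemma cvgn_cst_mul0 (k : R) g : g n @[n --> \oo] --> 0 -> k * g n @[n --> \oo] --> 0.
Proof. by apply: cvgn_zero_mul; exact: cvg_cst. Qed.

End real_sequences.

Section poisson_sums.
Context (R : realType).

Lemma pm_sum_cvg (r : R) : \sum_(k < n) pm r k @[n --> \oo] --> (1 : R).
Proof.
have e : (\sum_(0 <= k <oo) (pm r k)%:E = 1 :> \bar R)%E.
  transitivity (\sum_(0 <= k <oo) poisson_prob r 0%N [set k])%E.
    by apply: eq_eseriesr => k _; rewrite pmE.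
  have tS : trivIset setT (fun k : nat => [set k]).
    by apply/trivIsetP => i j _ _ ij; apply/seteqP; split => // w [] /= -> /eqP; rewrite (negbTE ij).
  have := @measure_bigcup _ _ _ (poisson_prob r 0%N) setT (fun k : nat => [set k]) (fun _ _ => I) tS.
  have -> : \bigcup_k [set k] = [set: nat] by apply/seteqP; split => // k _; exists k.
  have e1 : poisson_prob r 0%N [set: nat] = 1%E by exact: probability_setT.
  move=> /(etrans (esym e1)) ->; apply: eq_eseriesl => i; by rewrite in_setT.
have : (\sum_(0 <= k < n) (pm r k)%:E @[n --> \oo] --> (1%:E : \bar R))%E.
  rewrite -e; apply: is_cvg_ereal_nneg_natsum => k _; rewrite lee_fin; exact: pm_ge0.
under eq_fun do rewrite sumEFin.
move/fine_cvgP => [_]; apply: cvg_trans; apply: near_eq_cvg; near=> n.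
by rewrite /= big_mkord.
Unshelve. all: by end_near. Qed.

End poisson_sums.

Section poisson_limit.
Context (R : realType) (dO : measure_display) (Omega : measurableType dO)
  (P : probability Omega R) (G : nat -> Omega -> nat) (a D : nat -> R) (c : R).
Hypothesis mG : forall n, measurable_fun setT (G n).
Hypothesis IG : forall n, itg P (fun w => (G n w)%:R).
Hypothesis EG : forall n, Ex P (fun w => (G n w)%:R) = a n.
Hypothesis rec : forall n (m : nat),
  `|m%:R * Ex P (fun w => (G n w == m)%:R) - a n * Ex P (fun w => (G n w + 2 == m)%N%:R)|
  <= 4 * D n * a n.
Hypothesis c_gt0 : 0 < c.
Hypothesis ac : a n @[n --> \oo] --> c.
Hypothesis D0 : D n @[n --> \oo] --> 0.

Definition law (m n : nat) : R := Ex P (fun w => (G n w == m)%:R).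

Notation r := (c / 2).
Notation q := (pm r).

Let r_gt0 : 0 < r. Proof. exact: divr_gt0. Qed.

Let rec_cvg (m : nat) :
  m%:R * law m n - a n * Ex P (fun w => (G n w + 2 == m)%N%:R) @[n --> \oo] --> 0.
Proof.
apply: (@cvg0_le _ _ (fun n => a n * (4 * D n))) => [n|]; first by rewrite [leRHS]mulrC; exact: rec.
apply: (cvgn_zero_mul ac); rewrite -(mulr0 4); apply: cvgM => //; exact: cvg_cst.
Qed.

Let rec2 (m : nat) : m.+2%:R * law m.+2 n - a n * law m n @[n --> \oo] --> 0.
Proof.
apply: eq_cvgn (rec_cvg m.+2) => n.
congr (_ - _ * Ex P _); apply/funext => w; congr (_ : bool)%:R.
by rewrite addn2 !eqSS.
Qed.

Let law_bound m n : 0 <= law m n <= 1.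
Proof.
rewrite /law Ex_ge0//= -[leRHS](Ex_cst P); apply: Ex_le; last by move=> w; case: (_ == _).
  apply: (@itg_bnd _ _ _ P _ 1); last by move=> w; case: (_ == _); rewrite ?normr0 ?normr1.
  by apply: (@measurableT_comp _ _ _ _ _ _ (fun x : nat => (x == m)%:R : R)).
exact: itg_cst.
Qed.

Lemma law_odd k : law k.*2.+1 n @[n --> \oo] --> 0.
Proof.
elim: k => [|k IH].
  (* For [m = 1] the shifted event [G + 2 = 1] is empty, so the recursion bounds the probability of
     the value 1 directly. *)
  apply: eq_cvgn (rec_cvg 1) => n.
  rewrite mul1r [X in _ * X](_ : _ = 0) ?mulr0 ?subr0//.
  rewrite -[RHS](Ex_cst P); congr Ex; apply/funext => w.
  by rewrite addn2.
have h : k.*2.+3%:R * law k.*2.+3 n - a n * law k.*2.+1 n + a n * law k.*2.+1 n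
    @[n --> \oo] --> 0.
  by rewrite -(addr0 0); apply: cvgD; [exact: rec2|exact: (cvgn_zero_mul ac IH)].
apply: eq_cvgn (cvgn_cst_mul0 (k.*2.+3)%:R^-1 h) => n /=.
by rewrite subrK mulKf// pnatr_eq0.
Qed.

(** The recursion is linear, so it fixes the even probabilities only up to the unknown factor
    [law 0 n]; [dev] measures how far they are from being proportional to the Poisson weights. *)
Let dev k n := q 0 * law k.*2 n - q k * law 0 n.

Lemma law_even_dev k : dev k n @[n --> \oo] --> 0.
Proof.
rewrite /dev; elim: k => [|k IH].
  by under eq_fun do rewrite subrr; exact: cvg_cst.
have h1 : a n - 2 * r @[n --> \oo] --> 0.
  have -> : 2 * r = c by field.
  by rewrite -(subrr c); apply: cvgB => //; exact: cvg_cst.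
have h2 : law k.*2 n * (a n - 2 * r) @[n --> \oo] --> 0.
  apply: (@cvg0_le _ _ (fun n => `|a n - 2 * r|)).
    move=> n; rewrite normrM; have /andP[l0 l1] := law_bound k.*2 n.
    by rewrite (ger0_norm l0) ler_piMl.
  by rewrite -(normr0 R); exact: cvg_norm.
(* This sum is [(k.*2.+2)%:R * dev k.+1 n]: the recursion of the law is compared with [pmS], the
   step [k.+1] of the Poisson weights being two steps of the count. *)
have h : 2 * r * (q 0 * law k.*2 n - q k * law 0 n) +
    (q 0 * (law k.*2 n * (a n - 2 * r)) +
     q 0 * (k.*2.+2%:R * law k.*2.+2 n - a n * law k.*2 n)) @[n --> \oo] --> 0.
  rewrite -(addr0 0); apply: cvgD; first exact: cvgn_cst_mul0 IH.
  rewrite -(addr0 0); apply: cvgD; first exact: cvgn_cst_mul0 h2.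
  exact: cvgn_cst_mul0 (rec2 _).
apply: eq_cvgn (cvgn_cst_mul0 (k.*2.+2)%:R^-1 h) => n /=.
have qS := pmS k (ltW r_gt0).
have k0 : (k.*2.+2)%:R != 0 :> R by rewrite pnatr_eq0.
apply: (mulfI k0); rewrite mulVKf//.
have k2 : (k.*2.+2)%:R = 2 * k.+1%:R :> R by rewrite -natrM; congr _%:R; lia.
rewrite doubleS [RHS]mulrBr.
have -> : (k.*2.+2)%:R * (q k.+1 * law 0 n) = 2 * (k.+1%:R * q k.+1) * law 0 n.
  by rewrite k2 !mulrA.
by rewrite qS; ring.
Qed.

(** Markov's inequality; as [a n] converges, it keeps mass from escaping to infinity. *)
Let tail K n : `|1 - \sum_(m < K.+1.*2) law m n| <= a n / (K.+1.*2)%:R.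
Proof.
have K0 : 0 < (K.+1.*2)%:R :> R by rewrite ltr0n; lia.
have I1 m : itg P (fun w => (G n w == m)%:R).
  apply: (@itg_bnd _ _ _ P _ 1); last by move=> w; case: (_ == _); rewrite ?normr0 ?normr1.
  by apply: (@measurableT_comp _ _ _ _ _ _ (fun x : nat => (x == m)%:R : R)).
have Is : itg P (fun w => \sum_(m < K.+1.*2) (G n w == m)%:R) by apply: itg_sum.
have -> : 1 - \sum_(m < K.+1.*2) law m n = Ex P (fun w => 1 - \sum_(m < K.+1.*2) (G n w == m)%:R).
  by rewrite (ExB (itg_cst _ 1) Is) Ex_cst Ex_sum.
apply: le_trans (Ex_abs (itgB (itg_cst _ 1) Is)) _.
rewrite -EG mulrC -(ExZ _ (IG n)); apply: Ex_le.
- by apply: itg_abs; apply: itgB => //; exact: itg_cst.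
- exact: itgZ.
move=> w; have [lt|ge] := ltnP (G n w) K.+1.*2.
  rewrite (bigD1 (Ordinal lt))//= eqxx big1 ?addr0 ?subrr ?normr0.
    by rewrite mulr_ge0// invr_ge0 ltW.
  by move=> i; rewrite -val_eqE/= eq_sym => /negbTE ->.
rewrite big1 ?subr0 ?normr1; last first.
  by move=> i _; case: eqP => // Gi; move: ge; rewrite Gi leqNgt ltn_ord.
by rewrite mulrC ler_pdivlMr// mul1r ler_nat.
Qed.

Let sum_parity K n : \sum_(m < K.*2) law m n =
  \sum_(k < K) law k.*2 n + \sum_(k < K) law k.*2.+1 n.
Proof.
elim: K => [|K IH]; first by rewrite !big_ord0 addr0.
by rewrite doubleS !big_ord_recr /= IH; ring.
Qed.

(** The total mass 1 fixes the unknown factor: the tail is uniformly small, the odd values vanish,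
    and the even probabilities are nearly proportional to Poisson weights, which also sum to 1. *)
Lemma law_zero : law 0 n @[n --> \oo] --> q 0.
Proof.
apply/cvgrPdist_le => eps e0.
have e4 : 0 < eps / 4 by rewrite divr_gt0.
have q01 : 0 <= q 0 <= 1.
  rewrite pm_ge0 -lee_fin -pmE; exact: probability_le1.
have a_le : \forall n \near \oo, a n <= c + 1.
  have /cvgrPdist_le /(_ 1 ltr01) := ac; apply: filterS => n.
  by rewrite ler_norml => /andP[? ?]; lra.
have [K hK1 hK2] : exists2 K : nat, (c + 1) / (K.+1.*2)%:R <= eps / 4 & 1 - eps / 4 <= \sum_(k < K.+1) q k.
  have /cvgrPdist_le /(_ _ e4) [K0 _ hK0] := pm_sum_cvg r.
  pose K := maxn K0 (Num.trunc ((c + 1) / (eps / 4))).+1.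
  exists K.
    have K2 : 0 < (K.+1.*2)%:R :> R by rewrite ltr0n; lia.
    rewrite ler_pdivrMr// mulrC -ler_pdivrMr//.
    apply: ltW; apply: lt_le_trans (truncnS_gt _) _; rewrite ler_nat.
    apply: leq_trans (leq_maxr K0 _) _; rewrite -/K; lia.
  have K0K : (K0 <= K.+1)%N by apply: leq_trans (leq_maxl _ _) (leqnSn _).
  have := hK0 K.+1 K0K.
  by rewrite /= ler_norml => /andP[_ ?]; lra.
have odd0 : \sum_(k < K.+1) law k.*2.+1 n @[n --> \oo] --> 0.
  have := @cvgn_sum R _ (index_enum 'I_K.+1) (fun k n => law k.*2.+1 n) (fun=> 0) (fun k => law_odd k).
  by rewrite big1.
have dev0 : \sum_(k < K.+1) dev k n @[n --> \oo] --> 0.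
  have := @cvgn_sum R _ (index_enum 'I_K.+1) (fun k n => dev k n) (fun=> 0) (fun k => law_even_dev k).
  by rewrite big1.
move/cvgrPdist_le : odd0 => /(_ _ e4) odd0; move/cvgrPdist_le : dev0 => /(_ _ e4) dev0.
near=> n.
have ha : a n <= c + 1 by near: n.
have ho : `|0 - \sum_(k < K.+1) law k.*2.+1 n| <= eps / 4 by near: n.
have hd : `|0 - \sum_(k < K.+1) dev k n| <= eps / 4 by near: n.
have ht := tail K n; rewrite sum_parity in ht.
have hd' : \sum_(k < K.+1) dev k n = q 0 * \sum_(k < K.+1) law k.*2 n - (\sum_(k < K.+1) q k) * law 0 n.
  by rewrite /dev sumrB -mulr_sumr -mulr_suml.
have ht' : a n / (K.+1.*2)%:R <= eps / 4.
  by apply: le_trans hK1; rewrite ler_wpM2r// invr_ge0.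
have Q1 : \sum_(k < K.+1) q k <= 1.
  have : (\sum_(k < K.+1) (q k)%:E <= 1 :> \bar R)%E.
    rewrite (eq_bigr (fun k : 'I_K.+1 => poisson_prob r 0%N [set (k : nat)])); last first.
      by move=> k _; rewrite pmE.
    rewrite -(@measure_bigsetU_ord _ _ _ (poisson_prob r 0%N) K.+1 predT (fun k => [set (k : nat)])) //; last first.
      by apply/trivIsetP => i j _ _ ij; apply/seteqP; split => // w [] /= -> /eqP; rewrite val_eqE (negbTE ij).
    exact: probability_le1.
  by rewrite sumEFin lee_fin.
have /andP[p00 p01] := law_bound 0 n.
move: ht hd ho; rewrite hd' !ler_norml => /andP[t1 t2] /andP[d1 d2] /andP[ho1 ho2].
case/andP: q01 => q00 q01.
move: t1 t2 d1 d2 ho1 ho2 Q1 hK2.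
set B := \sum_(k < K.+1) law k.*2 n; set O := \sum_(k < K.+1) law _ n; set Q := \sum_(k < K.+1) q k.
move=> t1 t2 d1 d2 ho1 ho2 Q1 hK2.
(* The difference [q 0 - law 0 n] is [q 0 * (1 - B) - law 0 n * (1 - Q)] plus the sum of the
   [dev k n]; these three terms receive [eps / 2], [eps / 4] and [eps / 4]. *)
have qB1 : q 0 * (1 - B) <= eps / 2.
  apply: le_trans (_ : q 0 * (eps / 2) <= _); last by rewrite ler_piMl//; lra.
  by rewrite ler_wpM2l//; lra.
have qB2 : - (eps / 2) <= q 0 * (1 - B).
  apply: le_trans (_ : q 0 * - (eps / 2) <= _); last by rewrite ler_wpM2l//; lra.
  have : q 0 * (eps / 2) <= eps / 2 by rewrite ler_piMl//; lra.
  lra.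
have pQ1 : law 0 n * (1 - Q) <= eps / 4.
  apply: le_trans (_ : law 0 n * (eps / 4) <= _); last by rewrite ler_piMl//; lra.
  by rewrite ler_wpM2l//; lra.
have pQ2 : 0 <= law 0 n * (1 - Q) by rewrite mulr_ge0//; lra.
rewrite mulrBr mulr1 in qB1 qB2; rewrite mulrBr mulr1 in pQ1 pQ2.
apply/andP; split; lra.
Unshelve. all: by end_near. Qed.

Lemma law_even k : law k.*2 n @[n --> \oo] --> q k.
Proof.
have q0 : q 0 != 0.
  by rewrite pm_pos// /poisson_pmf r_gt0 expr0 fact0 invr1 !mul1r gt_eqF// expR_gt0.
have h : (q 0)^-1 * (dev k n + q k * law 0 n) @[n --> \oo] --> (q 0)^-1 * (0 + q k * q 0).
  apply: cvgM; first exact: cvg_cst.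
  apply: cvgD; first exact: law_even_dev.
  by apply: cvgM; [exact: cvg_cst|exact: law_zero].
rewrite add0r mulrCA mulVf// mulr1 in h.
apply: eq_cvgn h => n.
by rewrite /dev subrK mulKf.
Qed.

End poisson_limit.

(** * From point probabilities to convergence in law *)

Section weak_limit.
Context (R : realType) (dO : measure_display) (Omega : measurableType dO)
  (P : probability Omega R) (G : nat -> Omega -> nat) (c : R).
Hypothesis mG : forall n, measurable_fun setT (G n).
Notation q := (pm (c / 2)).
Hypothesis law_cvg : forall k, law P G k.*2 n @[n --> \oo] --> q k.
Context (Y : nat -> Omega -> R).
Hypothesis mY : forall n, measurable_fun setT (Y n).
Hypothesis IY : forall n, itg P (fun w => (Y n w - ((G n w)%:R - c)) ^+ 2).
Hypothesis Y0 : Ex P (fun w => (Y n w - ((G n w)%:R - c)) ^+ 2) @[n --> \oo] --> 0.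
Context (h : R -> R) (M : R).
Hypothesis hc : continuous h.
Hypothesis hM : forall x, `|h x| <= M.

Let X (k : nat) : R := 2 * (k%:R - c / 2).

Let M0 : 0 <= M. Proof. exact: le_trans (normr_ge0 (h 0)) (hM 0). Qed.

Let mh : measurable_fun setT h.
Proof. exact: continuous_measurable_fun. Qed.

Let mind n (k : nat) : measurable_fun setT (fun w => (G n w == k)%:R : R).
Proof. by apply: (@measurableT_comp _ _ _ _ _ _ (fun x : nat => (x == k)%:R : R)). Qed.

Let Iind n (k : nat) : itg P (fun w => (G n w == k)%:R).
Proof.
apply: (@itg_bnd _ _ _ P _ 1); first exact: mind.
by move=> w; case: (_ == _); rewrite ?normr0 ?normr1.
Qed.

Let mhY n : measurable_fun setT (fun w => h (Y n w)).
Proof. exact: measurableT_comp. Qed.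

Let IhY n : itg P (fun w => h (Y n w)).
Proof. by apply: (@itg_bnd _ _ _ P _ M). Qed.

Let term k n := Ex P (fun w => h (Y n w) * (G n w == k.*2)%:R).

Let Iterm k n : itg P (fun w => h (Y n w) * (G n w == k.*2)%:R).
Proof.
apply: (@itg_bnd _ _ _ P _ M); first exact: measurable_funM.
by move=> w; case: (_ == _); rewrite ?mulr1 ?mulr0 ?normr0.
Qed.

(** On the event [G n w = k.*2] the variable [Y n] is L^2-close to the fixed point [X k], so
    continuity of [h] at that point suffices. Where [Y n] is farther than [delta], the bound [2 * M]
    is paid for by [K] times the squared distance. *)
Lemma term_cvg k : term k n @[n --> \oo] --> q k * h (X k).
Proof.
have h1 : h (X k) * law P G k.*2 n @[n --> \oo] --> h (X k) * q k.
  by apply: cvgM; [exact: cvg_cst|exact: law_cvg].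
rewrite mulrC -[X in _ --> X]add0r.
apply: (eq_cvgn (f := fun n => (term k n - h (X k) * law P G k.*2 n) + h (X k) * law P G k.*2 n)).
  by move=> n; rewrite subrK.
apply: cvgD => //.
apply/cvgrPdist_le => eps e0.
have /cvgrPdist_le/(_ (eps / 2)) := @hc (X k).
move=> /(_ (divr_gt0 e0 (ltr0n _ 2)))/nbhs_ballP[delta /= d0 hd].
have d20 : 0 < delta ^+ 2 by rewrite exprn_gt0.
pose K := 2 * M / delta ^+ 2.
have K0 : 0 <= K by rewrite divr_ge0 ?mulr_ge0// ltW.
have e2 : 0 < eps / (2 * (K + 1)) by rewrite divr_gt0//; lra.
have /cvgrPdist_le/(_ _ e2) := Y0; apply: filterS => n.
rewrite sub0r normrN => hY.
rewrite sub0r normrN.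
have -> : term k n - h (X k) * law P G k.*2 n =
    Ex P (fun w => h (Y n w) * (G n w == k.*2)%:R - h (X k) * (G n w == k.*2)%:R).
  by rewrite /law -ExZ// -ExB//; exact: itgZ.
have Idf := itgB (Iterm k n) (itgZ (h (X k)) (Iind n k.*2)).
apply: le_trans (Ex_abs Idf) _.
apply: (@le_trans _ _ (Ex P (fun w => eps / 2 + K * (Y n w - ((G n w)%:R - c)) ^+ 2))).
  apply: Ex_le; first exact: itg_abs.
    by apply: itgD; [exact: itg_cst|exact: itgZ].
  move=> w; case: eqP => [Gk|_]; last first.
    rewrite !mulr0 subrr normr0; apply: addr_ge0; first by rewrite divr_ge0// ltW.
    by rewrite mulr_ge0// sqr_ge0.
  rewrite !mulr1 Gk.
  have XE : (k.*2)%:R - c = X k :> R by rewrite /X -mul2n natrM; field.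
  rewrite XE; have [lt|ge] := ltP `|X k - Y n w| delta.
    rewrite distrC; apply: le_trans (hd _ _) _; first exact: lt.
    by rewrite lerDl mulr_ge0// sqr_ge0.
  apply: le_trans (_ : 2 * M <= _).
    by apply: le_trans (ler_normB _ _) _; rewrite mulr_natl mulr2n lerD.
  apply: le_trans (_ : K * (Y n w - X k) ^+ 2 <= _); last first.
    by rewrite lerDr divr_ge0// ltW.
  rewrite /K mulrAC ler_pdivlMr// ler_wpM2l ?mulr_ge0//.
  by rewrite -[leRHS]real_normK ?num_real// distrC lerXn2r ?nnegrE ?(ltW d0).
rewrite (ExD (itg_cst _ _) (itgZ K (IY n))) Ex_cst (ExZ K (IY n)).
have E0 : 0 <= Ex P (fun w => (Y n w - ((G n w)%:R - c)) ^+ 2).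
  by apply: Ex_ge0 => w; exact: sqr_ge0.
rewrite ger0_norm// in hY.
have : K * Ex P (fun w => (Y n w - ((G n w)%:R - c)) ^+ 2) <= (K + 1) * (eps / (2 * (K + 1))).
  apply: ler_pM => //; lra.
have -> : (K + 1) * (eps / (2 * (K + 1))) = eps / 2 by field; apply/eqP; lra.
lra.
Qed.

Let Q : probability nat R := poisson_prob (c / 2) 0%N.

Let ExQ1 (k : nat) : Ex Q (fun j => (j == k)%:R) = q k.
Proof.
rewrite -[RHS]/(fine (Q [set k])) -Ex_indic//; congr Ex; apply/funext => j.
rewrite indicE; congr (nat_of_bool _)%:R.
by apply/eqP/idP => [->|]; rewrite inE.
Qed.

Let IQ (f : nat -> R) B : (forall k, `|f k| <= B) -> itg Q f.
Proof. by move=> fB; apply: (@itg_bnd _ _ _ Q _ B). Qed.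

(* Off the values [X 0], ..., [X (K - 1)] only a small mass is left. *)
Let remainder (d : measure_display) (T : measurableType d) (S : probability T R)
    (f : T -> R) (N : T -> nat) K :
  itg S f -> (forall x, `|f x| <= M) -> (forall k : nat, itg S (fun x => (N x == k)%:R)) ->
  (forall k : nat, itg S (fun x => f x * (N x == k)%:R)) -> forall (s : nat -> nat), injective s ->
  `|Ex S f - \sum_(k < K) Ex S (fun x => f x * (N x == s k)%:R)| <=
  M * (1 - \sum_(k < K) Ex S (fun x => (N x == s k)%:R)).
Proof.
move=> If fM IN IfN s injs.
have I1 : itg S (fun x => \sum_(k < K) (N x == s k)%:R) by exact: itg_sum.
have I2 : itg S (fun x => \sum_(k < K) f x * (N x == s k)%:R) by exact: itg_sum.
rewrite -Ex_sum// -(ExB If I2) -Ex_sum// -{2}(Ex_cst S 1) -(ExB (itg_cst _ _) I1) -ExZ; last first.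
  by apply: itgB => //; exact: itg_cst.
apply: le_trans (Ex_abs (itgB If I2)) _; apply: Ex_le.
- by apply: itg_abs; exact: itgB.
- by apply: itgZ; apply: itgB => //; exact: itg_cst.
move=> x; rewrite -mulr_sumr -{1}[f x]mulr1 -mulrBr normrM.
have [u0 u1] : 0 <= \sum_(k < K) (N x == s k)%:R :> R /\ \sum_(k < K) (N x == s k)%:R <= 1 :> R.
  split; first by apply: sumr_ge0.
  have [[j jK Nj]|no] := pselect (exists2 j, (j < K)%N & N x = s j).
    rewrite (bigD1 (Ordinal jK))//= Nj eqxx big1 ?addr0// => i.
    by rewrite -val_eqE/= eq_sym => /negbTE ij; rewrite (inj_eq injs) ij.
  rewrite big1// => i _; case: eqP => // Ni; case: no; exists i => //.
by rewrite (@ger0_norm _ (1 - _)) ?subr_ge0// ler_wpM2r// subr_ge0.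
Qed.

Lemma weak_cvg : Ex P (fun w => h (Y n w)) @[n --> \oo] --> Ex Q (fun k => h (X k)).
Proof.
apply/cvgrPdist_le => eps e0.
(* [M + 1] covers the case [M = 0]. The budget is [eps / 8] for the remainder under [Q], [eps / 4]
   for the one under [P], and [eps / 4] for the finite sums. *)
have M1 : 0 < 8 * (M + 1) by rewrite mulr_gt0//; have := M0; lra.
have e8 : 0 < eps / (8 * (M + 1)) by rewrite divr_gt0.
have e4 : 0 < eps / 4 by rewrite divr_gt0.
have [K _ /(_ K (leqnn _)) hK] := (cvgrPdist_le _ _).1 (pm_sum_cvg (c / 2)) _ e8.
have A : \sum_(k < K) term k n @[n --> \oo] --> \sum_(k < K) q k * h (X k).
  exact: (@cvgn_sum R 'I_K (index_enum 'I_K) (fun k n => term k n) (fun k => q k * h (X k))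
    (fun k => @term_cvg k)).
have B : \sum_(k < K) law P G k.*2 n @[n --> \oo] --> \sum_(k < K) q k.
  exact: (@cvgn_sum R 'I_K (index_enum 'I_K) (fun k n => law P G k.*2 n) (fun k => q k)
    (fun k => @law_cvg k)).
move/cvgrPdist_le : A => /(_ _ e4) A; move/cvgrPdist_le : B => /(_ _ e8) B.
have rQ := @remainder _ _ Q (fun k => h (X k)) id K (IQ (fun k => hM (X k))) (fun k => hM (X k)).
have I1 k : itg Q (fun x : nat => (x == k)%:R).
  by apply: (@IQ _ 1) => x; case: (_ == _); rewrite ?normr0 ?normr1.
have I2 k : itg Q (fun x : nat => h (X x) * (x == k)%:R).
  by apply: (@IQ _ M) => x; case: (_ == _); rewrite ?mulr1 ?mulr0 ?normr0.
have {}rQ := rQ I1 I2 id (@inj_id _).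
have ExQ2 k : Ex Q (fun x : nat => h (X x) * (x == k)%:R) = q k * h (X k).
  rewrite -ExQ1 mulrC -ExZ//; congr Ex; apply/funext => x /=.
  by case: eqP => [->|_]; rewrite ?mulr0.
have s1 : \sum_(k < K) Ex Q (fun x : nat => h (X x) * (x == k)%:R) = \sum_(k < K) q k * h (X k).
  by apply: eq_bigr => k _; exact: ExQ2.
have s2 : \sum_(k < K) Ex Q (fun x : nat => (x == k)%:R) = \sum_(k < K) q k.
  by apply: eq_bigr => k _; exact: ExQ1.
rewrite /= s1 s2 in rQ.
near=> n.
have rP := @remainder _ _ P (fun w => h (Y n w)) (G n) K (IhY n) (fun w => hM _)
  (fun k => Iind n k).
have I3 (k : nat) : itg P (fun x => h (Y n x) * (G n x == k)%:R).
  apply: (@itg_bnd _ _ _ P _ M); first exact: measurable_funM.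
  by move=> w; case: (_ == _); rewrite ?mulr1 ?mulr0 ?normr0.
have {}rP := rP I3 double (can_inj doubleK).
have hA : `|\sum_(k < K) q k * h (X k) - \sum_(k < K) term k n| <= eps / 4 by near: n.
have hB : `|\sum_(k < K) q k - \sum_(k < K) law P G k.*2 n| <= eps / (8 * (M + 1)) by near: n.
move: rQ rP hA hB hK; rewrite /term /law /=.
set LQ := Ex Q _; set LP := Ex P (fun w => h (Y n w)).
set AQ := \sum_(k < K) q k * _; set AP := \sum_(k < K) Ex P _; set BQ := \sum_(k < K) q k.
set BP := \sum_(k < K) Ex P _ => rQ rP hA hB hK.
have Me : M * (eps / (8 * (M + 1))) <= eps / 8.
  rewrite -[leRHS](_ : (M + 1) * (eps / (8 * (M + 1))) = eps / 8); last by field; apply/eqP; lra.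
  by rewrite ler_wpM2r ?(ltW e8)//; lra.
have r1 : M * (1 - BQ) <= eps / 8.
  apply: le_trans Me; rewrite ler_wpM2l//; apply: le_trans hK; exact: ler_norm.
have r2 : M * (1 - BP) <= eps / 4.
  have : M * (BQ - BP) <= eps / 8.
    apply: le_trans Me; rewrite ler_wpM2l//; apply: le_trans hB; exact: ler_norm.
  by lra.
move: rQ rP hA; rewrite !ler_norml => /andP[? ?] /andP[? ?] /andP[? ?].
apply/andP; split; lra.
Unshelve. all: by end_near. Qed.

End weak_limit.

(** * Variance and choice of the sequence *)

Section moments_off_null.
Context (R : realType) (dO : measure_display) (Omega : measurableType dO)
  (P : probability Omega R) (N : set Omega).
Hypotheses (mN : measurable N) (N0 : P N = 0%E).

Lemma expectation_off_null (X g : Omega -> R) : itg P g -> (forall w, ~ N w -> X w = g w) ->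
  ('E_P[X] = (Ex P g)%:E)%E.
Proof.
move=> Ig Xg; rewrite unlock -ExE//; apply: (integral_off_null mN N0).
  by apply/measurable_EFinP; exact: itg_meas Ig.
by move=> w Nw; rewrite Xg.
Qed.

Lemma variance_off_null (X g : Omega -> R) : l2 P g -> (forall w, ~ N w -> X w = g w) ->
  ('V_P[X] = (Ex P (fun w => (g w - Ex P g) ^+ 2))%:E)%E.
Proof.
move=> lg Xg; rewrite /variance unlock (expectation_off_null (l2_itg lg) Xg)/=.
apply: expectation_off_null => [|w Nw]; last by rewrite -[LHS]/((X w - _) * (X w - _)) Xg// expr2.
exact: (l2B lg (l2_cst _ _)).2.
Qed.

End moments_off_null.

Lemma div_sqrt_le (R : rcfType) (a v : R) : 0 <= a -> a <= v -> a / Num.sqrt v <= Num.sqrt a.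
Proof.
(* A vanishing variance is covered by the convention that division by 0 gives 0. *)
move=> a0 av; have [v0|v0] := eqVneq (Num.sqrt v) 0.
  by rewrite v0 invr0 mulr0 sqrtr_ge0.
have sv : 0 < Num.sqrt v by rewrite lt_neqAle eq_sym v0 sqrtr_ge0.
rewrite ler_pdivrMr// -{1}[a]sqr_sqrtr// expr2 ler_wpM2l ?sqrtr_ge0//.
by rewrite ler_sqrt// (le_trans a0).
Qed.

Section sparse_edge_count.
Context (R : realType) (dO : measure_display) (Omega : measurableType dO)
  (P : probability Omega R) (N : set Omega).
Hypotheses (mN : measurable N) (N0 : P N = 0%E).
Context (F F2 : Omega -> R) (G : Omega -> nat) (a D : R).
Hypothesis FG : forall w, ~ N w -> F w = (G w)%:R.
Hypothesis (IG : itg P (fun w => (G w)%:R)) (EG : Ex P (fun w => (G w)%:R) = a).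
Hypothesis (lF2 : l2 P F2) (EF2 : Ex P F2 = 0) (EF22 : Ex P (fun w => F2 w ^+ 2) = 2 * a).
Hypothesis lZ : l2 P (fun w => (G w)%:R - a - F2 w).
Hypothesis EZ : Ex P (fun w => ((G w)%:R - a - F2 w) ^+ 2) <= 8 * D * a.
Hypotheses (a_ge0 : 0 <= a) (D_ge0 : 0 <= D).

Let V := Ex P (fun w => ((G w)%:R - a) ^+ 2).

Let lGa : l2 P (fun w => (G w)%:R - a).
Proof.
have := l2D lF2 lZ; congr (l2 P _); apply/funext => w; lra.
Qed.

Let lG : l2 P (fun w => (G w)%:R).
Proof.
have := l2D lGa (l2_cst P a); congr (l2 P _); apply/funext => w; lra.
Qed.

Lemma expectation_edges : ('E_P[F] = a%:E)%E.
Proof. by rewrite (expectation_off_null mN N0 IG FG) EG. Qed.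

Lemma variance_edges : ('V_P[F] = V%:E)%E.
Proof. by rewrite (variance_off_null mN N0 lG FG) EG. Qed.

Lemma variance_double_integral : ('V_P[F2] = (2 * a)%:E)%E.
Proof.
rewrite (variance_off_null mN N0 lF2 (fun _ _ => erefl)) EF2 -EF22.
by congr (Ex P _)%:E; apply/funext => w; rewrite subr0.
Qed.

(** Expansion of the square of [F2 + Z]: the main term is [2 * a], and by Cauchy-Schwarz the mixed
    term is at most twice the square root of [2 * a * (8 * D * a)], which is
    [8 * a * Num.sqrt D]. *)
Lemma variance_edges_dist : `|V - 2 * a| <= 8 * a * (Num.sqrt D + D).
Proof.
pose Z w := (G w)%:R - a - F2 w.
have h : V = 2 * a + (2 * Ex P (fun w => F2 w * Z w) + Ex P (fun w => Z w ^+ 2)).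
  rewrite -EF22 -ExZ; last exact: l2_mul.
  rewrite -ExD//; [|by apply: itgZ; exact: l2_mul|exact: lZ.2].
  rewrite -ExD; [|exact: lF2.2|]; last first.
    by apply: itgD; [apply: itgZ; exact: l2_mul|exact: lZ.2].
  by congr Ex; apply/funext => w; rewrite /Z; ring.
have cs := cauchy_schwarz_Ex lF2 lZ.
have n1 : l2norm P F2 = Num.sqrt (2 * a) by rewrite /l2norm EF22.
have n2 : l2norm P Z <= Num.sqrt (8 * D * a).
  by rewrite /l2norm ler_wsqrtr.
have n3 : l2norm P F2 * l2norm P Z <= 4 * a * Num.sqrt D.
  rewrite n1; apply: le_trans (ler_wpM2l (sqrtr_ge0 _) n2) _.
  rewrite -sqrtrM ?mulr_ge0// (_ : 2 * a * (8 * D * a) = (4 * a) ^+ 2 * D); last by ring.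
  by rewrite sqrtrM ?sqr_ge0// sqrtr_sqr ger0_norm ?mulr_ge0.
have e0 : 0 <= Ex P (fun w => Z w ^+ 2) by apply: Ex_ge0 => w; exact: sqr_ge0.
have := le_trans cs n3; move: EZ; rewrite -/Z h !ler_norml => ? /andP[? ?].
have : 0 <= a * Num.sqrt D by rewrite mulr_ge0 ?sqrtr_ge0.
have : 0 <= a * D by rewrite mulr_ge0.
by move=> ? ?; apply/andP; split; lra.
Qed.

Hypothesis aV : a <= V.

Lemma standardize_edges w : ~ N w -> standardize P F w = ((G w)%:R - a) / Num.sqrt V.
Proof. by move=> /FG FGw; rewrite /standardize expectation_edges variance_edges FGw. Qed.

(** [a <= V] turns the bound [a / Num.sqrt V] into [Num.sqrt a], which stays bounded along the
    sequence even if the variance tends to 0. *)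
Lemma standardize_edges_ge w : ~ N w -> - Num.sqrt a <= standardize P F w.
Proof.
move=> /standardize_edges ->; apply: (@le_trans _ _ (- (a / Num.sqrt V))).
  by rewrite lerN2 div_sqrt_le.
by rewrite -mulNr ler_wpM2r ?invr_ge0 ?sqrtr_ge0// lerDr.
Qed.

(** Since [G] is nonnegative with mean [a], its mean absolute deviation is at most [2 * a]; for
    small [a] this beats the normalization, which is at least [Num.sqrt a]. *)
Lemma expectation_abs_standardize_edges : exists y : R,
  [/\ ('E_P[fun w => `|standardize P F w|%R] = y%:E)%E, 0 <= y & y <= 2 * Num.sqrt a].
Proof.
have I : itg P (fun w => (Num.sqrt V)^-1 * `|(G w)%:R - a|).
  by apply: itgZ; apply: itg_abs; exact: l2_itg.
exists (Ex P (fun w => (Num.sqrt V)^-1 * `|(G w)%:R - a|)); split.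
- apply: (expectation_off_null mN N0 I) => w /standardize_edges ->.
  by rewrite normrM normfV [X in _ / X]ger0_norm ?sqrtr_ge0// mulrC.
- by apply: Ex_ge0 => w; rewrite mulr_ge0// invr_ge0 sqrtr_ge0.
- rewrite ExZ; last by apply: itg_abs; exact: l2_itg.
  apply: (@le_trans _ _ ((Num.sqrt V)^-1 * (2 * a))).
    rewrite ler_wpM2l ?invr_ge0 ?sqrtr_ge0//.
    rewrite -[leRHS](_ : Ex P (fun w => (G w)%:R + a) = _); last first.
      by rewrite ExD ?EG ?Ex_cst//; [ring|exact: itg_cst].
    apply: Ex_le; first by apply: itg_abs; exact: l2_itg.
      by apply: itgD => //; exact: itg_cst.
    by move=> w; apply: le_trans (ler_normB _ _) _; rewrite !ger0_norm.
  by rewrite mulrCA ler_pM2l// mulrC div_sqrt_le.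
Qed.

Lemma double_integral_dist c :
  itg P (fun w => (F2 w - ((G w)%:R - c)) ^+ 2) /\
  Ex P (fun w => (F2 w - ((G w)%:R - c)) ^+ 2) <= 2 * (c - a) ^+ 2 + 16 * D * a.
Proof.
have l1 : l2 P (fun w => F2 w - ((G w)%:R - c)).
  by apply: l2B => //; apply: l2B => //; exact: l2_cst.
split; first exact: l1.2.
have I : itg P (fun w => 2 * ((G w)%:R - a - F2 w) ^+ 2) by apply: itgZ; exact: lZ.2.
apply: (@le_trans _ _ (Ex P (fun w => 2 * (c - a) ^+ 2 + 2 * ((G w)%:R - a - F2 w) ^+ 2))).
  apply: Ex_le; first exact: l1.2.
    by apply: itgD => //; exact: itg_cst.
  move=> w; rewrite -subr_ge0.
  (* For [u = c - a] and [v] the remainder, the left-hand side is [(u - v) ^+ 2], and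
     [2 * u ^+ 2 + 2 * v ^+ 2 - (u - v) ^+ 2] is [(u + v) ^+ 2]. *)
  rewrite [leRHS](_ : _ = (c - a + ((G w)%:R - a - F2 w)) ^+ 2); last by ring.
  exact: sqr_ge0.
rewrite ExD//; last exact: itg_cst.
rewrite Ex_cst ExZ; last exact: lZ.2.
by move: EZ; lra.
Qed.

Lemma centered_edges_dist c :
  itg P (fun w => ((G w)%:R - a - ((G w)%:R - c)) ^+ 2) /\
  Ex P (fun w => ((G w)%:R - a - ((G w)%:R - c)) ^+ 2) = (c - a) ^+ 2.
Proof.
have -> : (fun w => ((G w)%:R - a - ((G w)%:R - c)) ^+ 2) = fun=> (c - a) ^+ 2.
  by apply/funext => w; congr (_ ^+ 2); ring.
by split; [exact: itg_cst|rewrite Ex_cst].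
Qed.

End sparse_edge_count.

(** Compactness of the segment gives a cluster point along [v], and for each [n] an index [k n >= n]
    where [f] is close to it; [k n >= n] preserves the divergence of the sequence, without [k] being
    monotone. *)
Lemma cluster_sequence (R : realType) (A : set R) (f : R -> R) (K : R) :
  (forall b, exists2 x, b < x & A x) -> (forall x, A x -> 0 <= f x <= K) ->
  exists (u : nat -> R) (c : R),
    [/\ forall n, n%:R < u n, forall n, A (u n), 0 <= c & f (u n) @[n --> \oo] --> c].
Proof.
move=> exA fK.
have /choice[v vP] : forall n : nat, exists x, n%:R < x /\ A x.
  by move=> n; have [x ? ?] := exA n%:R; exists x.
have [] := @segment_compact R 0 K (f (v n) @[n --> \oo]).
  by exists 0%N => // n _; rewrite /= in_itv /=; apply: fK; exact: (vP n).2.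
move=> c [/=]; rewrite in_itv/= => /andP[c0 _] cl.
have /choice[k kP] : forall n : nat, exists m : nat, (n <= m)%N /\ `|c - f (v m)| < n.+1%:R^-1.
  move=> n.
  have h : (f (v m) @[m --> \oo]) [set f (v m) | m in [set m | (n <= m)%N]].
    by exists n => // m /= nm; exists m.
  have b : nbhs c (ball c n.+1%:R^-1) by apply: nbhsx_ballx; rewrite invr_gt0.
  by have [_ [[m /= nm <-] fm]] := cl _ _ h b; exists m.
exists (v \o k), c; split => //.
- by move=> n /=; apply: le_lt_trans (vP (k n)).1; rewrite ler_nat; case: (kP n).
- by move=> n /=; case: (vP (k n)).
- apply/cvgrPdist_le => e e0.
  have /cvgrPdist_le/(_ e e0) := @cvg_harmonic R.
  apply: filterS => n /=; rewrite sub0r normrN ger0_norm ?invr_ge0// => h.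
  by apply: le_trans h; apply: ltW; case: (kP n).
Qed.

Lemma not_cvg_pinfty (R : realType) (f : R -> R) : ~ (f x @[x --> +oo] --> +oo) ->
  exists K, forall b, exists2 x, b < x & f x < K.
Proof.
move=> nf; apply: contrapT => h; apply: nf; apply/cvgryPge => K.
apply: contrapT => hK; apply: h; exists K => b; apply: contrapT => hb; apply: hK.
exists b; split; first exact: num_real.
by move=> x bx; rewrite leNgt; apply/negP => fx; apply: hb; exists x.
Qed.

Section occupation_bounds.
Context (R : realType) (d : nat) (d_gt0 : (0 < d)%N) (H : R -> set (Rd R d)) (lam : R)
  (lam_gt0 : 0 < lam) (mH : measurable (H lam)) (Hsym : H lam = @topp R d @` H lam).

Lemma occupation_le u v : 0 <= u -> u <= v -> occupation H u lam <= occupation H v lam.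
Proof.
move=> u0 uv; have mI w : measurable (H lam `&` cube w).
  by apply: measurableI => //; exact: measurable_cube.
have fin w : lebesgue_Rd R d (H lam `&` cube w) \is a fin_num.
  rewrite ge0_fin_numE//; apply: (@le_lt_trans _ _ (lebesgue_Rd R d (cube w))).
    by apply: le_measure; rewrite ?inE//; exact: measurable_cube.
  by rewrite lebesgue_cube// ltry.
apply: fine_le => //; apply: le_measure; rewrite ?inE//.
by apply: setIS; exact: subset_cube.
Qed.

Lemma mean_edges_le : mean_edges lam (H lam) <= lam * hat_deg lam (H lam).
Proof.
have mW : measurable (cube 1 : set (Rd R d)) := @measurable_cube R d 1.
have muW : intensity d lam (cube 1) = lam%:E.
  by rewrite (intensityE lam_gt0) lebesgue_cube// powR1 expr1n mule1.
have := product_row_le (measurable_edge_set mH) (hat_deg_ge0 lam_gt0 (H lam))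
  (xsection_edge_set_le d_gt0 lam_gt0 mH Hsym) mW.
rewrite (_ : _ `&` _ = edge_set (H lam)); last first.
  by apply/seteqP; split => [z []//|z Cz]; split => //; case: Cz.
rewrite [X in (_ <= _ * X)%E]muW -EFinM mulrC => h.
rewrite -lee_fin /mean_edges fineK//.
by rewrite ge0_fin_numE//; apply: le_lt_trans h _; rewrite ltry.
Qed.

End occupation_bounds.

(** * Gaussian mass of a left tail *)

Section normal_tail.
Context (R : realType).

Lemma normal_prob_itv_gt0 (l u : R) : l < u -> (0 < normal_prob (0 : R) 1 `[l, u]%classic)%E.
Proof.
(* A lower bound of the density on the interval, where [x ^+ 2 <= l ^+ 2 + u ^+ 2] whatever the
   signs of the endpoints. *)
move=> lu; pose k := normal_peak 1 * expR (- (l ^+ 2 + u ^+ 2)) : R.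
have k0 : 0 < k by rewrite mulr_gt0 ?expR_gt0// normal_peak_gt0// oner_neq0.
have mI : measurable (`[l, u]%classic : set (measurableTypeR R)) by exact: measurable_itv.
apply: (@lt_le_trans _ _ (\int[lebesgue_measure]_(x in `[l, u]%classic) (k%:E : \bar R))%E).
  rewrite integral_cst//= lebesgue_measure_itv/= lte_fin lu -EFinB mule_gt0// lte_fin//.
  by rewrite subr_gt0.
apply: ge0_le_integral => //=.
- by move=> x _; rewrite lee_fin ltW.
- apply: measurable_funTS; apply/measurable_EFinP; exact: measurable_normal_pdf.
move=> x; rewrite in_itv/= => /andP[lx xu].
rewrite lee_fin normal_pdfE ?oner_neq0// ler_wpM2l ?normal_peak_ge0//.
rewrite /normal_fun ler_expR subr0 expr1n mulNr lerN2.
have x0 := sqr_ge0 x.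
have : x ^+ 2 <= l ^+ 2 + u ^+ 2 by have [x_ge0|x_lt0] := leP 0 x; nra.
rewrite ler_pdivrMr//; lra.
Qed.

Lemma normal_left_tail (b : R) : exists h : R -> R,
  [/\ continuous h, forall x, `|h x| <= 1, forall x, b <= x -> h x = 0 &
      (0 < 'E_(normal_prob (0 : R) 1)[h \o (fun x => x)])%E].
Proof.
(* [h] is 1 up to [b - 1] and 0 from [b] on, so its mean is at least the mass of a bounded interval
   ending at [b - 1]. *)
pose h x := Num.min 1 (Num.max 0 (b - x)).
have hc : continuous h.
  move=> x; apply: (@continuous_min _ _ (fun=> 1) (fun x => Num.max 0 (b - x))).
    exact: cvg_cst.
  apply: (@continuous_max _ _ (fun=> 0) (fun x => b - x)); first exact: cvg_cst.
  by apply: (@cvgB _ R^o); [exact: cvg_cst|exact: cvg_id].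
have h0 x : 0 <= h x by rewrite /h le_min ler01 le_max lexx.
have h1 x : `|h x| <= 1 by rewrite ger0_norm// /h ge_min lexx.
exists h; split => //.
  by move=> x bx; rewrite /h max_l ?subr_le0// min_r.
have Ih : itg (normal_prob (0 : R) 1) h.
  by apply: (@itg_bnd _ _ _ _ _ 1) => //; exact: continuous_measurable_fun.
rewrite (expectation_off_null (measurable0 : measurable (set0 : set (measurableTypeR R)))
  (measure0 _) Ih)// lte_fin.
have mI : measurable (`[b - 2, b - 1]%classic : set (measurableTypeR R)) by exact: measurable_itv.
have bb : b - 2 < b - 1 by lra.
apply: (@lt_le_trans _ _ (fine (normal_prob (0 : R) 1 `[b - 2, b - 1]%classic))).
  rewrite fine_gt0// normal_prob_itv_gt0//=.
  exact: (le_lt_trans (probability_le1 (normal_prob (0 : R) 1) mI) (ltry 1)).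
rewrite -[leLHS](Ex_indic (normal_prob (0 : R) 1) mI).
apply: Ex_le => //; first exact: itg_indic.
move=> x; rewrite indicE; case: (boolP (_ \in _)) => [|_]; last exact: h0.
rewrite inE/= in_itv/= => /andP[_ xb]; rewrite /h le_min lexx le_max/=.
by apply/orP; right; lra.
Qed.

End normal_tail.

(** * Convergence in law of almost sure versions, and conclusion *)

Lemma cvg_in_law_off_null (R : realType) (dO : measure_display) (Omega : measurableType dO)
    (P : probability Omega R) (X g : nat -> Omega -> R)
    (d' : measure_display) (T' : measurableType d') (Q : probability T' R) (Y : T' -> R) :
  (forall n, exists N, [/\ measurable N, P N = 0%E & forall w, ~ N w -> X n w = g n w]) ->
  (forall n, measurable_fun setT (g n)) -> measurable_fun setT Y ->
  (forall (h : R -> R) M, continuous h -> (forall x, `|h x| <= M) ->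
    Ex P (fun w => h (g n w)) @[n --> \oo] --> Ex Q (fun w => h (Y w))) ->
  cvg_in_law P \oo X Q Y.
Proof.
move=> Xg mg mY cv h hc [M hM].
have I (dU : measure_display) (U : measurableType dU) (S : probability U R) (f : U -> R) :
    measurable_fun setT f -> itg S (h \o f).
  move=> mf; apply: (@itg_bnd _ _ _ _ _ M) => [|w]; last exact: hM.
  by apply: measurableT_comp => //; exact: continuous_measurable_fun.
have -> : ('E_Q[h \o Y] = (Ex Q (fun w => h (Y w)))%:E)%E.
  exact: (expectation_off_null measurable0 (measure0 Q) (I _ _ _ _ mY)).
have -> : (fun n => 'E_P[h \o X n]%E) = EFin \o (fun n => Ex P (fun w => h (g n w))).
  apply/funext => n; have [N [mN N0 NX]] := Xg n.
  by apply: (expectation_off_null mN N0 (I _ _ _ _ (mg n))) => w /NX /= ->.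
by apply: cvg_EFin; [exact: nearW|exact: cv hM].
Qed.

Theorem theorem4p14 (R : realType) (d : nat) (d_ge1 : (1 <= d)%N)
  (dO : measure_display) (Omega : measurableType dO) (P : probability Omega R)
  (eta : R -> R.-ker Omega ~> Rd R d)
  (eta_points : forall lam : R, 0 < lam ->
     forall w, locally_finite_point_measure (eta lam w))
  (eta_poisson : forall lam : R, 0 < lam ->
     poisson_measure P (eta lam) (intensity d lam))
  (Hbar : R -> set (Rd R d))
  (Hbar_meas : forall lam : R, 0 < lam -> measurable (Hbar lam))
  (Hbar_sym : forall lam : R, 0 < lam -> Hbar lam = @topp R d @` Hbar lam)
  (Hbar_0 : forall lam : R, 0 < lam -> ~ Hbar lam tzero)
  (Hbar_pos : forall lam : R, 0 < lam ->
     (0 < lebesgue_Rd R d (Hbar lam `&` cube 1))%E)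
  (F1 F2 : R -> Omega -> R)
  (F1_int : forall lam : R, 0 < lam ->
     wiener_ito1 P (eta lam) (intensity d lam) (kernel1 Hbar lam) (F1 lam))
  (F2_int : forall lam : R, 0 < lam ->
     wiener_ito2 P (eta lam) (intensity d lam) (kernel2 Hbar lam) (F2 lam)) :
  let F := edge_stat eta Hbar in
  let F_tilde := fun lam => standardize P (F lam) in
  let psi := occupation Hbar 1 in
  let psi_check := occupation Hbar (1 / 2 ^+ d) in
  let psi_hat := occupation Hbar (2 ^+ d) in
  asymp psi_check psi_hat ->
  lam * psi lam @[lam --> +oo] --> (0 : R) ->
  ~ (lam ^+ 2 * psi lam @[lam --> +oo] --> +oo) ->
  (exists lam_ : nat -> R,
    [/\ forall n, 0 < lam_ n,
        lam_ n @[n --> \oo] --> +oo &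
        exists c : R,
        [/\ 0 <= c,
            ('V_P[F (lam_ n)])%E @[n --> \oo] --> (2 * c)%:E /\
            ('V_P[F2 (lam_ n)])%E @[n --> \oo] --> (2 * c)%:E,
            c = 0 ->
              ('E_P[fun w => `|F_tilde (lam_ n) w|%R])%E @[n --> \oo] --> 0%E &
            0 < c ->
              let X := fun k : nat => 2 * (k%:R - c / 2) : R in
              cvg_in_law P \oo (fun n => F2 (lam_ n))
                (poisson_prob (c / 2) 0%N) X /\
              cvg_in_law P \oo
                (fun n w => F (lam_ n) w - fine ('E_P[F (lam_ n)])%E)
                (poisson_prob (c / 2) 0%N) X]]) /\
  ~ cvg_in_law P +oo F_tilde (normal_prob (0 : R) 1) (fun x => x).
Proof.
move=> F F_tilde psi psi_check psi_hat [C [C' [C0 C'0 hasymp]]] hlp hdiv.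
pose D lam := hat_deg lam (Hbar lam); pose a lam := mean_edges lam (Hbar lam).
have psi_le lam : 0 < lam -> psi_check lam <= psi lam.
  move=> l0; apply: occupation_le; [exact: Hbar_meas|exact: divr_ge0|].
  by rewrite ler_pdivrMr// mul1r exprn_ege1// ler1n.
(* Comparability enters here: [psi_hat <= C' * psi_check <= C' * psi], as the smallest cube lies in
   the unit cube. *)
have D_le : \forall lam \near +oo, 0 < lam /\ D lam <= C' * (lam * psi lam).
  near=> lam; have l0 : 0 < lam by near: lam; exact: nbhs_pinfty_gt.
  split => //; rewrite mulrCA ler_wpM2l ?(ltW l0)//.
  apply: (@le_trans _ _ (C' * psi_check lam)); last by rewrite ler_wpM2l ?(ltW C'0)// psi_le.
  by have /andP[] : C * psi_check lam <= psi_hat lam <= C' * psi_check lam by near: lam.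
have D_cvg : D lam @[lam --> +oo] --> 0.
  apply/cvgrPdist_le => e e0.
  have /cvgrPdist_le/(_ (e / C') (divr_gt0 e0 C'0)) := hlp.
  apply: filterS2 D_le => lam [l0 Dle]; rewrite !sub0r !normrN => h.
  rewrite ger0_norm; last exact: hat_deg_ge0.
  apply: le_trans Dle _; rewrite mulrC -ler_pdivlMr//.
  by apply: le_trans h; exact: ler_norm.
(* The threshold that makes the variance differ from [2 * a] by at most [a], so that [a] is at most
   the variance. If [D <= 1 / 256], then the square root is at most [1 / 16], and
   [8 * (1 / 16 + 1 / 256) < 1]. *)
have D_small : \forall lam \near +oo, 8 * (Num.sqrt (D lam) + D lam) <= 1.
  have e0 : 0 < 256^-1 :> R by rewrite invr_gt0.
  have /cvgrPdist_le/(_ _ e0) := D_cvg.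
  apply: filterS2 D_le => lam [l0 _]; rewrite sub0r normrN => h.
  have {}h : D lam <= 256^-1 by apply: le_trans h; exact: ler_norm.
  have : Num.sqrt (D lam) <= 16^-1.
    rewrite -[leRHS](@ger0_norm _ (16^-1)) ?invr_ge0// -sqrtr_sqr ler_wsqrtr//.
    by apply: le_trans h _; rewrite exprVn lef_pV2 ?posrE// -natrX.
  lra.
have [K hK] := not_cvg_pinfty hdiv.
(* Where [lam ^+ 2 * psi lam < K], the mean satisfies [a <= lam * D <= C' * K], so compactness
   applies; the last condition holds at every point of the sequence, not only eventually. *)
pose A := [set lam | [/\ 0 < lam, 0 <= a lam <= C' * K & 8 * (Num.sqrt (D lam) + D lam) <= 1]].
have exA b : exists2 lam, b < lam & A lam.
  have [M1 [_ hM1]] := D_le; have [M2 [_ hM2]] := D_small.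
  have [lam] := hK (Num.max b (Num.max M1 M2)); rewrite !gt_max => /andP[bl /andP[/hM1[l0 Dle] /hM2 Ds]] lK.
  exists lam => //; split => //; rewrite mean_edges_ge0/=.
  apply: le_trans (mean_edges_le _ _ _ _) _ => //; [exact: Hbar_meas|exact: Hbar_sym|].
  apply: (@le_trans _ _ (lam * (C' * (lam * psi lam)))); first by rewrite ler_wpM2l ?(ltW l0).
  rewrite mulrCA ler_pM2l// mulrA -expr2; exact: ltW.
have [u [c [u_gt uA c0 ac]]] : exists (u : nat -> R) (c : R),
    [/\ forall n, n%:R < u n, forall n, A (u n), 0 <= c & a (u n) @[n --> \oo] --> c].
  by apply: (@cluster_sequence _ A a (C' * K) exA) => x [_ h _].
have u0 n : 0 < u n by case: (uA n).
have u_cvg : u n @[n --> \oo] --> +oo.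
  apply/cvgryPge => B; have /cvgryPge/(_ B) := @cvgr_idn R.
  by apply: filterS => n /le_trans; apply; exact: ltW.
have D0 : D (u n) @[n --> \oo] --> 0 by apply: (cvg_comp _ _ u_cvg).
pose G n := edge_num (eta_points _ (u0 n)) (Hbar (u n)).
have hN n : exists N, [/\ measurable N, P N = 0%E & forall w, ~ N w -> F (u n) w = (G n w)%:R].
  have [N [mN N0 NE]] := edge_num_off_null d_ge1 (u0 n) (eta_points _ (u0 n)) (eta_poisson _ (u0 n))
    (Hbar_meas _ (u0 n)) (Hbar_0 _ (u0 n)).
  by exists N; split => // w /NE[].
have mG n : measurable_fun setT (G n).
  exact: (measurable_edge_num (u0 n) _ (eta_poisson _ (u0 n)) (Hbar_meas _ (u0 n)) (Hbar_0 _ (u0 n))).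
have IG n : itg P (fun w => (G n w)%:R).
  exact: (itg_edge_num d_ge1 (u0 n) _ (eta_poisson _ (u0 n)) (Hbar_meas _ (u0 n)) (Hbar_0 _ (u0 n))).
have EG n : Ex P (fun w => (G n w)%:R) = a (u n).
  exact: (Ex_edge_num d_ge1 (u0 n) _ (eta_poisson _ (u0 n)) (Hbar_meas _ (u0 n)) (Hbar_0 _ (u0 n))).
have lF2 n : l2 P (F2 (u n)).
  exact: (l2_F2 d_ge1 (u0 n) (eta_points _ (u0 n)) (eta_poisson _ (u0 n)) (Hbar_meas _ (u0 n))
    (Hbar_sym _ (u0 n)) (Hbar_0 _ (u0 n)) (F2_int _ (u0 n))).
have EF2 n : Ex P (F2 (u n)) = 0.
  exact: (Ex_F2 d_ge1 (u0 n) (eta_points _ (u0 n)) (eta_poisson _ (u0 n)) (Hbar_meas _ (u0 n))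
    (Hbar_sym _ (u0 n)) (Hbar_0 _ (u0 n)) (F2_int _ (u0 n))).
have EF22 n : Ex P (fun w => F2 (u n) w ^+ 2) = 2 * a (u n).
  exact: (Ex_F2_sqr d_ge1 (u0 n) (eta_points _ (u0 n)) (eta_poisson _ (u0 n)) (Hbar_meas _ (u0 n))
    (Hbar_sym _ (u0 n)) (Hbar_0 _ (u0 n)) (F2_int _ (u0 n))).
have ZZ n := edge_chaos_rest d_ge1 (u0 n) (eta_points _ (u0 n)) (eta_poisson _ (u0 n))
  (Hbar_meas _ (u0 n)) (Hbar_sym _ (u0 n)) (Hbar_0 _ (u0 n)) (F2_int _ (u0 n)).
have rec n := edge_num_recursion d_ge1 (u0 n) (eta_points _ (u0 n)) (eta_poisson _ (u0 n))
  (Hbar_meas _ (u0 n)) (Hbar_sym _ (u0 n)) (Hbar_0 _ (u0 n)) (F2_int _ (u0 n)).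
have a_ge0 n : 0 <= a (u n) by exact: mean_edges_ge0.
have D_ge0 n : 0 <= D (u n) by exact: hat_deg_ge0.
pose V n := Ex P (fun w => ((G n w)%:R - a (u n)) ^+ 2).
have Vdist n : `|V n - 2 * a (u n)| <= 8 * a (u n) * (Num.sqrt (D (u n)) + D (u n)).
  exact: (variance_edges_dist (lF2 n) (EF22 n) (ZZ n).1 (ZZ n).2 (a_ge0 n) (D_ge0 n)).
have aV n : a (u n) <= V n.
  have [_ _ Ds] := uA n; have := Vdist n; rewrite ler_norml => /andP[h _].
  have := ler_wpM2l (a_ge0 n) Ds; lra.
have FE n : ('E_P[F (u n)] = (a (u n))%:E)%E.
  by have [N [mN N0 NF]] := hN n; exact: (expectation_edges mN N0 NF (IG n) (EG n)).
have FV n : ('V_P[F (u n)] = (V n)%:E)%E.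
  have [N [mN N0 NF]] := hN n.
  exact: (variance_edges mN N0 NF (EG n) (lF2 n) (ZZ n).1).
have VF2 n : ('V_P[F2 (u n)] = (2 * a (u n))%:E)%E.
  by have [N [mN N0 _]] := hN n; exact: (variance_double_integral mN N0 (lF2 n) (EF2 n) (EF22 n)).
have sqrtD0 : Num.sqrt (D (u n)) @[n --> \oo] --> 0.
  by rewrite -(@sqrtr0 R); apply: continuous_cvg => //; exact: sqrt_continuous.
have ac2 : 2 * a (u n) @[n --> \oo] --> 2 * c by apply: cvgM => //; exact: cvg_cst.
have Vc : V n @[n --> \oo] --> 2 * c.
  have h1 : 8 * a (u n) * (Num.sqrt (D (u n)) + D (u n)) @[n --> \oo] --> 0.
    apply: (@cvgn_zero_mul _ _ _ (8 * c)); first by apply: cvgM => //; exact: cvg_cst.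
    by rewrite -[X in _ --> X]addr0; apply: cvgD.
  have h2 : V n - 2 * a (u n) @[n --> \oo] --> 0 by exact: cvg0_le Vdist h1.
  have h3 : 2 * a (u n) + (V n - 2 * a (u n)) @[n --> \oo] --> 2 * c + 0 by apply: cvgD.
  by rewrite addr0 in h3; apply: eq_cvgn h3 => n; rewrite addrC subrK.
have sqrta : Num.sqrt (a (u n)) @[n --> \oo] --> Num.sqrt c.
  by apply: continuous_cvg => //; exact: sqrt_continuous.
split.
  exists u; split => //; exists c; split => //.
  - split.
      have -> : (fun n => 'V_P[F (u n)]%E) = EFin \o V by apply/funext => n; exact: FV.
      by apply: cvg_EFin => //; exact: nearW.
    have -> : (fun n => 'V_P[F2 (u n)]%E) = EFin \o (fun n => 2 * a (u n)).
      by apply/funext => n; exact: VF2.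
    by apply: cvg_EFin => //; exact: nearW.
  - move=> c_eq0.
    have /choice[y yP] : forall n, exists y : R,
        [/\ ('E_P[fun w => `|F_tilde (u n) w|%R] = y%:E)%E, 0 <= y & y <= 2 * Num.sqrt (a (u n))].
      move=> n; have [N [mN N0 NF]] := hN n.
      exact: (expectation_abs_standardize_edges mN N0 NF (IG n) (EG n) (lF2 n) (ZZ n).1 (a_ge0 n) (aV n)).
    have -> : (fun n => 'E_P[fun w => `|F_tilde (u n) w|%R]%E) = EFin \o y.
      by apply/funext => n; case: (yP n).
    apply: cvg_EFin; first exact: nearW.
    apply: (@cvg0_le _ _ (fun n => 2 * Num.sqrt (a (u n)))) => [n|].
      by have [_ y0 yle] := yP n; rewrite ger0_norm.
    by apply: cvgn_cst_mul0; move: sqrta; rewrite c_eq0 sqrtr0.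
  - move=> c_gt0 X.
    have lc := law_even mG IG EG rec c_gt0 ac D0.
    have ca : c - a (u n) @[n --> \oo] --> 0.
      by rewrite -(subrr c); apply: cvgB => //; exact: cvg_cst.
    have ca2 : (c - a (u n)) ^+ 2 @[n --> \oo] --> 0.
      by apply: eq_cvgn (cvgn_zero_mul ca ca) => n; rewrite expr2.
    have mX : measurable_fun setT X by [].
    (* Both variables are within vanishing L^2 distance of [G n - c]: the first through the chaos
       remainder and [c - a], the second through [c - a] alone. *)
    split.
    + apply: (cvg_in_law_off_null (g := fun n => F2 (u n))) => //.
      * by move=> n; exists set0; split.
      * by move=> n; case: (lF2 n).
      move=> h M hc hM.
      apply: (weak_cvg mG lc _ _ _ hc hM); first by move=> n; case: (lF2 n).
        by move=> n; case: (double_integral_dist (lF2 n) (ZZ n).1 (ZZ n).2 c).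
      apply: (@cvg0_le _ _ (fun n => 2 * (c - a (u n)) ^+ 2 + 16 * D (u n) * a (u n))) => [n|].
        rewrite ger0_norm; last by apply: Ex_ge0 => w; exact: sqr_ge0.
        by case: (double_integral_dist (lF2 n) (ZZ n).1 (ZZ n).2 c).
      rewrite -[X in _ --> X]addr0; apply: cvgD; first exact: cvgn_cst_mul0.
      apply: (eq_cvgn (f := fun n => a (u n) * (16 * D (u n)))); first by move=> n; rewrite mulrC.
      by apply: (cvgn_zero_mul ac); exact: cvgn_cst_mul0.
    + apply: (cvg_in_law_off_null (g := fun n w => (G n w)%:R - a (u n))) => //.
      * move=> n; have [N [mN N0 NF]] := hN n; exists N; split => // w Nw.
        by rewrite FE NF.
      * by move=> n; apply: measurable_funB => //; exact: itg_meas (IG n).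
      move=> h M hc hM.
      apply: (weak_cvg mG lc _ _ _ hc hM).
      * by move=> n; apply: measurable_funB => //; exact: itg_meas (IG n).
      * by move=> n; case: (centered_edges_dist P (G n) (a (u n)) c).
      apply: eq_cvgn ca2 => n.
      by case: (centered_edges_dist P (G n) (a (u n)) c).
move=> clt.
(* Eventually [a (u n) <= c + 1], so the standardized count is almost surely at least this threshold
   and [h] has mean 0 along the sequence, whereas its Gaussian mean is positive. This covers [c = 0]
   and [c > 0] at once. *)
have [h [hc h1 h0 hpos]] := normal_left_tail (- (Num.sqrt (c + 1))).
have cv : ('E_P[h \o F_tilde (u n)])%E @[n --> \oo] -->
    ('E_(normal_prob (0 : R) 1)[h \o (fun x => x)])%E.
  apply: (cvg_comp _ _ u_cvg (clt h hc _)); by exists 1.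
have cv0 : ('E_P[h \o F_tilde (u n)])%E @[n --> \oo] --> (0 : \bar R)%E.
  apply: (cvg_trans _ (@cvg_cst _ (0 : \bar R)%E _ \oo _)).
  apply: near_eq_cvg; near=> n.
  have ac1 : a (u n) <= c + 1.
    near: n; have /cvgrPdist_le/(_ _ ltr01) := ac; apply: filterS => n.
    rewrite ler_norml => /andP[? ?]; lra.
  have [N [mN N0 NF]] := hN n; apply/esym.
  rewrite (expectation_off_null mN N0 (itg_cst P 0)) ?Ex_cst// => w Nw.
  apply: h0; apply: le_trans (_ : - Num.sqrt (a (u n)) <= _).
    by rewrite lerN2 ler_wsqrtr.
  exact: (standardize_edges_ge mN N0 NF (IG n) (EG n) (lF2 n) (ZZ n).1 (a_ge0 n) (aV n)).
have E0 := cvg_unique (@ereal_hausdorff R) cv cv0; by rewrite E0 ltxx in hpos.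
Unshelve. all: by end_near. Qed.
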